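(* Consider the sparse deconvolution model of the context with $\mu_n=n^{\nu-1}$, $1/2<\nu<1$, and $\Phi_\mu=\int\varphi(x)f_0(x)\,dx$; let $s\ge0$, $B>0$. Let $g$ be bounded above and such that $|g(\theta)|\ge c_1(\theta^2+1)^{-\varsigma}$ for all $\theta$, for some $c_1>0$ and $\varsigma$, and let $\varsigma_0$ be the closest integer no less than $\varsigma$. Suppose there are constants $C_{g2}>0$, $C_{\varphi1}>0$ and non-negative $\alpha,\beta,\gamma,a,b,d$ (with $\alpha>0$ and $\beta=0$ whenever $\gamma=0$, and $b=0$ whenever $d=0$) such that for all $\omega\in\mathbb R$ $$|g^*(\omega)|\le C_{g2}(\omega^2+1)^{-\alpha/2}e^{-\gamma|\omega|^\beta},\qquad|\varphi^*(\omega)|\ge C_{\varphi1}(\omega^2+1)^{-a/2}e^{-d|\omega|^b}.$$ Let $g^*$ be $\varsigma_0$ times continuously differentiable and, for some $c_2>0$ and $\tau\ge0$ with $\tau=0$ if $\gamma=0$, $$\Big|\frac{d^lg^*(\omega)}{d\omega^l}\Big|\le c_2|g^*(\omega)|(1+|\omega|)^{\tau l},\quad l=1,2,\dots,\varsigma_0.$$ Let there exist $\omega_0\in(0,\infty)$ such that $\rho(\omega)=\arg(\varphi^*(\omega))$ is $\varsigma_0$ times continuously differentiable for $|\omega|\ge\omega_0$, with $|\rho^{(j)}(\omega)|\le\rho<\infty$, $j=0,1,\dots,\varsigma_0$. Let $$R_{n,\mu_n}(\Omega_s(B))=\inf_{\widetilde\Phi_\mu}\sup_{f_0\in\Omega_s(B)}\mathbb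 E(\widetilde\Phi_\mu-\Phi_\mu)^2,$$ the infimum being over all estimators based on $Y_1,\dots,Y_n$. Then, with a constant $C>0$ independent of $n$, $$R_{n,\mu_n}(\Omega_s(B))\ge\begin{cases} Cn^{-(2\nu-1)}&\text{if } b>\beta,\\ Cn^{-(2\nu-1)}&\text{if } b=\beta,\ d>\gamma>0,\\ Cn^{-(2\nu-1)}&\text{if } b=\beta,\ d=\gamma,\ a\ge\alpha+1/2,\\ Cn^{-\frac{(2\nu-1)(2s+2a-1)}{2s+2\alpha}}&\text{if } d=\gamma=0,\ a<\alpha+1/2,\\ C(\log n)^{-U_5/\beta}\,n^{-\frac{d(2\nu-1)}\gamma}&\text{if } b=\beta,\ \gamma>d>0,\\ C(\log n)^{-U_6/\beta}\exp\!\Big(-2d\big[\tfrac{(2\nu-1)\log n}{2\gamma}\big]^{b/\beta}\Big)&\text{if } b<\beta,\ d>0,\ \gamma>0,\\ C(\log n)^{-\frac{2s+2a-1}\beta}&\text{if } b=d=0,\ \beta>0,\ \gamma>0, \end{cases}$$ where $U_5=2a+2s(1-d/\gamma)-2d\alpha/\gamma+4\beta(\varsigma_0+1)-(U_{\tau,\varsigma_0}+1)d/\gamma-1$, $U_6=4b(\varsigma_0+1)+2a+2s-1$ and $U_{\tau,\varsigma_0}=\min(\beta(4\varsigma_0+3)-2\tau\varsigma_0-1,\ \beta(2\varsigma_0+3)+2\varsigma_0-1)$.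
   Context: Model: $Y_i=\theta_i+\xi_i$, $i=1,\dots,n$, where $\xi_i$ are i.i.d. with known pdf $g$, independent of the i.i.d. $\theta_i$, whose distribution is $f(x)=\mu_nf_0(x)+(1-\mu_n)\delta(x)$; here $\delta$ is the Dirac delta at $0$, $\mu_n$ is known and $f_0$ is an unknown pdf. For a function $t$, $t^*(\omega)=\int e^{i\omega x}t(x)\,dx$. $\varphi$ is a known real function with Fourier transform $\varphi^*$; it is assumed that $\int\varphi f_0=\frac1{2\pi}\int f_0^*(\omega)\varphi^*(-\omega)\,d\omega$ with an absolutely convergent integral. $\Omega_s(B)$ is the set of pdfs $f_0$ with $\int|f_0^*(\omega)|^2(\omega^2+1)^s\,d\omega\le B^2$. The bounds are asymptotic, i.e. for all sufficiently large $n$; in cases where $\beta$ appears in a denominator, $\beta>0$ is understood. *)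

(* Defs.v *)
From HB Require Import structures.
From mathcomp Require Import all_boot all_order all_algebra.
From mathcomp Require Import complex.
From mathcomp Require Import all_classical all_reals all_analysis.
From mathcomp Require Import measurable_realfun.

Set Implicit Arguments.
Unset Strict Implicit.
Unset Printing Implicit Defensive.

Import Order.TTheory GRing.Theory Num.Theory.
Import numFieldNormedType.Exports.

Local Open Scope classical_set_scope.
Local Open Scope ring_scope.
Local Open Scope complex_scope.

Record pdf (R : realType) := Pdf {
  pdf_fun :> R -> R ;
  measurable_pdf : measurable_fun [set: R] pdf_fun ;
  pdf_ge0 : forall x, 0 <= pdf_fun x ;
  integral_pdf : (\int[lebesgue_measure]_x (pdf_fun x)%:E = 1)%E }.

Definition pdf_prob (R : realType) (f : pdf R) (A : set (measurableTypeR R)) :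
    \bar R :=
  (\int[lebesgue_measure]_(x in A) (f x)%:E)%E.

Section pdf_prob.
Context (R : realType) (f : pdf R).

Let pdf_prob0 : pdf_prob f set0 = 0%E.
Proof. by rewrite /pdf_prob integral_set0. Qed.

Let pdf_prob_ge0 A : (0 <= pdf_prob f A)%E.
Proof. by apply: integral_ge0 => x _; rewrite lee_fin pdf_ge0. Qed.

Let pdf_prob_sigma_additive : semi_sigma_additive (pdf_prob f).
Proof.
move=> /= F mF tF mUF; rewrite /pdf_prob; apply: cvg_toP.
  apply: ereal_nondecreasing_is_cvgn => m n mn.
  apply: lee_sum_nneg_natr => // k _ _; apply: integral_ge0 => /= x Fkx.
  by rewrite lee_fin pdf_ge0.
rewrite ge0_integral_bigcup//=.
- apply/measurable_funTS/measurableT_comp => //.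
  exact: measurable_pdf.
- by move=> x _; rewrite lee_fin pdf_ge0.
Qed.

HB.instance Definition _ := isMeasure.Build _ _ _ (pdf_prob f)
  pdf_prob0 pdf_prob_ge0 pdf_prob_sigma_additive.

Let pdf_probT : pdf_prob f [set: _] = 1%E.
Proof. exact: integral_pdf. Qed.

HB.instance Definition _ :=
  @Measure_isProbability.Build _ _ R (pdf_prob f) pdf_probT.

End pdf_prob.

Definition mix_prob d (T : measurableType d) (R : realType) (p : {i01 R})
    (P Q : probability T R) : set T -> \bar R :=
  fun A => (p%:num%:E * P A + (1 - p%:num)%:E * Q A)%E.

Section mix_prob.
Context d (T : measurableType d) (R : realType).
Variables (p : {i01 R}) (P Q : probability T R).

Let onem_p_ge0 : 0 <= 1 - p%:num.
Proof. by rewrite subr_ge0. Qed.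

Let mix_probE : mix_prob p P Q =
  measure_add (mscale p%:num%:nng P) (mscale (NngNum onem_p_ge0) Q).
Proof. by apply/funext => A; rewrite measure_addE. Qed.

Let mix_prob0 : mix_prob p P Q set0 = 0%E.
Proof. by rewrite mix_probE; exact: measure0. Qed.

Let mix_prob_ge0 A : (0 <= mix_prob p P Q A)%E.
Proof. by rewrite mix_probE; exact: measure_ge0. Qed.

Let mix_prob_sigma_additive : semi_sigma_additive (mix_prob p P Q).
Proof. by rewrite mix_probE; exact: measure_semi_sigma_additive. Qed.

HB.instance Definition _ := isMeasure.Build _ _ _ (mix_prob p P Q)
  mix_prob0 mix_prob_ge0 mix_prob_sigma_additive.

Let mix_probT : mix_prob p P Q [set: T] = 1%E.
Proof.
by rewrite /mix_prob !probability_setT !mule1 -EFinD addrC subrK.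
Qed.

HB.instance Definition _ :=
  @Measure_isProbability.Build _ _ R (mix_prob p P Q) mix_probT.

End mix_prob.

Section obs_fun.
Context (R : realType).

Definition obs_fun (x : measurableTypeR R * measurableTypeR R) : R :=
  x.1 + x.2.

Let measurable_obs_fun : measurable_fun [set: _] obs_fun.
Proof. exact: measurable_funD. Qed.

HB.instance Definition _ := isMeasurableFun.Build _ _ _ _ obs_fun
  measurable_obs_fun.

End obs_fun.

(* The common law of the Y_i = theta_i + xi_i, where theta_i has law
   p * f0(x)dx + (1 - p) * delta_0 and xi_i is independent with density g. *)
Definition obs_law (R : realType) (g : pdf R) (p : {i01 R}) (f0 : pdf R) :
    probability R R :=
  distribution
    (product_measure1 (mix_prob p (pdf_prob f0) (dirac (0%R : measurableTypeR R))) (pdf_prob g))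
    (@obs_fun R).

Section tuple_cons.
Context d (T : measurableType d) (n : nat).

Definition tuple_cons (x : T * n.-tuple T) : n.+1.-tuple T :=
  [tuple of x.1 :: x.2].

Let measurable_tuple_cons : measurable_fun [set: T * n.-tuple T] tuple_cons.
Proof. exact: measurable_cons. Qed.

HB.instance Definition _ := isMeasurableFun.Build _ _ _ _ tuple_cons
  measurable_tuple_cons.

End tuple_cons.

(* n-fold product measure: the law of n independent draws from P. *)
Fixpoint iid_law d (T : measurableType d) (R : realType)
    (P : probability T R) (n : nat) : probability (n.-tuple T) R :=
  match n with
  | 0 => dirac [tuple]
  | m.+1 => distribution (product_measure1 P (iid_law P m)) (@tuple_cons _ T m)
  end.

Section fourier.
Context (R : realType).
Notation leb := (@lebesgue_measure R).

Definition fourier_on (A : set R) (t : R -> R) (w : R) : R[i] :=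
  (\int[leb]_(x in A) (cos (w * x) * t x))%R +i*
  (\int[leb]_(x in A) (sin (w * x) * t x))%R.

Definition fourier : (R -> R) -> R -> R[i] := fourier_on [set: R].

(* psi is the Fourier transform of t.  As t need not be absolutely integrable,
   the defining integral is read as the limit of the integrals over [-M, M],
   for almost every w; for integrable t this is psi = fourier t a.e. *)
Definition is_fourier (t : R -> R) (psi : R -> R[i]) : Prop :=
  (forall M : R, leb.-integrable `[- M, M] (EFin \o t)) /\
  {ae leb, forall w,
    complex.Re (fourier_on `[- M, M] t w) @[M --> +oo] --> complex.Re (psi w) /\
    complex.Im (fourier_on `[- M, M] t w) @[M --> +oo] --> complex.Im (psi w)}.

Definition cintegrable (h : R -> R[i]) : Prop :=
  leb.-integrable [set: R] (fun w => (complex.Re (h w))%:E) /\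
  leb.-integrable [set: R] (fun w => (complex.Im (h w))%:E).

Definition cintegral (h : R -> R[i]) : R[i] :=
  (\int[leb]_w complex.Re (h w))%R +i* (\int[leb]_w complex.Im (h w))%R.

Definition cderiv1n (l : nat) (h : R -> R[i]) (w : R) : R[i] :=
  derive1n l (fun v => complex.Re (h v)) w +i*
  derive1n l (fun v => complex.Im (h v)) w.

Definition Ck_on (k : nat) (D : set R) (h : R -> R) : Prop :=
  forall x, D x ->
    (forall j, (j < k)%N -> derivable (derive1n j h) x 1) /\
    {for x, continuous (derive1n k h)}.

Definition Omega (s B : R) : set (pdf R) := [set f0 |
  (\int[leb]_w
     (ComplexField.Normc.normc (fourier f0 w) ^+ 2 * (w ^+ 2 + 1) `^ s)%:E
   <= (B ^+ 2)%:E)%E].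

Definition Phi (phi : R -> R) (f0 : pdf R) : R :=
  (\int[leb]_x (phi x * f0 x))%R.

Definition parseval_at (phi : R -> R) (phis : R -> R[i]) (f0 : pdf R) : Prop :=
  [/\ leb.-integrable [set: R] (fun x => (phi x * f0 x)%:E),
      cintegrable (fun w => fourier f0 w * phis (- w)) &
      (Phi phi f0)%:C =
        ((2 * pi)^-1)%:C * cintegral (fun w => fourier f0 w * phis (- w))].

(* The estimators are the measurable functions of the sample (Y_1, ..., Y_n). *)
Definition minimax_risk (g : pdf R) (phi : R -> R) (F : set (pdf R))
    (p : {i01 R}) (n : nat) : \bar R :=
  ereal_inf [set ereal_sup
      [set (\int[iid_law (obs_law g p f0) n]_y
              ((est y - Phi phi f0) ^+ 2)%:E)%E | f0 in F]
    | est in [set e : n.-tuple R -> R | measurable_fun setT e]].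

End fourier.

(* Main.v *)
(* Two-point argument. Starting at a frequency m, put N adjacent windows of width
   2w and let pert be the function whose Fourier transform is, on each window, a
   smooth bump of height dl with the phase of phis at the centre of the window.
   The phase rho of phis has a bounded derivative, so for small w the functional
   separates the densities base + pert and base - pert by a multiple of
   dl N w m^-a exp(-d m^b), by Parseval's formula. The density g is at least
   c1 (1+x^2)^-varsigma, so the chi-square distance of the two laws of one
   observation is at most mu_n^2 times the integral of
   (1+x^2)^varsigma0 (g * pert)^2. Multiplication by x being differentiation of the
   Fourier transform, varsigma0 integrations by parts on each window and Bessel's
   inequality bound it by
   mu_n^2 dl^2 N w (w^-varsigma0 + m^(tau varsigma0))^2 m^(-2 alpha) exp(-2 gamma m^beta).
   As long as n times this stays bounded, the risk is at least a constant times the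
   squared separation, and the cases of the theorem are obtained by optimizing m:
   m fixed gives the parametric rate; otherwise m^(2s+2alpha) is of order
   n^(2nu-1), or m^beta is of order log n with a log log correction.
   Membership in the Sobolev class forces dl^2 N w m^(2s) to be bounded. *)
From HB Require Import structures.
Require Import Defs.
From mathcomp Require Import all_boot all_order all_algebra.
From mathcomp Require Import complex.
From mathcomp Require Import all_classical all_reals all_analysis.
From mathcomp Require Import measurable_realfun.
From mathcomp Require Import ring lra.

Set Implicit Arguments.
Unset Strict Implicit.
Unset Printing Implicit Defensive.

Import Order.TTheory GRing.Theory Num.Theory.
Import numFieldNormedType.Exports.

Local Open Scope classical_set_scope.
Local Open Scope ring_scope.

(** The obstacle is positivity: base + pert and base - pert must both be densities of the Sobolev
    class. A smooth bump of frequency width w has a kernel with tails of order x^-2, so a Cauchy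
    density of scale 1/w dominates pert as long as dl N is small. For b < 1 this is not enough: the
    windows are to cover a length of order m^(1-b), the largest over which exp(-d y^b) loses only a
    constant factor, so N is of order m^(1-b) while dl is of order m^-s N^(-1/2), and dl N is
    unbounded for small s. There the modulus of pert is added to the base. It is not smooth, but its
    increments are at most those of pert, which controls its Sobolev norm up to order 1; for s > 1
    the Cauchy density suffices again, as m^-s N^(1/2) stays bounded. The sparsity enters through
    the atom at 0: whatever f0 is, one observation has density at least (1 - mu_n) g, so g alone is
    the chi-square weight and mu_n enters squared, as n mu_n^2 = n^(2 nu - 1). All Fourier facts are
    obtained by damping with exp(-e |x|), which turns inverse transforms into convolutions with the
    Poisson kernel. *)

(** * Translations and reflections of Lebesgue measure *)

Section reflect_shift.
Context (R : realType).
Notation leb := (@lebesgue_measure R).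

(** The boolean sign treats translations ([false]) and reflections ([true]) by one change of
    variables. *)
Definition sgaff (b : bool) (c x : measurableTypeR R) : measurableTypeR R :=
  (-1) ^+ b * x + c.

Lemma measurable_sgaff b c : measurable_fun setT (sgaff b c).
Proof. by apply: measurable_funD => //; apply: measurable_funM. Qed.

HB.instance Definition _ b c := isMeasurableFun.Build _ _ _ _ (sgaff b c)
  (measurable_sgaff b c).

Lemma lebesgue_measure_sgaff b c A : measurable A ->
  leb A = pushforward leb (sgaff b c) A.
Proof.
apply: lebesgue_measure_unique => X [[x y] _ <-].
rewrite [RHS](_ : _ = leb (sgaff b c @^-1` `]x, y])) //.
case: b.
  rewrite (_ : _ @^-1` _ = [set` `[c - y, c - x[ ]); last first.
    by apply/seteqP; split=> z /=; rewrite /sgaff !in_itv/= expr1 mulN1r;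
       move=> /andP[? ?]; apply/andP; split; lra.
  rewrite !lebesgue_measure_itv/= !lte_fin !ltrD2l ltrN2.
  by case: ifP => // _; rewrite -!EFinB; congr EFin; ring.
rewrite (_ : _ @^-1` _ = [set` `]x - c, y - c] ]); last first.
  by apply/seteqP; split=> z /=; rewrite /sgaff !in_itv/= expr0 mul1r;
     move=> /andP[? ?]; apply/andP; split; lra.
rewrite !lebesgue_measure_itv/= !lte_fin ltrD2r.
by case: ifP => // _; rewrite -!EFinB; congr EFin; ring.
Qed.

Lemma ge0_integral_sgaff b c (f : R -> \bar R) : measurable_fun setT f ->
  (forall x, 0 <= f x)%E ->
  (\int[leb]_x f x = \int[leb]_x f (sgaff b c x))%E.
Proof.
move=> mf f0.
rewrite (eq_measure_integral (pushforward leb (sgaff b c))); last first.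
  by move=> A mA _; apply: lebesgue_measure_sgaff.
by rewrite ge0_integral_pushforward.
Qed.

Lemma integral_sgaff b c (f : R -> \bar R) : measurable_fun setT f ->
  (\int[leb]_x f x = \int[leb]_x f (sgaff b c x))%E.
Proof.
move=> mf; rewrite integralE [RHS]integralE.
rewrite (funepos_comp f (sgaff b c)) (funeneg_comp f (sgaff b c)) /=.
by rewrite -!ge0_integral_sgaff //; [exact: measurable_funeneg | exact: measurable_funepos].
Qed.

Lemma ge0_integralZl_leb (k : R) (f : R -> \bar R) : measurable_fun setT f ->
  (forall x, 0 <= f x)%E -> 0 <= k ->
  (\int[leb]_x (k%:E * f x) = k%:E * \int[leb]_x f x)%E.
Proof. by move=> mf f0 k0; rewrite ge0_integralZl. Qed.

Lemma ge0_integralD_leb (f h : R -> \bar R) : measurable_fun setT f ->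
  (forall x, 0 <= f x)%E -> measurable_fun setT h ->
  (forall x, 0 <= h x)%E ->
  (\int[leb]_x (f x + h x) = \int[leb]_x f x + \int[leb]_x h x)%E.
Proof. by move=> mf f0 mh h0; rewrite ge0_integralD. Qed.

Lemma ge0_le_integral_leb (f h : R -> \bar R) :
  (forall x, 0 <= f x)%E -> measurable_fun setT f -> measurable_fun setT h ->
  (forall x, f x <= h x)%E -> (\int[leb]_x f x <= \int[leb]_x h x)%E.
Proof. by move=> f0 mf mh fh; apply: ge0_le_integral. Qed.

End reflect_shift.

(** * The density of one observation *)

Section obs_density.
Context (R : realType).
Notation leb := (@lebesgue_measure R).
Implicit Types (f g : pdf R).
Import HBNNSimple.

Lemma measurable_pdfE f : measurable_fun setT (EFin \o f).
Proof. by apply/measurable_EFinP; exact: measurable_pdf. Qed.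

Lemma integral_pdf_prob_nnsfun f (h : {nnsfun measurableTypeR R >-> R}) :
  (\int[pdf_prob f]_x (h x)%:E = \int[leb]_x ((h x)%:E * (f x)%:E))%E.
Proof.
have mf := measurable_pdfE f.
transitivity (\sum_(r \in range h) r%:E * pdf_prob f (h @^-1` [set r]))%E.
  by rewrite (@integralT_nnsfun _ _ R (pdf_prob f) h) sintegralE.
transitivity (\sum_(r \in range h) \int[leb]_x (r%:E * ((\1_(h @^-1` [set r]) x)%:E * (f x)%:E)))%E; last first.
  rewrite -ge0_integral_fsum//.
  - apply: eq_integral => x _; rewrite [in RHS]fimfunE -fsumEFin//.
    rewrite ge0_mule_fsuml => [|r]; last by rewrite nnfun_muleindic_ge0.
    by apply: eq_fsbigr => r _; rewrite muleA.
  - by move=> r; apply: emeasurable_funM => //; apply: emeasurable_funM => //; apply/measurable_EFinP.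
  - move=> r x _; rewrite muleA; apply: mule_ge0; last by rewrite lee_fin pdf_ge0.
    by rewrite nnfun_muleindic_ge0.
apply: eq_fsbigr => r; rewrite inE => -[x0 _ <-].
rewrite ge0_integralZl//.
- congr (_ * _)%E; rewrite /= /pdf_prob integral_mkcond; apply: eq_integral => x _.
  rewrite patchE indicE; case: ifP => _; by rewrite ?mul1e ?mul0e.
- by apply: emeasurable_funM => //; apply/measurable_EFinP.
- by move=> x _; apply: mule_ge0; rewrite lee_fin// pdf_ge0.
- by rewrite lee_fin.
Qed.

Lemma ge0_integral_pdf_prob f (U : measurableTypeR R -> \bar R) : measurable_fun setT U ->
  (forall x, 0 <= U x)%E ->
  (\int[pdf_prob f]_x U x = \int[leb]_x (U x * (f x)%:E))%E.
Proof.
move=> mU U0; pose U_ := nnsfun_approx measurableT mU.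
have mf := measurable_pdfE f.
have cU x : setT x -> (U_ n x)%:E @[n --> \oo] --> U x.
  by move=> _; apply: cvg_nnsfun_approx.
transitivity (limn (fun n => \int[pdf_prob f]_x (U_ n x)%:E))%E.
  rewrite -monotone_convergence//=.
  - by apply: eq_integral => x _; apply/esym/cvg_lim => //; exact: cU.
  - by move=> n; apply/measurable_EFinP.
  - by move=> n x _; rewrite lee_fin.
  - by move=> x _ a b ab; rewrite lee_fin; exact/lefP/nd_nnsfun_approx.
under eq_fun do rewrite integral_pdf_prob_nnsfun.
rewrite -monotone_convergence//=.
- apply: eq_integral => x _; apply/cvg_lim => //.
  by apply: cvgeZr => //; exact: cU.
- by move=> n; apply: emeasurable_funM => //; apply/measurable_EFinP.
- by move=> n x _; rewrite mule_ge0// lee_fin// pdf_ge0.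
- move=> x _ a b ab; rewrite lee_wpmul2r// ?lee_fin ?pdf_ge0//.
  exact/lefP/nd_nnsfun_approx.
Qed.

(** [h] is an arbitrary real function because the signed perturbation is convolved with the noise as
    well as the densities. *)
Definition conv_pdf (h g : R -> R) (y : R) : R :=
  (\int[leb]_x (g (y - x) * h x))%R.

Definition obs_pdf g (p : {i01 R}) f y : R :=
  p%:num * conv_pdf f g y + (1 - p%:num) * g y.

Lemma measurable_conv_kernel g f :
  measurable_fun [set: R * R] (fun z => g (z.2 - z.1) * f z.1).
Proof.
apply: measurable_funM; first apply: (measurableT_comp (measurable_pdf g)).
  by apply: measurable_funB.
by apply: (measurableT_comp (measurable_pdf f)).
Qed.

Lemma conv_pdf_ge0 g f y : 0 <= conv_pdf f g y.
Proof. by apply: Rintegral_ge0 => x _; rewrite mulr_ge0// pdf_ge0. Qed.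

Lemma EFin_conv_pdf g f y : (exists M, forall x, g x <= M) ->
  (conv_pdf f g y)%:E = (\int[leb]_x (g (y - x) * f x)%:E)%E.
Proof.
move=> [M gM]; rewrite /conv_pdf /Rintegral fineK// ge0_fin_numE; last first.
  by apply: integral_ge0 => x _; rewrite lee_fin mulr_ge0// pdf_ge0.
have M0 : 0 <= M by apply: le_trans (gM 0); rewrite pdf_ge0.
apply: (@le_lt_trans _ _ (\int[leb]_x (M%:E * (f x)%:E)))%E; last first.
  rewrite ge0_integralZl// ?integral_pdf ?mule1 ?ltry//.
  - exact: measurable_pdfE.
  - by move=> x _; rewrite lee_fin pdf_ge0.
apply: ge0_le_integral => //.
- by move=> x _; rewrite lee_fin mulr_ge0// pdf_ge0.
- apply/measurable_EFinP; apply: measurable_funM; last exact: measurable_pdf.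
  by apply: (measurableT_comp (measurable_pdf g)); apply: measurable_funB.
- by apply: emeasurable_funM => //; exact: measurable_pdfE.
- by move=> x _; rewrite -EFinM lee_fin ler_wpM2r// pdf_ge0.
Qed.

Lemma measurable_conv_pdf g f : measurable_fun setT (conv_pdf f g).
Proof.
apply: measurableT_comp => //.
have := @measurable_fun_fubini_tonelli_G _ _ (measurableTypeR R) (measurableTypeR R) R leb
   (fun z => (g (z.2 - z.1) * f z.1)%:E).
apply.
- by apply/measurable_EFinP; exact: measurable_conv_kernel.
- by move=> z; rewrite lee_fin mulr_ge0// pdf_ge0.
Qed.

Lemma measurable_obs_pdf g p f : measurable_fun setT (obs_pdf g p f).
Proof.
apply: measurable_funD; apply: measurable_funM => //; last exact: measurable_pdf.
exact: measurable_conv_pdf.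
Qed.

(** The contribution of the atom at 0 does not depend on [f]; it bounds the denominator of the
    chi-square distance from below. *)
Lemma obs_pdf_ge g p f y : (1 - p%:num) * g y <= obs_pdf g p f y.
Proof. by rewrite lerDr mulr_ge0// conv_pdf_ge0. Qed.

(** The mixture splits into its diffuse part, where Tonelli's theorem and a translation produce the
    convolution, and the atom at 0, which leaves the noise density itself. *)
Lemma ge0_integral_obs_law g p f (U : R -> \bar R) :
  (exists M, forall x, g x <= M) ->
  measurable_fun setT U -> (forall x, 0 <= U x)%E ->
  (\int[obs_law g p f]_y U y = \int[leb]_y (U y * (obs_pdf g p f y)%:E))%E.
Proof.
move=> gM mU U0.
have mUD : measurable_fun [set: measurableTypeR R * measurableTypeR R]
    (U \o @obs_fun R).
  by apply: measurableT_comp => //; exact: measurable_funP.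
have mg := measurable_pdfE g; have mf := measurable_pdfE f.
have q0 : 0 <= 1 - p%:num by rewrite subr_ge0.
rewrite ge0_integral_distribution// fubini_tonelli1//=.
pose W (x : R) := (\int[leb]_y (U y * (g (y - x))%:E))%E.
have gsm x : measurable_fun setT (fun y : R => (g (y - x))%:E).
  apply/measurable_EFinP; apply: (measurableT_comp (measurable_pdf g)).
  exact: measurable_funB.
have -> : (\int[mix_prob p (pdf_prob f) (dirac (0%R : measurableTypeR R))]_x
     (fubini_F (pdf_prob g) (U \o @obs_fun R) x)
   = \int[mix_prob p (pdf_prob f) (dirac (0%R : measurableTypeR R))]_x W x)%E.
  apply: eq_integral => x _; rewrite /fubini_F /W.
  rewrite ge0_integral_pdf_prob; [| |by move=> y; exact: U0]; last first.
    exact: (measurableT_comp mU (measurable_funD (measurable_cst x) (@measurable_id _ _ setT))).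
  rewrite [RHS](ge0_integral_sgaff false x).
  - apply: eq_integral => y _.
    by rewrite /= /obs_fun /sgaff/= expr0 mul1r addrK addrC.
  - exact: emeasurable_funM.
  - by move=> y; rewrite mule_ge0// lee_fin pdf_ge0.
have mUg : measurable_fun [set: R * R] (fun z : R * R => (U z.2 * (g (z.2 - z.1))%:E)%E).
  apply: emeasurable_funM; first exact: measurableT_comp.
  apply/measurable_EFinP; apply: (measurableT_comp (measurable_pdf g)).
  exact: measurable_funB.
have Ug0 z : (0 <= U z.2 * (g (z.2 - z.1))%:E)%E.
  by rewrite mule_ge0// lee_fin pdf_ge0.
have mW : measurable_fun setT W.
  exact: (@measurable_fun_fubini_tonelli_F _ _ (measurableTypeR R) (measurableTypeR R) R leb
     (fun z : R * R => (U z.2 * (g (z.2 - z.1))%:E)%E)).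
have W0 x : (0 <= W x)%E.
  by apply: integral_ge0 => y _; rewrite mule_ge0// lee_fin pdf_ge0.
rewrite (eq_measure_integral (measure_add (mscale p%:num%:nng (pdf_prob f))
   (mscale (NngNum q0) (dirac (0%R : measurableTypeR R))))); last first.
  by move=> A mA _; apply: esym; apply: measure_addE.
rewrite ge0_integral_measure_add// !ge0_integral_mscale//=.
rewrite integral_dirac//= diracT mul1e ge0_integral_pdf_prob//.
pose F (z : measurableTypeR R * measurableTypeR R) : \bar R :=
  (U z.2 * (g (z.2 - z.1))%:E * (f z.1)%:E)%E.
have mF : measurable_fun setT F.
  apply: (emeasurable_funM mUg); apply/measurable_EFinP.
  exact: (measurableT_comp (measurable_pdf f)).
have F0 z : (0 <= F z)%E by rewrite mule_ge0// lee_fin pdf_ge0.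
have mconv (y : R) : measurable_fun setT (fun x : R => (g (y - x) * f x)%:E).
  apply/measurable_EFinP; apply: measurable_funM; last exact: measurable_pdf.
  by apply: (measurableT_comp (measurable_pdf g)); apply: measurable_funB.
have gf0 (y x : R) : 0 <= g (y - x) * f x by rewrite mulr_ge0// pdf_ge0.
have key : (\int[leb]_x (W x * (f x)%:E) =
    \int[leb]_y (U y * (conv_pdf f g y)%:E))%E.
  transitivity (\int[leb]_x \int[leb]_y F (x, y))%E.
    apply: eq_integral => x _; rewrite /W -ge0_integralZr//.
    - exact: (emeasurable_funM mU (gsm x)).
    - by move=> y _; rewrite mule_ge0// lee_fin pdf_ge0.
    - by rewrite lee_fin pdf_ge0.
  rewrite (fubini_tonelli F mF F0); apply: eq_integral => y _.
  rewrite EFin_conv_pdf// -ge0_integralZl//.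
  - by apply: eq_integral => x _; rewrite /F/= -muleA -EFinM.
  - exact: mconv.
  - by move=> x _; rewrite lee_fin.
have mUc : measurable_fun setT (fun y => U y * (conv_pdf f g y)%:E)%E.
  apply: (emeasurable_funM mU); apply/measurable_EFinP.
  exact: measurable_conv_pdf.
have Uc0 y : (0 <= U y * (conv_pdf f g y)%:E)%E.
  by rewrite mule_ge0// lee_fin conv_pdf_ge0.
have mU0 := emeasurable_funM mU (gsm 0).
have Ug00 y : (0 <= U y * (g (y - 0))%:E)%E.
  by rewrite mule_ge0// lee_fin pdf_ge0.
rewrite key /W -(ge0_integralZl_leb mUc Uc0)// -(ge0_integralZl_leb mU0 Ug00)//.
rewrite -ge0_integralD_leb; last 4 first.
- by apply: emeasurable_funM.
- by move=> y; rewrite mule_ge0 ?lee_fin.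
- by apply: emeasurable_funM.
- by move=> y; rewrite mule_ge0 ?lee_fin.
apply: eq_integral => y _; rewrite subr0 /obs_pdf (EFinD (_ * _)) ge0_muleDr.
- by rewrite !EFinM muleCA [X in (_ + X = _)%E]muleCA.
- by rewrite lee_fin mulr_ge0// conv_pdf_ge0.
- by rewrite lee_fin mulr_ge0// pdf_ge0.
Qed.

End obs_density.

(** * Two-point lower bound *)

Section iid_affinity.
Context (R : realType).
Notation leb := (@lebesgue_measure R).
Variables (P Q : probability R R) (p q : R -> R) (r : R).
Hypotheses (mp : measurable_fun setT p) (mq : measurable_fun setT q).
Hypotheses (p0 : forall x, 0 < p x) (q0 : forall x, 0 < q x).
Hypothesis hP : forall U : R -> \bar R, measurable_fun setT U ->
  (forall x, 0 <= U x)%E -> (\int[P]_y U y = \int[leb]_y (U y * (p y)%:E))%E.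
Hypothesis hQ : forall U : R -> \bar R, measurable_fun setT U ->
  (forall x, 0 <= U x)%E -> (\int[Q]_y U y = \int[leb]_y (U y * (q y)%:E))%E.
Hypotheses (r0 : 0 <= r)
  (hr : (r%:E <= \int[leb]_x (Num.sqrt (p x * q x))%:E)%E).

(* The Hellinger affinity in dual form (AM-GM in l): the n-fold product is
   handled by induction on n through integrals alone, without a joint density. *)
Lemma iid_affinity (n : nat) (u v : n.-tuple R -> \bar R) (K : R) :
  measurable_fun setT u -> measurable_fun setT v ->
  (forall y, 0 <= u y)%E -> (forall y, 0 <= v y)%E -> 0 <= K ->
  (forall l : R, 0 < l -> forall y, (K%:E <= l%:E * u y + l^-1%:E * v y)%E) ->
  forall l : R, 0 < l ->
  ((K * r ^+ n)%:E <= l%:E * \int[iid_law P n]_y u y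
                      + l^-1%:E * \int[iid_law Q n]_y v y)%E.
Proof.
elim: n u v => [|n IH] u v mu mv u0 v0 K0 huv l l0.
  by rewrite /= !integral_dirac// !diracT !mul1e expr0 mulr1; exact: huv.
have muc : measurable_fun setT (u \o @tuple_cons _ R n) by exact: measurableT_comp.
have mvc : measurable_fun setT (v \o @tuple_cons _ R n) by exact: measurableT_comp.
rewrite /= !ge0_integral_distribution// !fubini_tonelli1//=.
pose U x := (\int[iid_law P n]_t (u \o @tuple_cons _ R n) (x, t))%E.
pose V x := (\int[iid_law Q n]_t (v \o @tuple_cons _ R n) (x, t))%E.
have mU : measurable_fun setT U.
  by apply: (measurable_fun_fubini_tonelli_F (m2 := iid_law P n) _ muc) => z; exact: u0.
have mV : measurable_fun setT V.
  by apply: (measurable_fun_fubini_tonelli_F (m2 := iid_law Q n) _ mvc) => z; exact: v0.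
have U0 x : (0 <= U x)%E by apply: integral_ge0 => t _; exact: u0.
have V0 x : (0 <= V x)%E by apply: integral_ge0 => t _; exact: v0.
have UV x k : 0 < k -> ((K * r ^+ n)%:E <= k%:E * U x + k^-1%:E * V x)%E.
  move=> k0; apply: (IH (fun t => u (tuple_cons (x, t))) (fun t => v (tuple_cons (x, t)))) => //.
  - exact: (measurableT_comp muc (pair1_measurable x)).
  - exact: (measurableT_comp mvc (pair1_measurable x)).
  - by move=> j j0 y; exact: huv.
rewrite [X in (_ <= _ * X + _)%E](_ : _ = \int[P]_x U x)%E//.
rewrite [X in (_ <= _ + _ * X)%E](_ : _ = \int[Q]_x V x)%E//.
rewrite hP// hQ//.
have mp' : measurable_fun setT (EFin \o p) by exact/measurable_EFinP.
have mq' : measurable_fun setT (EFin \o q) by exact/measurable_EFinP.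
have mUp := emeasurable_funM mU mp'; have mVq := emeasurable_funM mV mq'.
have Up0 x : (0 <= U x * (p x)%:E)%E by rewrite mule_ge0// lee_fin ltW.
have Vq0 x : (0 <= V x * (q x)%:E)%E by rewrite mule_ge0// lee_fin ltW.
have l0' := ltW l0; have li0 : 0 <= l^-1 by rewrite invr_ge0.
rewrite -(ge0_integralZl_leb mUp)// -(ge0_integralZl_leb mVq)//.
rewrite -ge0_integralD_leb; last 4 first.
- by apply: emeasurable_funM.
- by move=> y; rewrite mule_ge0 ?lee_fin.
- by apply: emeasurable_funM.
- by move=> y; rewrite mule_ge0 ?lee_fin.
have mpq : measurable_fun setT (fun x => (Num.sqrt (p x * q x))%:E).
  apply/measurable_EFinP; apply: measurableT_comp; last exact: measurable_funM.
  by apply: continuous_measurable_fun; exact: sqrt_continuous.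
have Kr0 : 0 <= K * r ^+ n by rewrite mulr_ge0 ?exprn_ge0.
apply: (@le_trans _ _ (\int[leb]_x ((K * r ^+ n)%:E * (Num.sqrt (p x * q x))%:E))%E).
  rewrite ge0_integralZl_leb//.
  by rewrite exprSr mulrA EFinM lee_pmul// lee_fin.
apply: ge0_le_integral_leb => //.
- by move=> x; rewrite mule_ge0// lee_fin.
- exact: emeasurable_funM.
- by apply: emeasurable_funD; apply: emeasurable_funM.
move=> x; set w := Num.sqrt _.
have pq0 : 0 < p x * q x by rewrite mulr_gt0.
have w0 : 0 < w by rewrite sqrtr_gt0.
have wE : w * w = p x * q x by rewrite -expr2 sqr_sqrtr// ltW.
(* The induction hypothesis is used with a multiplier depending on x: times [w], the square root of
   p x * q x, the multiplier l * p x / w becomes l * p x and its inverse becomes q x / l. *)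
have k0 : 0 < l * p x / w by rewrite divr_gt0// mulr_gt0.
have w0' : (0 <= w%:E)%E by rewrite lee_fin ltW.
have := lee_wpmul2r w0' (UV x _ k0).
move=> /le_trans; apply; rewrite ge0_muleDl ?mule_ge0 ?lee_fin ?invr_ge0 ?(ltW k0)//.
have e1 : l * p x / w * w = l * p x by rewrite divfK// gt_eqF.
have e2 : (l * p x / w)^-1 * w = l^-1 * q x.
  have := p0 x; rewrite lt0r => /andP[pn _].
  have wn : w != 0 by rewrite gt_eqF.
  have ln : l != 0 by rewrite gt_eqF.
  rewrite invf_div mulrAC wE; field; by rewrite ln pn.
rewrite muleAC -EFinM e1 [X in (_ + X <= _)%E]muleAC -EFinM e2.
by rewrite !EFinM !muleA (muleAC l%:E) (muleAC l^-1%:E).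
Qed.

End iid_affinity.

Lemma measurable_funV_gt0 d (T : measurableType d) (R : realType) (D : set T)
    (f : T -> R) : measurable_fun D f -> (forall x, 0 < f x) ->
  measurable_fun D (fun x => (f x)^-1).
Proof.
move=> mf f0; rewrite (_ : (fun _ => _) = (fun x => expR (- ln (f x)))).
  apply: (measurableT_comp (@measurable_expR R)).
  by apply: measurableT_comp => //; apply: measurableT_comp => //; exact: measurable_ln.
by apply/funext => x; rewrite expRN lnK// posrE.
Qed.

Section two_point.
Context (R : realType).
Notation leb := (@lebesgue_measure R).

(** With a = x^2 and b = y^2 the difference of the two sides is (x - y)^2 x y / (x^2 + y^2).
    Integrated over two densities, this bounds one minus the Hellinger affinity by half the
    symmetric chi-square distance. *)
Lemma le_sqrtM_chi (a b : R) : 0 < a -> 0 < b ->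
  (a + b) / 2 <= Num.sqrt (a * b) + (a - b) ^+ 2 / (a + b) / 2.
Proof.
move=> a0 b0; rewrite sqrtrM ?(ltW a0)//.
have [x [x0 -> ->]] : exists x : R, [/\ 0 < x, Num.sqrt a = x & a = x ^+ 2].
  by exists (Num.sqrt a); rewrite sqrtr_gt0 sqr_sqrtr// ltW.
have [y [y0 -> ->]] : exists y : R, [/\ 0 < y, Num.sqrt b = y & b = y ^+ 2].
  by exists (Num.sqrt b); rewrite sqrtr_gt0 sqr_sqrtr// ltW.
have s0 : 0 < x ^+ 2 + y ^+ 2 by rewrite addr_gt0// exprn_gt0.
have s1 : x ^+ 2 + y ^+ 2 != 0 by rewrite gt_eqF.
rewrite -subr_ge0.
have -> : x * y + (x ^+ 2 - y ^+ 2) ^+ 2 / (x ^+ 2 + y ^+ 2) / 2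
   - (x ^+ 2 + y ^+ 2) / 2
  = (x - y) ^+ 2 * x * y / (x ^+ 2 + y ^+ 2) by field.
apply: divr_ge0 (ltW s0); apply: mulr_ge0 (ltW y0).
exact: mulr_ge0 (sqr_ge0 _) (ltW x0).
Qed.

Lemma bernoulli_ge (x : R) n : 0 <= x <= 1 -> 1 - n%:R * x <= (1 - x) ^+ n.
Proof.
move=> /andP[x0 x1]; elim: n => [|n IH]; first by rewrite mul0r subr0 expr0.
rewrite exprSr; apply: le_trans (ler_wpM2r _ IH); last by rewrite subr_ge0.
rewrite -natr1; have n0 : 0 <= n%:R :> R by [].
have := mulr_ge0 n0 (sqr_ge0 x); nra.
Qed.

(* Without the added [D ^+ 2] the right side could vanish as l tends to 0 or to
   infinity; 17/5 is not sharp, the optimal constant being 4. *)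
Lemma two_point_dual (D x y l : R) : 0 < l -> D ^+ 2 <= (x - y) ^+ 2 ->
  17 / 5 * D ^+ 2 <= l * (D ^+ 2 + 4 * x ^+ 2) + l^-1 * (D ^+ 2 + 4 * y ^+ 2).
Proof.
move=> l0 Dxy; set a := D ^+ 2 in Dxy *.
have a0 : 0 <= a by exact: sqr_ge0.
set u := a + _; set v := a + _.
have u0 : 0 <= u by rewrite addr_ge0// mulr_ge0// sqr_ge0.
have v0 : 0 <= v by rewrite addr_ge0// mulr_ge0// sqr_ge0.
have hs : a <= 2 * (x ^+ 2 + y ^+ 2).
  apply: (le_trans Dxy); have := sqr_ge0 (x + y); nra.
(* The product u v is at least a^2 + 4 a (x^2 + y^2), and x^2 + y^2 is at least a / 2. Then (l u + v
   / l)^2 >= 4 u v >= 12 a^2, while (17/5)^2 = 11.56. *)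
have uv : 3 * a ^+ 2 <= u * v.
  rewrite /u /v; have := mulr_ge0 (sqr_ge0 x) (sqr_ge0 y).
  by have := ler_wpM2l a0 hs; nra.
have li0 : 0 < l^-1 by rewrite invr_gt0.
have lu0 : 0 <= l * u + l^-1 * v by rewrite addr_ge0// mulr_ge0// ltW.
have K0 : 0 <= 17 / 5 * a by rewrite mulr_ge0.
rewrite -ler_sqr ?nnegrE//.
apply: (@le_trans _ _ (4 * (u * v))).
  by have := sqr_ge0 a; nra.
rewrite -subr_ge0 (_ : _ - _ = (l * u - l^-1 * v) ^+ 2) ?sqr_ge0//.
by field; rewrite gt_eqF.
Qed.

Variables (g : pdf R) (p : {i01 R}) (f1 f2 : pdf R).
Hypotheses (gM : exists M, forall x, g x <= M) (g0 : forall x, 0 < g x)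
  (p1 : p%:num < 1).

Let P1 := obs_pdf g p f1.
Let P2 := obs_pdf g p f2.

Lemma obs_pdf_gt0 f y : 0 < obs_pdf g p f y.
Proof. by apply: lt_le_trans (obs_pdf_ge _ _ _ _); rewrite mulr_gt0// subr_gt0. Qed.

Lemma integral_obs_pdf f : (\int[leb]_y (obs_pdf g p f y)%:E = 1)%E.
Proof.
have := ge0_integral_obs_law p f gM (@measurable_cst _ _ R (\bar R) setT 1%E) (fun=> lee01).
rewrite integral_cst//= mul1e probability_setT => ->.
by apply: eq_integral => x _; rewrite mul1e.
Qed.

Lemma hellinger_affinity_ge (c : R) :
  (\int[leb]_y ((P1 y - P2 y) ^+ 2 / (P1 y + P2 y))%:E <= c%:E)%E ->
  ((1 - c / 2)%:E <= \int[leb]_y (Num.sqrt (P1 y * P2 y))%:E)%E.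
Proof.
move=> hc.
have mP1 : measurable_fun setT P1 by exact: measurable_obs_pdf.
have mP2 : measurable_fun setT P2 by exact: measurable_obs_pdf.
have P10 := obs_pdf_gt0 f1; have P20 := obs_pdf_gt0 f2.
have s0 y : 0 < P1 y + P2 y by rewrite addr_gt0 ?P10 ?P20.
pose t y := (P1 y - P2 y) ^+ 2 / (P1 y + P2 y).
have t0 y : 0 <= t y by rewrite divr_ge0 ?sqr_ge0// ltW.
have mt : measurable_fun setT t.
  apply: measurable_funM; first exact/measurable_funX/measurable_funB.
  apply: measurable_funV_gt0 => //; exact: measurable_funD.
have ms : measurable_fun setT (fun y => Num.sqrt (P1 y * P2 y)).
  apply: measurableT_comp; last exact: measurable_funM.
  by apply: continuous_measurable_fun; exact: sqrt_continuous.
have h1 : (1 <= \int[leb]_y ((Num.sqrt (P1 y * P2 y))%:E + (2^-1 * t y)%:E))%E.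
  rewrite -(integral_obs_pdf f1) -/P1.
  apply: (@le_trans _ _ (\int[leb]_y (2^-1%:E * (P1 y)%:E + 2^-1%:E * (P2 y)%:E))%E).
    rewrite ge0_integralD_leb; last 4 first.
    - by apply: emeasurable_funM => //; apply/measurable_EFinP.
    - by move=> y; rewrite -EFinM lee_fin mulr_ge0// ltW ?P10.
    - by apply: emeasurable_funM => //; apply/measurable_EFinP.
    - by move=> y; rewrite -EFinM lee_fin mulr_ge0// ltW ?P20.
    rewrite !ge0_integralZl_leb//.
    - by rewrite /P1 /P2 !integral_obs_pdf !mule1 -EFinD lee_fin; lra.
    - by apply/measurable_EFinP.
    - by move=> y; rewrite lee_fin ltW ?P20.
    - by apply/measurable_EFinP.
    - by move=> y; rewrite lee_fin ltW ?P10.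
  apply: ge0_le_integral_leb.
  - by move=> y; rewrite -!EFinM -EFinD lee_fin addr_ge0// mulr_ge0// ltW ?P10 ?P20.
  - by apply: emeasurable_funD; apply: emeasurable_funM => //; apply/measurable_EFinP.
  - apply: emeasurable_funD; apply/measurable_EFinP => //.
    exact: measurable_funM.
  - move=> y; rewrite -!EFinM -!EFinD lee_fin.
    have := le_sqrtM_chi (P10 y) (P20 y); rewrite -/(P1 y) -/(P2 y) -/(t y); lra.
have htc : (\int[leb]_y (2^-1 * t y)%:E <= (c / 2)%:E)%E.
  under eq_integral do rewrite EFinM.
  rewrite ge0_integralZl_leb//; last by apply/measurable_EFinP.
  by rewrite mulrC EFinM lee_pmul// integral_ge0// => y _; rewrite lee_fin t0.
rewrite EFinB leeBlDr//; apply: (le_trans h1).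
rewrite ge0_integralD_leb; first by rewrite leeD2l.
- by apply/measurable_EFinP.
- by move=> y; rewrite lee_fin.
- by apply/measurable_EFinP; exact: measurable_funM.
- by move=> y; rewrite lee_fin mulr_ge0.
Qed.

(** [iid_affinity] is applied with l = 1 to the losses D^2 + 4 (e - Phi)^2. By Bernoulli's
    inequality n c <= 1/5 keeps the affinity of the samples above 9/10, so the left side is at least
    17/5 * 9/10 * D^2 = 3.06 D^2; if both risks were below D^2 / 8, the right side would be at most
    3 D^2. *)
Lemma minimax_risk_two_point (phi : R -> R) (F : set (pdf R)) (n : nat) (c : R) :
  (0 < n)%N -> F f1 -> F f2 -> 0 <= c -> n%:R * c <= 1 / 5 ->
  (\int[leb]_y ((P1 y - P2 y) ^+ 2 / (P1 y + P2 y))%:E <= c%:E)%E ->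
  (((Phi phi f1 - Phi phi f2) ^+ 2 / 8)%:E <= minimax_risk g phi F p n)%E.
Proof.
move=> n0 Ff1 Ff2 c0 nc /hellinger_affinity_ge hr.
set D := Phi phi f1 - Phi phi f2.
apply: le_ereal_inf_tmp => _ [e /= me <-].
pose X i (y : n.-tuple R) := (e y - Phi phi (if i then f1 else f2)) ^+ 2.
pose P i : probability R R := obs_law g p (if i then f1 else f2).
pose r i := (\int[iid_law (P i) n]_y (X i y)%:E)%E.
suff : ((D ^+ 2 / 8)%:E <= r true)%E \/ ((D ^+ 2 / 8)%:E <= r false)%E.
  by case=> /le_trans; apply; apply: ereal_sup_ubound; [exists f1 | exists f2].
have mX i : measurable_fun setT (X i).
  by apply: measurable_funX; exact: measurable_funB.
have X0 i y : 0 <= X i y by exact: sqr_ge0.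
have D20 : 0 <= D ^+ 2 by exact: sqr_ge0.
pose u i y := ((D ^+ 2)%:E + 4%:E * (X i y)%:E)%E.
have mu i : measurable_fun setT (u i).
  apply: emeasurable_funD => //; apply: emeasurable_funM => //.
  exact/measurable_EFinP.
have u0 i y : (0 <= u i y)%E by rewrite /u -EFinM -EFinD lee_fin addr_ge0// mulr_ge0.
have iu i : (\int[iid_law (P i) n]_y u i y = (D ^+ 2)%:E + 4%:E * r i)%E.
  rewrite ge0_integralD//; last 2 first.
  - by move=> y _; rewrite -EFinM lee_fin mulr_ge0.
  - apply: emeasurable_funM => //; exact/measurable_EFinP.
  rewrite integral_cst//= probability_setT mule1 ge0_integralZl//.
  - exact/measurable_EFinP.
  - by move=> y _; rewrite lee_fin.
have c5 : c <= 1 / 5.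
  by apply: le_trans nc; rewrite ler_peMl// ler1n.
have r0 : 0 <= 1 - c / 2 by lra.
have := @iid_affinity R (P true) (P false) P1 P2 (1 - c / 2)
  (measurable_obs_pdf _ _ _) (measurable_obs_pdf _ _ _)
  (obs_pdf_gt0 f1) (obs_pdf_gt0 f2)
  (fun U => ge0_integral_obs_law p f1 (U := U) gM)
  (fun U => ge0_integral_obs_law p f2 (U := U) gM)
  r0 hr n (u true) (u false) (17 / 5 * D ^+ 2)
  (mu true) (mu false) (u0 true) (u0 false).
have K0 : 0 <= 17 / 5 * D ^+ 2 by rewrite mulr_ge0.
have hd l : 0 < l -> forall y,
    ((17 / 5 * D ^+ 2)%:E <= l%:E * u true y + l^-1%:E * u false y)%E.
  move=> l0 y; rewrite /u -!EFinM -!EFinD lee_fin.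
  apply: two_point_dual => //; rewrite le_eqVlt; apply/orP; left; apply/eqP.
  by rewrite /D; ring.
move=> /(_ K0 hd 1 ltr01); rewrite invr1 !mul1e !iu => main.
have rn : 9 / 10 <= (1 - c / 2) ^+ n.
  have c01 : 0 <= c / 2 <= 1 by apply/andP; split; lra.
  by apply: le_trans (bernoulli_ge n c01); rewrite mulrA; lra.
have [h1|h1] := leP (D ^+ 2 / 8)%:E (r true); [by left | right].
rewrite leNgt; apply/negP => h2.
have r1 : (0 <= r true)%E by apply: integral_ge0 => y _; rewrite lee_fin.
have D2 : 0 < D ^+ 2.
  by have := le_lt_trans r1 h1; rewrite lte_fin; lra.
have : ((17 / 5 * D ^+ 2 * (1 - c / 2) ^+ n)%:E <=
   ((D ^+ 2)%:E + 4%:E * (D ^+ 2 / 8)%:E) + ((D ^+ 2)%:E + 4%:E * (D ^+ 2 / 8)%:E))%E.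
  by apply: (le_trans main); apply: leeD; (apply: leeD; first exact: lexx);
     (apply: lee_wpmul2l; [rewrite lee_fin ler0n|exact: ltW]).
rewrite -!EFinM -!EFinD lee_fin.
have := ler_wpM2l K0 rn; lra.
Qed.

End two_point.

(** * Integration on the line and Fourier inversion *)

Section rint.
Context (R : realType).
Notation leb := (@lebesgue_measure R).
Implicit Types (f g h q : R -> R).

Definition intg f := leb.-integrable [set: R] (EFin \o f).

Lemma intg_measurable f : intg f -> measurable_fun setT f.
Proof. by move=> /measurable_int /measurable_EFinP. Qed.

Lemma le_intg f g : intg g -> measurable_fun setT f ->
  (forall x, `|f x| <= g x) -> intg f.
Proof.
move=> ig mf fg; apply: le_integrable ig => //; first exact/measurable_EFinP.
by move=> x _ /=; rewrite lee_fin (le_trans (fg x))// ler_norm.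
Qed.

Lemma eq_intg f g : f =1 g -> intg f -> intg g.
Proof. by move=> /funext ->. Qed.

Lemma intgZ k f : intg f -> intg (fun x => k * f x).
Proof. by move=> h; exact: (integrableZl measurableT k h). Qed.

Lemma intgD f g : intg f -> intg g -> intg (fun x => f x + g x).
Proof. by move=> hf hg; exact: (integrableD measurableT hf hg). Qed.

Lemma intgB f g : intg f -> intg g -> intg (fun x => f x - g x).
Proof. by move=> hf hg; exact: (integrableB measurableT hf hg). Qed.

Lemma intg_abs f : intg f -> intg (fun x => `|f x|).
Proof. by move=> hf; exact: (integrable_abse hf). Qed.

Lemma intg_bounded (k : R -> R) M f : intg f -> measurable_fun setT k ->
  (forall x, `|k x| <= M) -> intg (fun x => k x * f x).
Proof.
move=> hf mk kM; apply: (@le_intg _ (fun x => M * `|f x|)).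
- by apply: intgZ; exact: intg_abs.
- by apply: measurable_funM => //; exact: intg_measurable.
- by move=> x; rewrite normrM ler_wpM2r.
Qed.

Lemma intg0 : intg (fun=> 0).
Proof. exact: integrable0. Qed.

Lemma intg_sum (I : Type) (s : seq I) (F : I -> R -> R) :
  (forall i, intg (F i)) -> intg (fun x => \sum_(i <- s) F i x).
Proof.
move=> hF; elim: s => [|i s IH].
  by apply: eq_intg intg0 => x; rewrite big_nil.
by apply: eq_intg (intgD (hF i) IH) => x; rewrite big_cons.
Qed.

Definition Rint f : R := (\int[leb]_x f x)%R.

Lemma eq_Rint f g : f =1 g -> Rint f = Rint g.
Proof. by move=> /funext ->. Qed.

Lemma EFin_Rint f : intg f -> (Rint f)%:E = (\int[leb]_x (f x)%:E)%E.
Proof. by move=> hf; rewrite /Rint /Rintegral fineK//; exact: integrable_fin_num. Qed.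

Lemma RintZ k f : intg f -> Rint (fun x => k * f x) = k * Rint f.
Proof. by move=> hf; exact: RintegralZl. Qed.

Lemma RintD f g : intg f -> intg g ->
  Rint (fun x => f x + g x) = Rint f + Rint g.
Proof. by move=> hf hg; exact: RintegralD. Qed.

Lemma RintB f g : intg f -> intg g ->
  Rint (fun x => f x - g x) = Rint f - Rint g.
Proof. by move=> hf hg; exact: RintegralB. Qed.

Lemma RintN f : intg f -> Rint (fun x => - f x) = - Rint f.
Proof.
move=> hf; rewrite -mulN1r -RintZ//; apply: eq_Rint => x; by rewrite mulN1r.
Qed.

Lemma Rint0 : Rint (fun=> 0) = 0.
Proof. by rewrite /Rint /Rintegral integral0. Qed.

Lemma Rint_sum (I : Type) (s : seq I) (F : I -> R -> R) :
  (forall i, intg (F i)) ->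
  Rint (fun x => \sum_(i <- s) F i x) = \sum_(i <- s) Rint (F i).
Proof.
move=> hF; elim: s => [|i s IH].
  by rewrite big_nil -[RHS]Rint0; apply: eq_Rint => x; rewrite big_nil.
rewrite big_cons -IH -RintD//; last exact: intg_sum.
by apply: eq_Rint => x; rewrite big_cons.
Qed.

Lemma Rint_ge0 f : (forall x, 0 <= f x) -> 0 <= Rint f.
Proof. by move=> f0; apply: Rintegral_ge0. Qed.

Lemma le_Rint f g : intg f -> intg g -> (forall x, f x <= g x) ->
  Rint f <= Rint g.
Proof. by move=> hf hg fg; apply: le_Rintegral. Qed.

Lemma normr_Rint f : intg f -> `|Rint f| <= Rint (fun x => `|f x|).
Proof. by move=> hf; exact: le_normr_Rintegral. Qed.

Lemma intg_le_fin f M : measurable_fun setT f -> (forall x, 0 <= f x) ->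
  (\int[leb]_x (f x)%:E <= M%:E)%E -> intg f.
Proof.
move=> mf f0 h; apply/integrableP; split; first exact/measurable_EFinP.
rewrite (_ : integral _ _ _ = \int[leb]_x (f x)%:E)%E; last first.
  by apply: eq_integral => x _ /=; rewrite ger0_norm.
by apply: le_lt_trans h _; rewrite ltry.
Qed.

Lemma Rint_sgaff b c f : measurable_fun setT f ->
  Rint f = Rint (fun x => f (sgaff b c x)).
Proof.
move=> mf; rewrite /Rint /Rintegral; congr fine.
by rewrite (integral_sgaff b c)//; exact/measurable_EFinP.
Qed.

Lemma Rint_shift c f : measurable_fun setT f -> Rint f = Rint (fun x => f (x + c)).
Proof.
move=> mf; rewrite (Rint_sgaff false c mf); apply: eq_Rint => x.
by rewrite /sgaff expr0 mul1r.
Qed.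

Lemma Rint_opp f : measurable_fun setT f -> Rint f = Rint (fun x => f (- x)).
Proof.
move=> mf; rewrite (Rint_sgaff true 0 mf); apply: eq_Rint => x.
by rewrite /sgaff expr1 mulN1r addr0.
Qed.

Lemma intg_sgaff b c f : intg f -> intg (fun x => f (sgaff b c x)).
Proof.
move=> hf; have mf := intg_measurable hf.
apply/integrableP; split.
  apply/measurable_EFinP; apply: measurableT_comp => //; exact: measurable_sgaff.
move: hf => /integrableP[_]; rewrite (ge0_integral_sgaff b c)//.
by apply: measurableT_comp => //; exact/measurable_EFinP.
Qed.

Lemma intg_shift c f : intg f -> intg (fun x => f (x + c)).
Proof.
by move/(intg_sgaff false c); apply: eq_intg => x; rewrite /sgaff expr0 mul1r.
Qed.

Lemma intg_opp f : intg f -> intg (fun x => f (- x)).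
Proof.
by move/(intg_sgaff true 0); apply: eq_intg => x; rewrite /sgaff expr1 mulN1r addr0.
Qed.

Lemma measurable_Rint_param (k : R * R -> R) : measurable_fun setT k ->
  measurable_fun setT (fun x => Rint (fun y => k (x, y))).
Proof.
move=> mk.
have mk' : measurable_fun [set: measurableTypeR R * measurableTypeR R] (EFin \o k).
  exact/measurable_EFinP.
apply: (@measurableT_comp _ _ _ _ _ _ fine _ (fun x => \int[leb]_y (EFin \o k) (x, y))%E) => //.
under eq_fun do rewrite integralE.
apply: emeasurable_funB.
- have := @measurable_fun_fubini_tonelli_F _ _ (measurableTypeR R) (measurableTypeR R) R leb _
    (measurable_funepos mk') (fun z => funepos_ge0 _ z).
  by congr measurable_fun; apply/funext => x; rewrite /fubini_F; apply: eq_integral => y _;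
     rewrite !funeposE.
- have := @measurable_fun_fubini_tonelli_F _ _ (measurableTypeR R) (measurableTypeR R) R leb _
    (measurable_funeneg mk') (fun z => funeneg_ge0 _ z).
  by congr measurable_fun; apply/funext => x; rewrite /fubini_F; apply: eq_integral => y _;
     rewrite !funenegE.
Qed.

(** The bounded kernel will be a cosine or a sine of a product; its bound makes the double integral
    absolutely convergent. *)
Lemma fubini_Rint (a b : R -> R) (k : R * R -> R) (M : R) :
  intg a -> intg b -> measurable_fun setT k -> (forall z, `|k z| <= M) ->
  Rint (fun x => a x * Rint (fun y => k (x, y) * b y)) =
  Rint (fun y => b y * Rint (fun x => k (x, y) * a x)).
Proof.
move=> ha hb mk kM.
have ma := intg_measurable ha; have mb := intg_measurable hb.
have mk1 x : measurable_fun setT (fun y => k (x, y)) by exact: measurableT_comp.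
have mk2 y : measurable_fun setT (fun x => k (x, y)) by exact: measurableT_comp.
pose Fr (z : measurableTypeR R * measurableTypeR R) : R := a z.1 * (k z * b z.2).
pose F : measurableTypeR R * measurableTypeR R -> \bar R := EFin \o Fr.
have mF : measurable_fun [set: measurableTypeR R * measurableTypeR R] F.
  apply: measurableT_comp => //; apply: measurable_funM; first exact: measurableT_comp.
  by apply: measurable_funM => //; exact: measurableT_comp.
have hk x : intg (fun y => k (x, y) * b y) by apply: (intg_bounded hb (mk1 x)).
have hk2 y : intg (fun x => k (x, y) * a x) by apply: (intg_bounded ha (mk2 y)).
have iF : (leb \x leb)%E.-integrable setT F.
  apply/(integrable12ltyP _ _ mF).
  apply: (@le_lt_trans _ _ (\int[leb]_x (M * Rint (fun y => `|b y|) * `|a x|)%:E)%E).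
    apply: ge0_le_integral_leb.
    - by move=> x; exact: integral_ge0.
    - apply: (@measurable_fun_fubini_tonelli_F _ _ (measurableTypeR R) (measurableTypeR R) R leb (abse \o F)) => //.
      exact: measurableT_comp.
      by move=> z; exact: abse_ge0.
    - apply/measurable_EFinP; apply: measurable_funM => //.
      exact: measurableT_comp.
    - move=> x; rewrite (_ : integral _ _ _ = \int[leb]_y (`|a x| * `|k (x, y) * b y|)%:E)%E; last first.
        by apply: eq_integral => y _; rewrite /F/= normrM.
      rewrite -EFin_Rint; last by apply: intgZ; exact: intg_abs.
      rewrite lee_fin mulrC RintZ; last exact: intg_abs.
      apply: ler_wpM2l => //; rewrite -RintZ; last exact: intg_abs.
      apply: le_Rint; [exact: intg_abs| by apply: intgZ; exact: intg_abs|].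
      by move=> y; rewrite normrM ler_wpM2r.
  rewrite -EFin_Rint ?ltry//; apply: intgZ; exact: intg_abs.
have := Fubini iF.
rewrite (_ : integral _ _ _ = \int[leb]_x (a x * Rint (fun y => k (x, y) * b y))%:E)%E; last first.
  apply: eq_integral => x _; rewrite -RintZ// EFin_Rint//.
  exact: intgZ.
move=> e; transitivity (fine (\int[leb]_x (a x * Rint (fun y => k (x, y) * b y))%:E)%E); first exact: erefl.
rewrite e; apply: (congr1 fine); apply: eq_integral => y _.
rewrite -RintZ// EFin_Rint; last exact: intgZ.
by apply: eq_integral => x _; rewrite /F /Fr/=; congr EFin; ring.
Qed.

End rint.

(** * The Poisson kernel *)

Section poisson.
Context (R : realType).
Notation leb := (@lebesgue_measure R).
Implicit Types (f g h q F G : R -> R).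

Lemma is_derive_mulk (k x : R) : is_derive x 1 (fun x => k * x) k.
Proof.
have : is_derive x 1 (k \*: (@id R^o)) (k *: 1) by exact: is_deriveZ.
by rewrite /GRing.scale/= mulr1.
Qed.

Lemma is_derive_expRM (k x : R) :
  is_derive x 1 (fun x => expR (k * x)) (k * expR (k * x)).
Proof.
have := @is_derive1_comp R expR (fun x => k * x) x _ _ (is_derive_expR _) (is_derive_mulk k x).
by rewrite mulrC.
Qed.

Lemma is_derive_cosM (k x : R) :
  is_derive x 1 (fun x => cos (k * x)) (- k * sin (k * x)).
Proof.
have := @is_derive1_comp R cos (fun x => k * x) x _ _ (is_derive_cos _) (is_derive_mulk k x).
by rewrite mulrC mulrN mulNr.
Qed.

Lemma is_derive_sinM (k x : R) :
  is_derive x 1 (fun x => sin (k * x)) (k * cos (k * x)).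
Proof.
have := @is_derive1_comp R sin (fun x => k * x) x _ _ (is_derive_sin _) (is_derive_mulk k x).
by rewrite mulrC.
Qed.

Lemma even_FTC2 f (F : R -> R) (l : R) : (forall x, 0 <= f x) -> continuous f ->
  (forall x, f (- x) = f x) -> (forall x : R, 0 < x -> is_derive x 1 F (f x)) ->
  {for 0, continuous F} -> F x @[x --> +oo] --> l ->
  intg f /\ Rint f = 2 * (l - F 0).
Proof.
move=> f0 cf ef dF cF Fl.
have E : (\int[leb]_x (f x)%:E = (2 * (l - F 0))%:E)%E.
  rewrite ge0_symfun_integralT//; last by move=> x /=; rewrite ef.
  rewrite -set_itvcy (@ge0_continuous_FTC2y _ f F 0 l)//.
  - exact: continuous_subspaceT.
  - by move=> x x0; have := dF x x0 => -[].
  - exact: cvg_at_right_filter.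
  - move=> x; rewrite in_itv/= andbT => x0; rewrite derive1E.
    by have := dF x x0 => -[].
split; last by rewrite /Rint /Rintegral E.
by apply: (@intg_le_fin _ _ (2 * (l - F 0))) => //; [exact: continuous_measurable_fun | rewrite E].
Qed.

Lemma cvg_expR_bounded (e M : R) (G : R -> R) : 0 < e -> (forall x, `|G x| <= M) ->
  expR (- (e * x)) * G x @[x --> +oo] --> (0 : R).
Proof.
move=> e0 GM.
have M0 : 0 <= M by apply: le_trans (GM 0).
apply: norm_cvg0.
apply: (@squeeze_cvgr _ _ _ _ (cst 0) (fun x => M * expR (- (e * x)))).
- near=> x; rewrite normr_ge0/= normrM mulrC.
  by rewrite (ger0_norm (expR_ge0 _)) ler_wpM2r// expR_ge0.
- exact: cvg_cst.
- rewrite -[X in _ --> X](mulr0 M); apply: cvgZr.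
  apply: (@cvg_comp _ _ _ (fun x => e * x) (fun y => expR (- y)) _ _ _ _ (@cvgr_expR R)).
  apply/cvgryPge => A; near=> x.
  rewrite mulrC -ler_pdivrMr//; near: x; exact: nbhs_pinfty_ge.
Unshelve. all: end_near. Qed.

Lemma continuous_normM (e : R) : continuous (fun x : R => expR (- (e * `|x|))).
Proof.
move=> x; apply: continuous_comp; last exact: continuous_expR.
by apply: cvgN; apply: cvgZr; exact: norm_continuous.
Qed.

(** The Poisson kernel normalized to total mass 2 pi, that is, the Fourier transform of exp(-e
    |x|). *)
Definition poisson (e y : R) : R := 2 * e / (e ^+ 2 + y ^+ 2).

(** The summand 1 makes the integrand nonnegative, as [even_FTC2] demands; it is removed in
    [ct_expabs] by subtracting half of the case y = 0. *)
Lemma expabs_cos (e y : R) : 0 < e ->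
  intg (fun x => expR (- (e * `|x|)) * (1 + cos (y * x))) /\
  Rint (fun x => expR (- (e * `|x|)) * (1 + cos (y * x))) = 2 / e + poisson e y.
Proof.
move=> e0; have en : e != 0 by rewrite gt_eqF.
have sn : e ^+ 2 + y ^+ 2 != 0 by rewrite gt_eqF// ltr_pwDl ?exprn_gt0 ?sqr_ge0.
pose G x := - e^-1 + (e ^+ 2 + y ^+ 2)^-1 * (y * sin (y * x) - e * cos (y * x)).
pose F x := expR (- e * x) * G x.
have [||||||h1 h2] := @even_FTC2 (fun x => expR (- (e * `|x|)) * (1 + cos (y * x))) F 0.
- by move=> x; rewrite mulr_ge0 ?expR_ge0// -lerBlDl sub0r cos_geN1.
- move=> x; apply: cvgM; first exact: continuous_normM.
  apply: cvgD; first exact: cvg_cst.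
  apply: continuous_comp; last exact: continuous_cos.
  exact: mulrl_continuous.
- by move=> x; rewrite normrN mulrN cosN.
- move=> x x0.
  have dG : is_derive x 1 G ((e ^+ 2 + y ^+ 2)^-1 * (y * (y * cos (y * x)) - e * (- y * sin (y * x)))).
    have := is_deriveD (is_derive_cst (- e^-1) x 1) (is_deriveZ (e ^+ 2 + y ^+ 2)^-1
      (is_deriveB (is_deriveZ y (is_derive_sinM y x)) (is_deriveZ e (is_derive_cosM y x)))).
    by rewrite add0r.
  have := is_deriveM (is_derive_expRM (- e) x) dG.
  move=> H; apply: (is_derive_eq H); rewrite /GRing.scale/= (gtr0_norm x0) mulNr /G.
  by field; rewrite sn en.
- apply: cvgM.
  + by have := is_derive_expRM (- e) 0 => -[/derivable1_diffP/differentiable_continuous].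
  + apply: cvgD; first exact: cvg_cst.
    apply: cvgZr; apply: cvgB; apply: cvgZr.
    * by have := is_derive_sinM y 0 => -[/derivable1_diffP/differentiable_continuous].
    * by have := is_derive_cosM y 0 => -[/derivable1_diffP/differentiable_continuous].
- rewrite /F; under eq_fun do rewrite mulNr.
  apply: (@cvg_expR_bounded _ (e^-1 + (e ^+ 2 + y ^+ 2)^-1 * (`|y| + e))) => // x.
  rewrite /G (le_trans (ler_normD _ _))// lerD//.
    by rewrite normrN ger0_norm// invr_ge0 ltW.
  rewrite normrM ger0_norm; last by rewrite invr_ge0 addr_ge0// sqr_ge0.
  apply: ler_wpM2l; first by rewrite invr_ge0 addr_ge0// sqr_ge0.
  rewrite (le_trans (ler_normB _ _))// lerD// normrM.
    by rewrite ler_piMr// sin_max.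
  by rewrite (gtr0_norm e0) ler_piMr ?cos_max// ltW.
split => //; rewrite h2 /F /G /poisson mulr0 expR0 mulr0 sin0 cos0.
by field; rewrite ?en ?sn.
Qed.

Lemma intg_expabs (e : R) : 0 < e -> intg (fun x => expR (- (e * `|x|))).
Proof.
move=> e0; have [h _] := expabs_cos 0 e0.
apply: eq_intg (intgZ 2^-1 h) => x.
by rewrite mul0r cos0; field.
Qed.

Lemma intg_cosM f x : intg f -> intg (fun w => cos (x * w) * f w).
Proof.
move=> hf; apply: (@intg_bounded _ _ 1) => // [|w]; last exact: cos_max.
apply: continuous_measurable_fun => w; apply: continuous_comp.
  exact: mulrl_continuous.
exact: continuous_cos.
Qed.

Lemma intg_sinM f x : intg f -> intg (fun w => sin (x * w) * f w).
Proof.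
move=> hf; apply: (@intg_bounded _ _ 1) => // [|w]; last exact: sin_max.
apply: continuous_measurable_fun => w; apply: continuous_comp.
  exact: mulrl_continuous.
exact: continuous_sin.
Qed.

(* The real and imaginary parts of [fourier q x], by conversion. *)
Definition ct q (x : R) : R := Rint (fun w => cos (x * w) * q w).
Definition st q (x : R) : R := Rint (fun w => sin (x * w) * q w).

Lemma ct_expabs (e y : R) : 0 < e ->
  ct (fun x => expR (- (e * `|x|))) y = poisson e y.
Proof.
move=> e0; have [h1 h2] := expabs_cos y e0; have [h3 h4] := expabs_cos 0 e0.
have i0 := intg_expabs e0.
have -> : ct (fun x => expR (- (e * `|x|))) y =
    Rint (fun x => expR (- (e * `|x|)) * (1 + cos (y * x))) -
    2^-1 * Rint (fun x => expR (- (e * `|x|)) * (1 + cos (0 * x))).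
  rewrite -RintZ// -RintB//; last exact: intgZ.
  by apply: eq_Rint => x; rewrite mul0r cos0; field.
rewrite h2 h4 /poisson; field.
by rewrite !gt_eqF// ltr_pwDl ?exprn_gt0 ?sqr_ge0.
Qed.

Lemma poisson_ge0 (e y : R) : 0 < e -> 0 <= poisson e y.
Proof.
by move=> e0; rewrite divr_ge0 ?mulr_ge0 ?addr_ge0 ?sqr_ge0// ltW.
Qed.

Lemma continuous_poisson (e : R) : 0 < e -> continuous (poisson e).
Proof.
move=> e0 y; apply: cvgZr; apply: cvgV.
  by rewrite gt_eqF// ltr_pwDl ?exprn_gt0 ?sqr_ge0.
by apply: cvgD; [exact: cvg_cst | exact: exprn_continuous].
Qed.

Lemma integral_poisson (e : R) : 0 < e -> intg (poisson e) /\ Rint (poisson e) = 2 * pi.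
Proof.
move=> e0; have en : e != 0 by rewrite gt_eqF.
have dF (x : R) : is_derive x 1 (fun x => 2 * atan (e^-1 * x)) (poisson e x).
  have sn : e ^+ 2 + x ^+ 2 != 0 by rewrite gt_eqF// ltr_pwDl ?exprn_gt0 ?sqr_ge0.
  have := @is_derive1_comp R atan (fun x => e^-1 * x) x _ _ (is_derive1_atan _) (is_derive_mulk e^-1 x).
  move=> /(is_deriveZ 2) H; apply: (is_derive_eq H).
  have sn' : 1 + (e^-1 * x) ^+ 2 != 0 by rewrite gt_eqF// ltr_pwDl ?sqr_ge0.
  rewrite /GRing.scale/= /poisson; field.
  by rewrite sn en /=.
have cF : {for 0, continuous (fun x => 2 * atan (e^-1 * x))}.
  by have := dF 0 => -[/derivable1_diffP/differentiable_continuous].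
have lF : 2 * atan (e^-1 * x) @[x --> +oo] --> pi.
  rewrite [X in _ --> X](_ : _ = 2 * (pi / 2)); last by field.
  apply: cvgZr; apply: (@cvg_comp _ _ _ (fun x => e^-1 * x) (@atan R) _ _ _ _ (@cvgy_atan R)).
  apply/cvgryPge => A; near=> x.
  rewrite mulrC ler_pdivlMr//; near: x; exact: nbhs_pinfty_ge.
have [||h1 h2] := even_FTC2 _ (continuous_poisson e0) _ (fun x _ => dF x) cF lF.
- by move=> x; exact: poisson_ge0.
- by move=> x; rewrite /poisson sqrrN.
by split => //; rewrite h2 mulr0 atan0 mulr0 subr0.
Unshelve. all: end_near. Qed.

End poisson.

(** * Bessel's inequality and Fourier inversion by damping *)

Section bessel.
Context (R : realType).
Notation leb := (@lebesgue_measure R).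
Implicit Types (f g h q F G : R -> R).

Lemma measurable_cosM2 : measurable_fun [set: R * R] (fun z : R * R => cos (z.1 * z.2)).
Proof.
apply: (measurableT_comp (continuous_measurable_fun (@continuous_cos R))).
exact: measurable_funM.
Qed.

Lemma measurable_sinM2 : measurable_fun [set: R * R] (fun z : R * R => sin (z.1 * z.2)).
Proof.
apply: (measurableT_comp (continuous_measurable_fun (@continuous_sin R))).
exact: measurable_funM.
Qed.

Lemma measurable_ct q : measurable_fun setT q -> measurable_fun setT (ct q).
Proof.
move=> mq; apply: (measurable_Rint_param (k := fun z => cos (z.1 * z.2) * q z.2)).
by apply: measurable_funM; [exact: measurable_cosM2 | exact: measurableT_comp].
Qed.

Lemma measurable_st q : measurable_fun setT q -> measurable_fun setT (st q).
Proof.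
move=> mq; apply: (measurable_Rint_param (k := fun z => sin (z.1 * z.2) * q z.2)).
by apply: measurable_funM; [exact: measurable_sinM2 | exact: measurableT_comp].
Qed.

Lemma ct_bound q x : intg q -> `|ct q x| <= Rint (fun w => `|q w|).
Proof.
move=> hq; apply: le_trans (normr_Rint (intg_cosM x hq)) _.
apply: le_Rint; [exact/intg_abs/intg_cosM|exact: intg_abs|].
by move=> w; rewrite normrM ler_piMl// cos_max.
Qed.

Lemma st_bound q x : intg q -> `|st q x| <= Rint (fun w => `|q w|).
Proof.
move=> hq; apply: le_trans (normr_Rint (intg_sinM x hq)) _.
apply: le_Rint; [exact/intg_abs/intg_sinM|exact: intg_abs|].
by move=> w; rewrite normrM ler_piMl// sin_max.
Qed.

Lemma intg_conv (a b : R -> R) (M : R) : intg a -> intg b -> (forall x, `|b x| <= M) ->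
  intg (fun w => Rint (fun v => a v * b (w - v))) /\
  Rint (fun w => Rint (fun v => a v * b (w - v))) = Rint a * Rint b.
Proof.
move=> ha hb bM.
have ma := intg_measurable ha; have mb := intg_measurable hb.
pose Fr (z : measurableTypeR R * measurableTypeR R) : R := a z.2 * b (z.1 - z.2).
pose F : measurableTypeR R * measurableTypeR R -> \bar R := EFin \o Fr.
have mF : measurable_fun [set: measurableTypeR R * measurableTypeR R] F.
  apply: measurableT_comp => //; apply: measurable_funM; first exact: measurableT_comp.
  by apply: measurableT_comp => //; exact: measurable_funB.
have hbs v : intg (fun w => b (w - v)) by exact: intg_shift.
have Rbs v : Rint (fun w => b (w - v)) = Rint b by rewrite -Rint_shift.
have Rbsa v : Rint (fun w => `|b (w - v)|) = Rint (fun w => `|b w|).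
  by rewrite (Rint_shift (-v) (f := fun w => `|b w|))//; exact: measurableT_comp.
have mbs (w : R) : measurable_fun setT (fun v : R => b (w - v)).
  by apply: measurableT_comp => //; exact: measurable_funB.
have ha1 w : intg (fun v => a v * b (w - v)).
  by apply: eq_intg (intg_bounded ha (mbs w) (fun v => bM _)) => v; rewrite mulrC.
have iF : (leb \x leb)%E.-integrable setT F.
  apply/(integrable21ltyP _ _ mF).
  apply: (@le_lt_trans _ _ (\int[leb]_v (Rint (fun w => `|b w|) * `|a v|)%:E)%E).
    apply: ge0_le_integral_leb.
    - by move=> x; exact: integral_ge0.
    - apply: (@measurable_fun_fubini_tonelli_G _ _ (measurableTypeR R) (measurableTypeR R) R leb (abse \o F)) => //.
      exact: measurableT_comp.
      by move=> z; exact: abse_ge0.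
    - apply/measurable_EFinP; apply: measurable_funM => //.
      exact: measurableT_comp.
    - move=> v; rewrite (_ : integral _ _ _ = \int[leb]_w (`|a v| * `|b (w - v)|)%:E)%E; last first.
        by apply: eq_integral => y _; rewrite /F/= normrM.
      rewrite -EFin_Rint; last by apply: intgZ; exact: intg_abs.
      rewrite RintZ; last exact: intg_abs.
      by rewrite Rbsa lee_fin mulrC.
  rewrite -EFin_Rint ?ltry//; apply: intgZ; exact: intg_abs.
have FE w : (\int[leb]_v F (w, v) = (Rint (fun v => a v * b (w - v)))%:E)%E.
  by rewrite EFin_Rint.
split.
  have := integrable_fubini_F iF; rewrite (_ : fubini_F leb F = EFin \o (fun w => Rint (fun v => a v * b (w - v))))//.
  by apply/funext => w; rewrite /fubini_F FE.
have := Fubini iF.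
under eq_integral do rewrite FE.
move=> e; transitivity (fine (\int[leb]_w (Rint (fun v => a v * b (w - v)))%:E)%E) => //.
rewrite e mulrC -RintZ//; apply: (congr1 fine); apply: eq_integral => v _.
rewrite /F/Fr/= -EFin_Rint; last exact: intgZ.
by rewrite RintZ// Rbs mulrC.
Qed.

(** The damping factor increases to 1 as e decreases to 0; along e = 1/(n+1), monotone convergence
    carries the uniform bound to the limit and yields integrability as well. *)
Lemma monotone_limit_expabs (S : R -> R) (C : R) : measurable_fun setT S ->
  (forall x, 0 <= S x) ->
  (forall e, 0 < e -> intg (fun x => expR (- (e * `|x|)) * S x) /\
      Rint (fun x => expR (- (e * `|x|)) * S x) <= C) ->
  intg S /\ Rint S <= C.
Proof.
move=> mS S0 h.
have E : (\int[leb]_x (S x)%:E <= C%:E)%E.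
  pose g n x := (expR (- (n.+1%:R^-1 * `|x|)) * S x)%:E.
  have gx x : g n x @[n --> \oo] --> (S x)%:E.
    apply: cvg_EFin; first by near=> n.
    rewrite -[X in _ --> X]mul1r; apply: cvgZl.
    rewrite -[X in _ --> X]expR0; apply: continuous_cvg; first exact: continuous_expR.
    rewrite -[X in _ --> X]oppr0 -[X in _ --> - X](mul0r `|x|); apply: cvgN; apply: cvgZl.
    exact: cvg_harmonic.
  have e0 n : 0 < n.+1%:R^-1 :> R by rewrite invr_gt0.
  have := @cvg_monotone_convergence _ _ R leb setT measurableT g _ _ _.
  rewrite (_ : (fun x => limn (g ^~ x)) = EFin \o S); last first.
    by apply/funext => x; apply/cvg_lim => //; exact: gx.
  move=> H; apply: (cvge_to_le (H _ _ _)).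
  - move=> n; apply/measurable_EFinP; apply: measurable_funM => //.
    by apply: continuous_measurable_fun; exact: continuous_normM.
  - by move=> n x _; rewrite lee_fin mulr_ge0// expR_ge0.
  - move=> x _ m n mn; rewrite lee_fin ler_wpM2r// ler_expR lerN2 ler_wpM2r//.
    by rewrite lef_pV2 ?posrE// ler_nat.
  - near=> n; have [h1 h2] := h _ (e0 n).
    by rewrite /g -EFin_Rint// lee_fin.
have iS := intg_le_fin mS S0 E.
by split => //; rewrite -lee_fin EFin_Rint.
Unshelve. all: end_near. Qed.

End bessel.

Section inversion.
Context (R : realType).
Notation leb := (@lebesgue_measure R).
Implicit Types (f g h q F G : R -> R) (e x y v w : R).

Let E e x := expR (- (e * `|x|)).

Lemma poisson_le e y : 0 < e -> poisson e y <= 2 / e.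
Proof.
move=> e0; have e20 : 0 < e ^+ 2 by rewrite exprn_gt0.
rewrite /poisson ler_pdivrMr ?ltr_pwDl ?sqr_ge0//.
rewrite (_ : 2 / e * _ = 2 * e + 2 / e * y ^+ 2); last by field; rewrite gt_eqF.
by rewrite lerDl mulr_ge0 ?sqr_ge0// divr_ge0// ltW.
Qed.

Lemma poissonN e y : poisson e (- y) = poisson e y.
Proof. by rewrite /poisson sqrrN. Qed.

Lemma poisson_bound e y : 0 < e -> `|poisson e y| <= 2 / e.
Proof. by move=> e0; rewrite ger0_norm ?poisson_ge0// poisson_le. Qed.

Lemma measurable_poisson e : 0 < e -> measurable_fun setT (poisson e).
Proof. by move=> e0; apply: continuous_measurable_fun; exact: continuous_poisson. Qed.

Lemma intg_bpoisson f e w : 0 < e -> intg f -> intg (fun v => f v * poisson e (w - v)).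
Proof.
move=> e0 hf.
have mp : measurable_fun setT (fun v => poisson e (w - v)).
  by apply: (measurableT_comp (measurable_poisson e0)); exact: measurable_funB.
by apply: eq_intg (intg_bounded hf mp (fun v => poisson_bound _ e0)) => v; rewrite mulrC.
Qed.

Lemma measurable_cosM x : measurable_fun setT (fun w => cos (x * w)).
Proof.
apply: (measurableT_comp (continuous_measurable_fun (@continuous_cos R))).
exact: measurable_funM.
Qed.

Lemma measurable_sinM x : measurable_fun setT (fun w => sin (x * w)).
Proof.
apply: (measurableT_comp (continuous_measurable_fun (@continuous_sin R))).
exact: measurable_funM.
Qed.

Lemma intg_expabsM e (k : R -> R) (M : R) : 0 < e -> measurable_fun setT k ->
  (forall x, `|k x| <= M) -> intg (fun x => E e x * k x).
Proof.
move=> e0 mk kM.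
by apply: eq_intg (intg_bounded (intg_expabs e0) mk kM) => x; rewrite mulrC.
Qed.

Lemma Rint_expabs_cos e y : 0 < e -> Rint (fun x => E e x * cos (y * x)) = poisson e y.
Proof. by move=> e0; rewrite -ct_expabs//; apply: eq_Rint => x; rewrite mulrC. Qed.

(** The left side is the damped inverse Fourier integral. Exchanging the integrals leaves the
    transform of exp(-e |x|) at w - v, by the addition formula for the cosine. *)
Lemma poisson_smoothing q e w : 0 < e -> intg q ->
  Rint (fun x => E e x * (cos (w * x) * ct q x + sin (w * x) * st q x)) =
  Rint (fun v => q v * poisson e (w - v)).
Proof.
move=> e0 hq; have mq := intg_measurable hq.
have mc := measurable_ct mq; have ms := measurable_st mq.
have ic : intg (fun x => E e x * cos (w * x)).
  by apply: (intg_expabsM e0 (measurable_cosM w)) => x; exact: cos_max.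
have is' : intg (fun x => E e x * sin (w * x)).
  by apply: (intg_expabsM e0 (measurable_sinM w)) => x; exact: sin_max.
have ic2 : intg (fun x => E e x * cos (w * x) * ct q x).
  by apply: eq_intg (intg_bounded ic mc (fun x => ct_bound x hq)) => x; rewrite mulrC.
have is2 : intg (fun x => E e x * sin (w * x) * st q x).
  by apply: eq_intg (intg_bounded is' ms (fun x => st_bound x hq)) => x; rewrite mulrC.
transitivity (Rint (fun x => E e x * cos (w * x) * ct q x) +
              Rint (fun x => E e x * sin (w * x) * st q x)).
  by rewrite -RintD//; apply: eq_Rint => x; rewrite mulrDr !mulrA.
rewrite (fubini_Rint ic hq (@measurable_cosM2 R) (fun z => cos_max (z.1 * z.2))).
rewrite (fubini_Rint is' hq (@measurable_sinM2 R) (fun z => sin_max (z.1 * z.2))).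
have iv v : intg (fun x => cos (x * v) * (E e x * cos (w * x))).
  by apply: eq_intg (intg_cosM v ic) => x; rewrite (mulrC v).
have iv' v : intg (fun x => sin (x * v) * (E e x * sin (w * x))).
  by apply: eq_intg (intg_sinM v is') => x; rewrite (mulrC v).
have mcI : measurable_fun setT (fun v => Rint (fun x => cos (x * v) * (E e x * cos (w * x)))).
  apply: (measurable_Rint_param (k := fun z => cos (z.2 * z.1) * (E e z.2 * cos (w * z.2)))).
  apply: measurable_funM.
    apply: (measurableT_comp (continuous_measurable_fun (@continuous_cos R))).
    exact: measurable_funM.
  by apply: (measurableT_comp (intg_measurable ic)).
have msI : measurable_fun setT (fun v => Rint (fun x => sin (x * v) * (E e x * sin (w * x)))).
  apply: (measurable_Rint_param (k := fun z => sin (z.2 * z.1) * (E e z.2 * sin (w * z.2)))).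
  apply: measurable_funM.
    apply: (measurableT_comp (continuous_measurable_fun (@continuous_sin R))).
    exact: measurable_funM.
  by apply: (measurableT_comp (intg_measurable is')).
have bc v : `|Rint (fun x => cos (x * v) * (E e x * cos (w * x)))| <= Rint (E e).
  apply: le_trans (normr_Rint (iv v)) _; apply: le_Rint.
  - exact: intg_abs.
  - exact: intg_expabs.
  - move=> x; rewrite !normrM (ger0_norm (expR_ge0 _)) mulrCA -[leRHS]mulr1.
    by rewrite ler_wpM2l ?expR_ge0// -[leRHS]mulr1 ler_pM ?cos_max.
have bs v : `|Rint (fun x => sin (x * v) * (E e x * sin (w * x)))| <= Rint (E e).
  apply: le_trans (normr_Rint (iv' v)) _; apply: le_Rint.
  - exact: intg_abs.
  - exact: intg_expabs.
  - move=> x; rewrite !normrM (ger0_norm (expR_ge0 _)) mulrCA -[leRHS]mulr1.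
    by rewrite ler_wpM2l ?expR_ge0// -[leRHS]mulr1 ler_pM ?sin_max.
rewrite -RintD; last 2 first.
- by apply: eq_intg (intg_bounded hq mcI bc) => v; rewrite mulrC.
- by apply: eq_intg (intg_bounded hq msI bs) => v; rewrite mulrC.
apply: eq_Rint => v; rewrite -mulrDr -RintD; [|exact: iv|exact: iv']; congr (_ * _).
rewrite -Rint_expabs_cos//; apply: eq_Rint => x.
rewrite mulrBl cosB (mulrC v x); ring.
Qed.

(** The damped energy of the transform equals the integral of q times its Poisson smoothing.
    Bounding q(w) q(v) by the mean of the two squares and using that the kernel has mass 2 pi gives
    a bound free of e, and the damping is removed by monotone convergence. *)
Lemma bessel q : intg q -> intg (fun w => q w ^+ 2) ->
  intg (fun x => ct q x ^+ 2 + st q x ^+ 2) /\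
  Rint (fun x => ct q x ^+ 2 + st q x ^+ 2) <= 2 * pi * Rint (fun w => q w ^+ 2).
Proof.
move=> hq hq2; have mq := intg_measurable hq.
have mc := measurable_ct mq; have ms := measurable_st mq.
apply: monotone_limit_expabs => [|x|e e0].
- by apply: measurable_funD; apply: measurable_funX.
- by rewrite addr_ge0 ?sqr_ge0.
have [ip Ip] := integral_poisson e0.
have [ic Ic] := intg_conv hq2 ip (fun x => poisson_bound x e0).
have [ic' _] := intg_conv (intg_abs hq) ip (fun x => poisson_bound x e0).
pose a x := E e x * ct q x; pose b x := E e x * st q x.
have ia : intg a by apply: (intg_expabsM e0 mc) => x; exact: ct_bound.
have ib : intg b by apply: (intg_expabsM e0 ms) => x; exact: st_bound.
have ia2 : intg (fun x => a x * ct q x).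
  by apply: eq_intg (intg_bounded ia mc (fun x => ct_bound x hq)) => x; rewrite mulrC.
have ib2 : intg (fun x => b x * st q x).
  by apply: eq_intg (intg_bounded ib ms (fun x => st_bound x hq)) => x; rewrite mulrC.
split.
  by apply: eq_intg (intgD ia2 ib2) => x; rewrite /a /b /E; ring.
pose J w := Rint (fun v => q v * poisson e (w - v)).
have e1 : Rint (fun x => E e x * (ct q x ^+ 2 + st q x ^+ 2)) =
    Rint (fun x => a x * ct q x) + Rint (fun x => b x * st q x).
  by rewrite -RintD//; apply: eq_Rint => x; rewrite /a /b /E; ring.
have bJ w : `|J w| <= 2 / e * Rint (fun v => `|q v|).
  apply: le_trans (normr_Rint (intg_bpoisson w e0 hq)) _.
  rewrite -RintZ; last exact: intg_abs.
  apply: le_Rint.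
  - exact/intg_abs/intg_bpoisson.
  - exact/intgZ/intg_abs.
  - by move=> v; rewrite normrM mulrC ler_wpM2r// poisson_bound.
have mJ : measurable_fun setT J.
  apply: (measurable_Rint_param (k := fun z => q z.2 * poisson e (z.1 - z.2))).
  apply: measurable_funM; first exact: measurableT_comp.
  by apply: (measurableT_comp (measurable_poisson e0)); exact: measurable_funB.
have iqJ : intg (fun w => q w * J w).
  by apply: eq_intg (intg_bounded hq mJ bJ) => w; rewrite mulrC.
have e2 : Rint (fun x => a x * ct q x) + Rint (fun x => b x * st q x) =
    Rint (fun w => q w * J w).
  rewrite (fubini_Rint ia hq (@measurable_cosM2 R) (fun z => cos_max (z.1 * z.2))).
  rewrite (fubini_Rint ib hq (@measurable_sinM2 R) (fun z => sin_max (z.1 * z.2))).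
  have ica w : intg (fun x => cos (x * w) * a x).
    by apply: eq_intg (intg_cosM w ia) => x; rewrite (mulrC w).
  have isb w : intg (fun x => sin (x * w) * b x).
    by apply: eq_intg (intg_sinM w ib) => x; rewrite (mulrC w).
  have ba w : `|Rint (fun x => cos (x * w) * a x)| <= Rint (fun x => `|a x|).
    have := ct_bound w ia; rewrite /ct; under [X in `|X|]eq_Rint do rewrite mulrC (mulrC w) mulrC.
    by [].
  have bb w : `|Rint (fun x => sin (x * w) * b x)| <= Rint (fun x => `|b x|).
    have := st_bound w ib; rewrite /st; under [X in `|X|]eq_Rint do rewrite mulrC (mulrC w) mulrC.
    by [].
  have ma' : measurable_fun setT (fun w => Rint (fun x => cos (x * w) * a x)).
    have := measurable_ct (intg_measurable ia); congr measurable_fun; apply/funext => w.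
    by apply: eq_Rint => x; rewrite (mulrC w).
  have mb' : measurable_fun setT (fun w => Rint (fun x => sin (x * w) * b x)).
    have := measurable_st (intg_measurable ib); congr measurable_fun; apply/funext => w.
    by apply: eq_Rint => x; rewrite (mulrC w).
  rewrite -RintD; last 2 first.
  - by apply: eq_intg (intg_bounded hq ma' ba) => w; rewrite mulrC.
  - by apply: eq_intg (intg_bounded hq mb' bb) => w; rewrite mulrC.
  apply: eq_Rint => w; rewrite -mulrDr -RintD; [|exact: ica|exact: isb]; congr (_ * _).
  rewrite /J -poisson_smoothing//; apply: eq_Rint => x.
  rewrite /a /b /E (mulrC x w); ring.
rewrite -/(E e) e1 e2.
have iq2J : intg (fun w => pi * q w ^+ 2 + 2^-1 * Rint (fun v => q v ^+ 2 * poisson e (w - v))).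
  by apply: intgD; apply: intgZ.
apply: (@le_trans _ _ (Rint (fun w => pi * q w ^+ 2 +
    2^-1 * Rint (fun v => q v ^+ 2 * poisson e (w - v))))); last first.
  rewrite RintD; [|exact: intgZ|exact: intgZ].
  rewrite !RintZ// Ic Ip le_eqVlt; apply/orP; left; apply/eqP; by field.
apply: le_Rint => // w.
have ipw : intg (fun v => poisson e (w - v)).
  have := intg_shift (- w) ip; apply: eq_intg => v.
  by rewrite -poissonN opprB.
have Ipw : Rint (fun v => poisson e (w - v)) = 2 * pi.
  rewrite -Ip (Rint_shift (- w) (measurable_poisson e0)).
  by apply: eq_Rint => v; rewrite -poissonN opprB.
rewrite /J -RintZ; last exact: intg_bpoisson.
have -> : pi * q w ^+ 2 + 2^-1 * Rint (fun v => q v ^+ 2 * poisson e (w - v)) =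
  Rint (fun v => 2^-1 * q w ^+ 2 * poisson e (w - v) + 2^-1 * (q v ^+ 2 * poisson e (w - v))).
  rewrite RintD; last 2 first.
  - exact: intgZ.
  - exact/intgZ/intg_bpoisson.
  rewrite (RintZ (2^-1 * q w ^+ 2) ipw) (RintZ 2^-1 (intg_bpoisson w e0 hq2)).
  by rewrite Ipw; field.
apply: le_Rint.
- exact/intgZ/intg_bpoisson.
- by apply: intgD; [exact: intgZ|exact/intgZ/intg_bpoisson].
move=> v; rewrite -subr_ge0.
rewrite (_ : _ - _ = 2^-1 * (q w - q v) ^+ 2 * poisson e (w - v)); last by field.
by rewrite mulr_ge0 ?poisson_ge0// mulr_ge0 ?sqr_ge0.
Qed.

End inversion.

Section inversion.
Context (R : realType).
Notation leb := (@lebesgue_measure R).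
Implicit Types (f g h q F G : R -> R) (e x y v w : R).

Lemma ctN q x : ct q (- x) = ct q x.
Proof. by apply: eq_Rint => w; rewrite mulNr cosN. Qed.

Lemma stN q x : intg q -> st q (- x) = - st q x.
Proof.
move=> hq; rewrite /st -RintN; last exact: intg_sinM.
by apply: eq_Rint => w; rewrite mulNr sinN mulNr.
Qed.

Lemma st_even f y : (forall x, f (- x) = f x) -> intg f -> st f y = 0.
Proof.
move=> ef hf; have mf := intg_measurable hf.
have m1 : measurable_fun setT (fun x => sin (y * x) * f x).
  by apply: measurable_funM => //; exact: measurable_sinM.
have : st f y = - st f y.
  rewrite -stN// /st {1}(Rint_opp m1).
  by apply: eq_Rint => x; rewrite ef mulrN mulNr.
lra.
Qed.

(** Within distance eta of y the Lipschitz bound applies. Beyond it, the kernel of width e is at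
    most e (1 + eta^-2) times the kernel of width 1, whose mass is again 2 pi. *)
Lemma poisson_approx q (M L e eta y : R) : 0 < e -> 0 < eta -> intg q -> 0 <= L ->
  (forall v, `|q v| <= M) -> (forall v w, `|q v - q w| <= L * `|v - w|) ->
  `|Rint (fun v => q v * poisson e (y - v)) - 2 * pi * q y| <=
  2 * pi * (L * eta + 2 * M * e * (1 + eta ^- 2)).
Proof.
move=> e0 eta0 hq L0 qM qL.
have M0 : 0 <= M by apply: le_trans (qM 0).
have sh c : 0 < c -> intg (fun v => poisson c (y - v)) /\
    Rint (fun v => poisson c (y - v)) = 2 * pi.
  move=> c0; have [ip <-] := integral_poisson c0; split.
    by have := intg_shift (- y) ip; apply: eq_intg => v; rewrite -poissonN opprB.
  rewrite (Rint_shift (- y) (measurable_poisson c0)).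
  by apply: eq_Rint => v; rewrite -poissonN opprB.
have [ie Ie] := sh _ e0; have [i1 I1] := sh _ ltr01.
have iqp := intg_bpoisson y e0 hq.
rewrite -Ie mulrC -RintZ// -RintB//; last exact: intgZ.
apply: le_trans (normr_Rint _) _; first by apply: intgB => //; exact: intgZ.
have -> : Rint (fun v => poisson e (y - v)) * (L * eta + 2 * M * e * (1 + eta ^- 2)) =
  Rint (fun v => (L * eta) * poisson e (y - v) +
     (2 * M * e * (1 + eta ^- 2)) * poisson 1 (y - v)).
  rewrite RintD; [|exact: intgZ|exact: intgZ].
  by rewrite (RintZ _ ie) (RintZ _ i1) Ie I1; ring.
apply: le_Rint.
- by apply: intg_abs; apply: intgB => //; exact: intgZ.
- by apply: intgD; exact: intgZ.
move=> v; rewrite -mulrBl normrM (ger0_norm (poisson_ge0 _ e0)).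
set t := y - v.
have tE : `|q v - q y| <= L * `|t| by apply: le_trans (qL _ _) _; rewrite distrC.
have q2 : `|q v - q y| <= 2 * M.
  by apply: le_trans (ler_normB _ _) _; have := qM v; have := qM y; lra.
have pe := poisson_ge0 t e0; have p1 := poisson_ge0 t (@ltr01 R).
have c0 : 0 <= 2 * M * e * (1 + eta ^- 2).
  by rewrite !mulr_ge0 ?(ltW e0)// addr_ge0// invr_ge0 exprn_ge0// ltW.
have [te|te] := leP `|t| eta.
  apply: (@le_trans _ _ (L * eta * poisson e t)).
    by rewrite ler_wpM2r// (le_trans tE)// ler_wpM2l.
  by rewrite lerDl mulr_ge0.
apply: (@le_trans _ _ (2 * M * e * (1 + eta ^- 2) * poisson 1 t)); last first.
  by rewrite lerDr mulr_ge0// mulr_ge0// ltW.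
apply: (@le_trans _ _ (2 * M * poisson e t)); first by rewrite ler_wpM2r.
rewrite -!mulrA; apply: ler_wpM2l => //; apply: ler_wpM2l => //.
have t20 : eta ^+ 2 < t ^+ 2.
  by rewrite -[ltRHS]real_normK ?num_real// ltrXn2r// ltW.
have eta20 : 0 < eta ^+ 2 by rewrite exprn_gt0.
have e20 : 0 < e ^+ 2 by rewrite exprn_gt0.
have t2 : 0 < t ^+ 2 by lra.
rewrite /poisson expr1n mulr1.
rewrite (_ : e * _ = 2 * e * ((1 + (eta ^+ 2)^-1) / (1 + t ^+ 2))); last by ring.
apply: ler_wpM2l; first by rewrite mulr_ge0// ltW.
have es0 : 0 < e ^+ 2 + t ^+ 2 by lra.
rewrite ler_pdivlMr; last by lra.
rewrite mulrC ler_pdivrMr//.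
have h : 1 <= (eta ^+ 2)^-1 * t ^+ 2 by rewrite mulrC ler_pdivlMr// mul1r ltW.
have h0 : 0 <= (eta ^+ 2)^-1 * e ^+ 2 by rewrite mulr_ge0 ?invr_ge0// ltW.
nra.
Qed.

(** The damped inverse integrals converge to the left side by dominated convergence and to the right
    side by [poisson_approx]. Evenness makes the sine transform vanish, so cosine transforms
    suffice. *)
Lemma fourier_inversion q (M L : R) y : intg q -> (forall v, q (- v) = q v) -> 0 <= L ->
  (forall v, `|q v| <= M) -> (forall v w, `|q v - q w| <= L * `|v - w|) ->
  intg (ct q) -> ct (ct q) y = 2 * pi * q y.
Proof.
move=> hq eq L0 qM qL hct.
have M0 : 0 <= M by apply: le_trans (qM 0).
(* With eta = 1/(n+1), the cube makes e (1 + eta^-2) of order 1/(n+1), like the Lipschitz term. *)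
pose ep (n : nat) : R := n.+1%:R ^- 3.
have ep0 n : 0 < ep n by rewrite invr_gt0 exprn_gt0.
have epc : ep n @[n --> \oo] --> (0 : R).
  rewrite (_ : ep = (fun x : R => x ^+ 3) \o (fun n => n.+1%:R^-1)); last first.
    by apply/funext => n; rewrite /ep/= exprVn.
  rewrite [X in _ --> X](_ : 0 = 0 ^+ 3 :> R); last by rewrite expr0n.
  exact: (@cvg_comp _ _ _ (fun n => n.+1%:R^-1) (fun x : R => x ^+ 3) _ _ _ (@cvg_harmonic R) (@exprn_continuous R 3 0)).
pose A n := Rint (fun x => expR (- (ep n * `|x|)) * (cos (y * x) * ct q x)).
have ict : intg (fun x => cos (y * x) * ct q x) by exact: intg_cosM.
have mct := intg_measurable ict.
have Alim : A n @[n --> \oo] --> ct (ct q) y.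
  pose F n x := (expR (- (ep n * `|x|)) * (cos (y * x) * ct q x))%:E.
  have iF n : intg (fun x => expR (- (ep n * `|x|)) * (cos (y * x) * ct q x)).
    apply: (@intg_bounded _ _ 1) => //.
      by apply: continuous_measurable_fun; exact: continuous_normM.
    move=> x; rewrite (ger0_norm (expR_ge0 _)) -[leRHS]expR0 ler_expR oppr_le0.
    by rewrite mulr_ge0// ltW.
  have H : (A n)%:E @[n --> \oo] --> (ct (ct q) y)%:E.
    rewrite (EFin_Rint ict) (_ : (fun n => (A n)%:E) = (fun n => \int[leb]_x F n x)%E); last first.
      by apply/funext => n; rewrite EFin_Rint.
    apply: (@dominated_cvg _ _ R leb setT measurableT F
       (fun x => (cos (y * x) * ct q x)%:E) (fun x => `|cos (y * x) * ct q x|%:E)).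
    - by move=> n; apply/measurable_EFinP; exact: (intg_measurable (iF n)).
    - move=> x _; apply: cvg_EFin; first by near=> n.
      rewrite -[X in _ --> X]mul1r; apply: cvgZl.
      rewrite -[X in _ --> X]expR0; apply: continuous_cvg; first exact: continuous_expR.
      rewrite -[X in _ --> X]oppr0 -[X in _ --> - X](mul0r `|x|); apply: cvgN; apply: cvgZl.
      exact: epc.
    - by [].
    - exact: intg_abs.
    - move=> n x _ /=; rewrite lee_fin normrM ler_piMl//.
      rewrite (ger0_norm (expR_ge0 _)) -[leRHS]expR0 ler_expR oppr_le0.
      by rewrite mulr_ge0// ltW.
  exact: (fine_cvg H).
have Aerr n : `|A n - 2 * pi * q y| <= (2 * pi * (L + 4 * M)) * n.+1%:R^-1.
  have -> : A n = Rint (fun v => q v * poisson (ep n) (y - v)).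
    rewrite -poisson_smoothing//; apply: eq_Rint => x.
    by rewrite (st_even x eq hq) mulr0 addr0.
  set k : R := n.+1%:R; have k0 : 0 < k by rewrite /k.
  have k1 : 1 <= k by rewrite /k ler1n.
  have ik0 : 0 < k^-1 by rewrite invr_gt0.
  apply: le_trans (poisson_approx y (ep0 n) ik0 hq L0 qM qL) _.
  rewrite -[leRHS]mulrA; apply: ler_wpM2l; first by rewrite mulr_ge0// pi_ge0.
  rewrite [leRHS]mulrDl; apply: lerD => //; rewrite /ep -/k.
  rewrite (_ : 4 * M * k^-1 = 2 * M * (2 * k^-1)); last by ring.
  rewrite -[leLHS]mulrA; apply: ler_wpM2l; first by rewrite mulr_ge0.
  rewrite (_ : 2 * k^-1 = k ^- 3 * (2 * k ^+ 2)); last by field; rewrite gt_eqF.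
  apply: ler_wpM2l; first by rewrite invr_ge0 exprn_ge0// ltW.
  have : 1 <= k ^+ 2 by rewrite exprn_ege1.
  rewrite exprVn invrK; lra.
apply: (@cvg_unique _ _ (A n @[n --> \oo]) _ _ _ Alim).
  exact: norm_hausdorff.
apply/cvgrPdist_lt => e e0.
have C0 : 0 <= 2 * pi * (L + 4 * M) by rewrite !mulr_ge0 ?pi_ge0 ?addr_ge0// mulr_ge0.
set C := (2 * pi * (L + 4 * M)) in C0 Aerr.
have h0 : C * n.+1%:R^-1 @[n --> \oo] --> (0 : R).
  by rewrite -[X in _ --> X](mulr0 C); apply: cvgZr; exact: cvg_harmonic.
near=> n; rewrite distrC; apply: (le_lt_trans (Aerr n)).
apply: le_lt_trans (ler_norm _) _.
near: n.
by move/cvgrPdist_lt : h0 => /(_ e e0); apply: filterS => k; rewrite sub0r normrN.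
Unshelve. all: end_near. Qed.

End inversion.

(** * Windowed oscillating integrals *)

Section cut.
Context (R : realType).
Notation leb := (@lebesgue_measure R).
Implicit Types (u f g h q F G : R -> R) (a b x y v w : R).

(** Half-open, so that adjacent windows partition their union and no point lies in two of them. *)
Definition cut a b u x : R := if a <= x < b then u x else 0.

Lemma cutE a b u : cut a b u = u \_ `[a, b[.
Proof.
apply/funext => x; rewrite patchE /cut; congr (if _ then _ else _).
by apply/idP/idP; rewrite inE/= in_itv/=.
Qed.

Lemma integrable_itvcc a b u : continuous u -> leb.-integrable `[a, b] (EFin \o u).
Proof.
move=> cu; apply: continuous_compact_integrable; first exact: segment_compact.
exact: continuous_subspaceT.
Qed.

Lemma integrable_itvco a b u : continuous u -> leb.-integrable `[a, b[ (EFin \o u).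
Proof.
move=> /(@integrable_itvcc a b); apply: integrableS => //.
by apply: subset_itv; rewrite bnd_simp.
Qed.

Lemma Rint_cut a b u : continuous u ->
  Rint (cut a b u) = (\int[leb]_(x in `[a, b]) u x)%R.
Proof.
move=> cu; rewrite cutE /Rint -Rintegral_mkcond Rintegral_itv_bndo_bndc//.
exact: integrable_itvco.
Qed.

Lemma intg_cut a b u : continuous u -> intg (cut a b u).
Proof.
move=> cu; rewrite cutE /intg -restrict_EFin; apply/integrable_restrict => //=.
rewrite setTI; exact: integrable_itvco.
Qed.

Lemma is_derive_continuous u u' : (forall x, is_derive x 1 u (u' x)) -> continuous u.
Proof.
by move=> du x; have := du x => -[/derivable1_diffP/differentiable_continuous].
Qed.

Lemma continuous_cosM x : continuous (fun w => cos (x * w)).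
Proof. by apply: is_derive_continuous => w; exact: is_derive_cosM. Qed.

Lemma continuous_sinM x : continuous (fun w => sin (x * w)).
Proof. by apply: is_derive_continuous => w; exact: is_derive_sinM. Qed.

(** Multiplying the transform by x differentiates u; the zeros of u at both ends remove the boundary
    terms, although the cut function may have corners there. *)
Lemma cut_parts a b u u' x : a < b -> (forall w, is_derive w 1 u (u' w)) ->
  continuous u' -> u a = 0 -> u b = 0 ->
  x * ct (cut a b u) x = - st (cut a b u') x /\
  x * st (cut a b u) x = ct (cut a b u') x.
Proof.
move=> ab du cu' ua ub; have cu := is_derive_continuous du.
have dLR F F' : (forall w, is_derive w 1 F (F' w)) -> derivable_oo_LRcontinuous F a b.
  move=> dF; have cF := is_derive_continuous dF; split.
  - by move=> w _; have := dF w => -[].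
  - by apply: cvg_at_right_filter; exact: cF.
  - by apply: cvg_at_left_filter; exact: cF.
have d1 F F' : (forall w, is_derive w 1 F (F' w)) -> {in `]a, b[, derive1 F =1 F'}.
  by move=> dF w _; rewrite derive1E; have := dF w => -[].
have ccu : continuous (fun w => cos (x * w) * u w).
  by move=> w; apply: cvgM; [exact: continuous_cosM | exact: cu].
have csu : continuous (fun w => sin (x * w) * u w).
  by move=> w; apply: cvgM; [exact: continuous_sinM | exact: cu].
have ccu' : continuous (fun w => cos (x * w) * u' w).
  by move=> w; apply: cvgM; [exact: continuous_cosM | exact: cu'].
have csu' : continuous (fun w => sin (x * w) * u' w).
  by move=> w; apply: cvgM; [exact: continuous_sinM | exact: cu'].
have ctE f : continuous (fun w => cos (x * w) * f w) ->
    ct (cut a b f) x = (\int[leb]_(w in `[a, b]) (cos (x * w) * f w))%R.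
  move=> cf; rewrite -Rint_cut//; apply: eq_Rint => w.
  by rewrite /cut; case: ifP; rewrite ?mulr0.
have stE f : continuous (fun w => sin (x * w) * f w) ->
    st (cut a b f) x = (\int[leb]_(w in `[a, b]) (sin (x * w) * f w))%R.
  move=> cf; rewrite -Rint_cut//; apply: eq_Rint => w.
  by rewrite /cut; case: ifP; rewrite ?mulr0.
have iab f : continuous f -> leb.-integrable `[a, b] (EFin \o f).
  move=> cf; apply: continuous_compact_integrable; first exact: segment_compact.
  exact: continuous_subspaceT.
have cxc : continuous (fun w => x * cos (x * w)).
  by move=> w; apply: cvgZr; exact: continuous_cosM.
have cxs : continuous (fun w => x * sin (x * w)).
  by move=> w; apply: cvgZr; exact: continuous_sinM.
rewrite !ctE// !stE//; split.
- have := @Rintegration_by_parts R u (fun w => sin (x * w)) u' (fun w => x * cos (x * w)) a b ab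
    (continuous_subspaceT cu') (dLR _ _ du) (d1 _ _ du)
    (continuous_subspaceT cxc) (dLR _ _ (is_derive_sinM x)) (d1 _ _ (is_derive_sinM x)).
  rewrite ua ub !mul0r subrr sub0r => H.
  rewrite -RintegralZl//; last exact: iab.
  transitivity (\int[leb]_(x0 in `[a, b]) (u x0 * (x * cos (x * x0))))%R.
    by apply: eq_Rintegral => w _; ring.
  rewrite H.
  by congr (- _); apply: eq_Rintegral => w _; rewrite mulrC.
- have dc w : is_derive w 1 (fun w => - cos (x * w)) (x * sin (x * w)).
    by apply: (is_derive_eq (is_deriveN (is_derive_cosM x w))); rewrite mulNr opprK.
  have := @Rintegration_by_parts R u (fun w => - cos (x * w)) u' (fun w => x * sin (x * w)) a b ab
    (continuous_subspaceT cu') (dLR _ _ du) (d1 _ _ du)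
    (continuous_subspaceT cxs) (dLR _ _ dc) (d1 _ _ dc).
  rewrite ua ub !mul0r subrr sub0r => H.
  rewrite -RintegralZl//; last exact: iab.
  transitivity (\int[leb]_(x0 in `[a, b]) (u x0 * (x * sin (x * x0))))%R.
    by apply: eq_Rintegral => w _; ring.
  rewrite H.
  rewrite -mulN1r -RintegralZl//.
    by apply: eq_Rintegral => w _; ring.
  apply: iab => w; apply: cvgM; first exact: cu'.
  apply: cvgN; exact: continuous_cosM.
Qed.

End cut.

Section bump.
Context (R : realType) (r : nat).
Implicit Types (c w x : R).

(* The order r of the zeros at -1 and 1 allows r integrations by parts on a
   window without boundary terms. *)
Definition bump : {poly R} := (1 - 'X^2) ^+ r.

(* The i-th derivative of the bump rescaled to the window [c - w, c + w]. *)
Definition bumpd (i : nat) c w x : R := w ^- i * (bump^`(i)).[(x - c) / w].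

(** Each differentiation uses up at most one of the r factors 1 - X^2. *)
Lemma bump_derivn i : (i <= r)%N -> exists u : {poly R}, bump^`(i) = (1 - 'X^2) ^+ (r - i) * u.
Proof.
elim: i => [|i IH] ir; first by exists 1; rewrite derivn0 subn0 mulr1.
have [u e] := IH (ltnW ir).
rewrite derivnS e derivM.
have -> : (r - i = (r - i.+1).+1)%N by rewrite subnSK.
set t := 1 - 'X^2; set k := (r - i.+1)%N.
exists (t^`() * u *+ k.+1 + t * u^`()).
rewrite deriv_exp /= exprS mulrDr mulrnAl !mulrnAr; congr (_ *+ _ + _); ring.
Qed.

Lemma bump_derivn_root i x : (i < r)%N -> x ^+ 2 = 1 -> (bump^`(i)).[x] = 0.
Proof.
move=> ir x2; have [u ->] := bump_derivn (ltnW ir).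
rewrite hornerM horner_exp !hornerE x2 subrr expr0n.
by rewrite subn_eq0 leqNgt ir mul0r.
Qed.

Lemma is_derive_bumpd i c w x : is_derive x 1 (bumpd i c w) (bumpd i.+1 c w x).
Proof.
have d1 : is_derive x 1 (fun x => (x - c) / w) (w^-1).
  have := is_deriveM (is_deriveB (is_derive_id x 1) (is_derive_cst c x 1)) (is_derive_cst w^-1 x 1).
  move=> H; apply: (is_derive_eq H).
  by rewrite /GRing.scale/= mulr0 add0r subr0 mulr1.
have d2 := @is_derive1_comp R (fun y => (bump^`(i)).[y]) _ x _ _ (is_derive_poly _ _) d1.
apply: (is_derive_eq (is_deriveZ (w ^- i) d2)).
rewrite /bumpd derivnS /GRing.scale/= exprS invfM; ring.
Qed.

Lemma bumpd_edge i c w : w != 0 -> (i < r)%N ->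
  bumpd i c w (c - w) = 0 /\ bumpd i c w (c + w) = 0.
Proof.
move=> w0 ir; rewrite /bumpd; split.
- rewrite (_ : (c - w - c) / w = -1); last by field.
  by rewrite bump_derivn_root ?mulr0// sqrrN expr1n.
- rewrite (_ : (c + w - c) / w = 1); last by field.
  by rewrite bump_derivn_root ?mulr0// expr1n.
Qed.

Lemma poly_bounded (p : {poly R}) : exists2 M : R, 0 <= M & forall x, `|x| <= 1 -> `|p.[x]| <= M.
Proof.
exists (\sum_(i < size p) `|p`_i|); first exact: sumr_ge0.
move=> x x1; rewrite horner_coef; apply: le_trans (ler_norm_sum _ _ _) _.
apply: ler_sum => i _; rewrite normrM ler_piMr// normrX.
exact: exprn_ile1.
Qed.

Lemma bump_bounded (K : nat) : exists2 M : R, 1 <= M & forall i x, (i <= K)%N -> `|x| <= 1 ->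
  `|(bump^`(i)).[x]| <= M.
Proof.
elim: K => [|K [M M1 IH]].
  have [M M0 h] := poly_bounded bump^`(0).
  exists (M + 1); first by rewrite lerDr.
  by move=> i x; rewrite leqn0 => /eqP -> /h; lra.
have [M' M0 h] := poly_bounded bump^`(K.+1).
exists (M + M'); first by rewrite ler_wpDr.
move=> i x; rewrite leq_eqVlt => /orP[/eqP ->|]; first by move/h; lra.
by rewrite ltnS => /IH /[apply]; lra.
Qed.

End bump.

Section linear.
Context (R : realType).
Implicit Types (f g q : R -> R) (x : R).

Lemma ctD f g x : intg f -> intg g -> ct (fun w => f w + g w) x = ct f x + ct g x.
Proof.
move=> hf hg; rewrite /ct -RintD; [|exact: intg_cosM|exact: intg_cosM].
by apply: eq_Rint => w; rewrite mulrDr.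
Qed.

Lemma stD f g x : intg f -> intg g -> st (fun w => f w + g w) x = st f x + st g x.
Proof.
move=> hf hg; rewrite /st -RintD; [|exact: intg_sinM|exact: intg_sinM].
by apply: eq_Rint => w; rewrite mulrDr.
Qed.

Lemma ctZ k f x : intg f -> ct (fun w => k * f w) x = k * ct f x.
Proof.
move=> hf; rewrite /ct -RintZ; last exact: intg_cosM.
by apply: eq_Rint => w; rewrite mulrCA.
Qed.

Lemma stZ k f x : intg f -> st (fun w => k * f w) x = k * st f x.
Proof.
move=> hf; rewrite /st -RintZ; last exact: intg_sinM.
by apply: eq_Rint => w; rewrite mulrCA.
Qed.

Lemma eq_ct f g x : f =1 g -> ct f x = ct g x.
Proof. by move=> /funext ->. Qed.

Lemma eq_st f g x : f =1 g -> st f x = st g x.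
Proof. by move=> /funext ->. Qed.

Lemma ct_sum N (F : 'I_N -> R -> R) x : (forall k, intg (F k)) ->
  ct (fun w => \sum_k F k w) x = \sum_k ct (F k) x.
Proof.
move=> hF; rewrite /ct -Rint_sum; last by move=> k; exact: intg_cosM.
by apply: eq_Rint => w; rewrite mulr_sumr.
Qed.

Lemma st_sum N (F : 'I_N -> R -> R) x : (forall k, intg (F k)) ->
  st (fun w => \sum_k F k w) x = \sum_k st (F k) x.
Proof.
move=> hF; rewrite /st -Rint_sum; last by move=> k; exact: intg_sinM.
by apply: eq_Rint => w; rewrite mulr_sumr.
Qed.

Lemma intg_cut1 (a b : R) : intg (cut a b (fun=> 1)).
Proof. by apply: intg_cut => x; exact: cvg_cst. Qed.

Lemma Rint_cut1 (a b : R) : a <= b -> Rint (cut a b (fun=> 1)) = b - a.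
Proof.
move=> ab; rewrite Rint_cut; last by move=> x; exact: cvg_cst.
rewrite Rintegral_cst// mul1r /= lebesgue_measure_itv/= lte_fin.
case: ltP => // ba; rewrite /= (_ : b = a) ?subrr//.
by apply/eqP; rewrite eq_le ba ab.
Qed.

(** At most one term is nonzero at x, so the bound does not grow with N. The vanishing outside the
    union is what the induction needs when x lies in the last interval. *)
Lemma disjoint_sum (lft : nat -> R) (t : nat -> R -> R) (S : R) (N : nat) (x : R) :
  0 <= S -> (forall k, lft k <= lft k.+1) ->
  (forall k x, ~~ (lft k <= x < lft k.+1) -> t k x = 0) ->
  (forall k, (k < N)%N -> `|t k x| <= S) ->
  `|\sum_(k < N) t k x| <= S /\
  (~~ (lft 0%N <= x < lft N) -> \sum_(k < N) t k x = 0).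
Proof.
move=> S0 lf t0; elim: N => [|N IH] tS; first by rewrite big_ord0 normr0.
have lN j : lft 0%N <= lft j by elim: j => // j /le_trans; apply.
have [IH1 IH2] := IH (fun k kN => tS k (ltnW kN)).
rewrite big_ord_recr /=; have [xN|xN] := ltP x (lft N).
  rewrite [t N x]t0 ?addr0; last by rewrite leNgt xN.
  split => // h; apply: IH2; apply: contra h => /andP[-> _] /=.
  exact: lt_le_trans xN (lf N).
rewrite IH2 ?add0r; last by rewrite negb_and -leNgt xN orbT.
split; first exact: tS.
move=> h; apply: t0; apply: contra h => /andP[_ ->].
by rewrite andbT (le_trans (lN N)).
Qed.

End linear.

Section windows.
Context (R : realType).
Variables (r K N : nat) (m w S : R) (G : nat -> nat -> R -> R).
Hypotheses (w0 : 0 < w) (Kr : (K < r)%N) (S0 : 0 <= S).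
Hypothesis dG : forall k j (x : R), (j < K)%N -> is_derive x 1 (G k j) (G k j.+1 x).
Hypothesis cG : forall k j, (j <= K)%N -> continuous (G k j).

(* Left end and centre of the k-th of N adjacent windows of width 2w from m on. *)
Definition lft (k : nat) : R := m + 2 * k%:R * w.
Definition ctr (k : nat) : R := lft k + w.

Hypothesis bnd : forall k i j x, (k < N)%N -> (i + j <= K)%N ->
  lft k <= x < lft k.+1 -> `|bumpd r i (ctr k) w x * G k j x| <= S.

Lemma lftS k : lft k.+1 = ctr k + w.
Proof. by rewrite /ctr /lft -natr1; ring. Qed.

Lemma lft_le k : lft k <= lft k.+1.
Proof. by rewrite lftS /ctr; have := w0; lra. Qed.

(* In [win i j k], i counts the derivatives falling on the bump and j those
   falling on the amplitude [G k 0]. *)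
Definition win (i j k : nat) : R -> R :=
  cut (lft k) (lft k.+1) (fun x => bumpd r i (ctr k) w x * G k j x).

Definition wsum (i j : nat) (x : R) : R := \sum_(k < N) win i j k x.

Lemma continuous_bumpd i c : continuous (bumpd r i c w).
Proof. by apply: is_derive_continuous => x; exact: is_derive_bumpd. Qed.

Lemma continuous_win i j k : (j <= K)%N ->
  continuous (fun x => bumpd r i (ctr k) w x * G k j x).
Proof. by move=> jK x; apply: cvgM; [exact: continuous_bumpd | exact: cG]. Qed.

Lemma intg_win i j k : (j <= K)%N -> intg (win i j k).
Proof. by move=> jK; apply: intg_cut; exact: continuous_win. Qed.

Lemma intg_wsum i j : (j <= K)%N -> intg (wsum i j).
Proof. by move=> jK; apply: intg_sum => k; exact: intg_win. Qed.

Lemma wsum_bound i j x : (i + j <= K)%N ->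
  `|wsum i j x| <= S /\ (~~ (lft 0%N <= x < lft N) -> wsum i j x = 0).
Proof.
move=> ijK; apply: (disjoint_sum (t := win i j)) => //.
- exact: lft_le.
- by move=> k y; rewrite /win /cut => /negbTE ->.
- move=> k kN; rewrite /win /cut; case: ifP => [h|_]; last by rewrite normr0.
  exact: bnd.
Qed.

Lemma wsum_sqr i j : (i + j <= K)%N ->
  intg (fun x => wsum i j x ^+ 2) /\
  Rint (fun x => wsum i j x ^+ 2) <= S ^+ 2 * (2 * N%:R * w).
Proof.
move=> ijK.
have iw := intg_wsum i (leq_trans (leq_addl i j) ijK).
have i1 := intgZ (S ^+ 2) (intg_cut1 (lft 0) (lft N)).
have le1 x : wsum i j x ^+ 2 <= S ^+ 2 * cut (lft 0) (lft N) (fun=> 1) x.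
  have [h1 h2] := wsum_bound x ijK; rewrite /cut; case: ifPn => [_|/h2 ->].
    by rewrite mulr1 -[leLHS]real_normK ?num_real// lerXn2r ?nnegrE.
  by rewrite expr0n mulr0.
have isq : intg (fun x => wsum i j x ^+ 2).
  apply: (le_intg i1) => [|x]; first by apply: measurable_funX; exact: intg_measurable iw.
  by rewrite ger0_norm ?sqr_ge0.
split => //; apply: le_trans (le_Rint isq i1 le1) _.
rewrite RintZ; last exact: intg_cut1.
rewrite Rint_cut1; last first.
  by rewrite /lft mulr0 mul0r addr0 lerDl mulr_ge0 ?mulr_ge0// ltW.
by rewrite le_eqVlt; apply/orP; left; apply/eqP; rewrite /lft; ring.
Qed.

(** Leibniz' rule on each window. The order of differentiation of the bump is still below r, so the
    window edges contribute nothing. *)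
Lemma wsum_parts i j x : (i + j < K)%N ->
  x * ct (wsum i j) x = - st (fun y => wsum i.+1 j y + wsum i j.+1 y) x /\
  x * st (wsum i j) x = ct (fun y => wsum i.+1 j y + wsum i j.+1 y) x.
Proof.
move=> ijK.
have jK : (j < K)%N by apply: leq_ltn_trans ijK; rewrite leq_addl.
have iK : (i < K)%N by apply: leq_ltn_trans ijK; rewrite leq_addr.
have iw i' j' : (j' <= K)%N -> forall k : 'I_N, intg (win i' j' k).
  by move=> h k; exact: intg_win.
pose u k (y : R) := bumpd r i (ctr k) w y * G k j y.
pose u' k (y : R) := bumpd r i.+1 (ctr k) w y * G k j y + bumpd r i (ctr k) w y * G k j.+1 y.
have du k (y : R) : is_derive y 1 (u k) (u' k y).
  apply: (is_derive_eq (is_deriveM (is_derive_bumpd r i (ctr k) w y) (dG k y jK))).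
  by rewrite /GRing.scale/= /u'; ring.
have cu' k : continuous (u' k).
  by move=> y; apply: cvgD; apply: continuous_win => //; exact: ltnW.
have lr k : lft k < lft k.+1 by rewrite lftS /ctr; have := w0; lra.
have [ea eb] : (forall k, u k (lft k) = 0) /\ (forall k, u k (lft k.+1) = 0).
  have h k := bumpd_edge (ctr k) (lt0r_neq0 w0) (ltn_trans iK Kr).
  split=> k; rewrite /u.
    by have [h1 _] := h k; rewrite (_ : lft k = ctr k - w) ?h1 ?mul0r// /ctr addrK.
  by have [_ h1] := h k; rewrite lftS h1 mul0r.
have P k := cut_parts x (lr k) (du k) (cu' k) (ea k) (eb k).
have i' k : intg (cut (lft k) (lft k.+1) (u' k)) by exact: intg_cut.
have uE y : wsum i.+1 j y + wsum i j.+1 y = \sum_(k < N) cut (lft k) (lft k.+1) (u' k) y.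
  rewrite /wsum -big_split; apply: eq_bigr => k _.
  rewrite /win /cut /=; case: ifP => _; last exact: addr0.
  by [].
rewrite (eq_st x uE) (eq_ct x uE).
have sE : st (fun y => \sum_(k < N) cut (lft k) (lft k.+1) (u' k) y) x =
    \sum_(k < N) st (cut (lft k) (lft k.+1) (u' k)) x by rewrite st_sum.
have cE : ct (fun y => \sum_(k < N) cut (lft k) (lft k.+1) (u' k) y) x =
    \sum_(k < N) ct (cut (lft k) (lft k.+1) (u' k)) x by rewrite ct_sum.
rewrite sE cE; split.
- have -> : ct (wsum i j) x = \sum_(k < N) ct (win i j k) x.
    by rewrite -ct_sum//; exact: iw (ltnW jK).
  rewrite mulr_sumr -sumrN.
  by apply: eq_bigr => k _; have [] := P k.
- have -> : st (wsum i j) x = \sum_(k < N) st (win i j k) x.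
    by rewrite -st_sum//; exact: iw (ltnW jK).
  rewrite mulr_sumr.
  by apply: eq_bigr => k _; have [] := P k.
Qed.

(** One factor 1 + x^2 is traded for one derivative through [wsum_parts]. Leibniz' rule has two
    terms, each entering with factor 2, so a level costs 1 + 2 + 2 = 5; the case l = 0 is Bessel's
    inequality on a support of length 2 N w. *)
Lemma wsum_weighted l i j : (i + j + l <= K)%N ->
  intg (fun x => (1 + x ^+ 2) ^+ l * (ct (wsum i j) x ^+ 2 + st (wsum i j) x ^+ 2)) /\
  Rint (fun x => (1 + x ^+ 2) ^+ l * (ct (wsum i j) x ^+ 2 + st (wsum i j) x ^+ 2)) <=
  5 ^+ l * (2 * pi * (S ^+ 2 * (2 * N%:R * w))).
Proof.
elim: l i j => [|l IH] i j ijl.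
  rewrite addn0 in ijl; have [h1 h2] := wsum_sqr ijl.
  have iw := intg_wsum i (leq_trans (leq_addl i j) ijl).
  have [b1 b2] := bessel iw h1.
  have e x : (1 + x ^+ 2) ^+ 0 * (ct (wsum i j) x ^+ 2 + st (wsum i j) x ^+ 2) =
    ct (wsum i j) x ^+ 2 + st (wsum i j) x ^+ 2 by rewrite expr0 mul1r.
  split; first by apply: eq_intg b1 => x; rewrite e.
  rewrite (eq_Rint e) expr0 mul1r (le_trans b2)// ler_wpM2l// mulr_ge0//.
  exact: pi_ge0.
have lK : (i + j + l < K)%N by rewrite -addnS.
have ijK : (i + j < K)%N by apply: leq_ltn_trans lK; rewrite leq_addr.
have [a1 a2] := IH i j (ltnW lK).
have [b1 b2] := IH i.+1 j lK.
have lK' : (i + j.+1 + l <= K)%N by rewrite addnS.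
have [c1 c2] := IH i j.+1 lK'.
pose W i j x := (1 + x ^+ 2) ^+ l * (ct (wsum i j) x ^+ 2 + st (wsum i j) x ^+ 2).
have iD : intg (fun x => W i j x + 2 * (W i.+1 j x + W i j.+1 x)).
  by apply: intgD => //; apply: intgZ; apply: intgD.
have jK : (j < K)%N by apply: leq_ltn_trans ijK; rewrite leq_addl.
have m1 := intg_measurable (intg_wsum i (ltnW jK)).
have le1 x : (1 + x ^+ 2) ^+ l.+1 * (ct (wsum i j) x ^+ 2 + st (wsum i j) x ^+ 2) <=
    W i j x + 2 * (W i.+1 j x + W i j.+1 x).
  have [p1 p2] := wsum_parts x ijK.
  rewrite /W [X in X * _ <= _](exprSr _ l); set P := (1 + x ^+ 2) ^+ l.
  have P0 : 0 <= P by rewrite exprn_ge0// addr_ge0 ?sqr_ge0.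
  have iw1 := intg_wsum i.+1 (ltnW jK); have iw2 := intg_wsum i jK.
  rewrite (stD x iw1 iw2) in p1; rewrite (ctD x iw1 iw2) in p2.
  set A := ct (wsum i j) x in p1 *; set B := st (wsum i j) x in p2 *.
  set A1 := ct (wsum i.+1 j) x in p2 *; set A2 := ct (wsum i j.+1) x in p2 *.
  set B1 := st (wsum i.+1 j) x in p1 *; set B2 := st (wsum i j.+1) x in p1 *.
  have -> : P * (1 + x ^+ 2) * (A ^+ 2 + B ^+ 2) =
    P * (A ^+ 2 + B ^+ 2 + ((x * A) ^+ 2 + (x * B) ^+ 2)) by ring.
  rewrite p1 p2.
  have -> : P * (A ^+ 2 + B ^+ 2) + 2 * (P * (A1 ^+ 2 + B1 ^+ 2) + P * (A2 ^+ 2 + B2 ^+ 2)) =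
    P * (A ^+ 2 + B ^+ 2 + 2 * (A1 ^+ 2 + B1 ^+ 2 + (A2 ^+ 2 + B2 ^+ 2))) by ring.
  apply: ler_wpM2l => //.
  rewrite lerD2l -subr_ge0.
  rewrite (_ : _ - _ = (A1 - A2) ^+ 2 + (B1 - B2) ^+ 2); last by ring.
  by rewrite addr_ge0 ?sqr_ge0.
have W0 x : 0 <= (1 + x ^+ 2) ^+ l.+1 * (ct (wsum i j) x ^+ 2 + st (wsum i j) x ^+ 2).
  by rewrite mulr_ge0// ?exprn_ge0// addr_ge0 ?sqr_ge0.
have iW : intg (fun x => (1 + x ^+ 2) ^+ l.+1 * (ct (wsum i j) x ^+ 2 + st (wsum i j) x ^+ 2)).
  apply: (le_intg iD) => [|x]; last by rewrite ger0_norm.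
  apply: measurable_funM.
    by apply: measurable_funX; apply: measurable_funD => //; exact: measurable_funX.
  by apply: measurable_funD; apply: measurable_funX; [exact: measurable_ct|exact: measurable_st].
split => //; apply: le_trans (le_Rint iW iD le1) _.
rewrite RintD//; last by apply: intgZ; exact: intgD.
rewrite RintZ; last exact: intgD.
rewrite RintD// exprS -mulrA.
move: a2 b2 c2; set V := 5 ^+ l * _; clearbody V.
set x1 := Rint _; set x2 := Rint _; set x3 := Rint _; move=> a2 b2 c2.
rewrite -/x1 -/x2 -/x3; clearbody x1 x2 x3; lra.
Qed.

End windows.

(** * The kernel of one bump and the perturbation *)

Section kernel.
Context (R : realType).
Variables (r : nat) (w : R).
Hypotheses (r1 : (1 < r)%N) (w0 : 0 < w).
Implicit Types (x y c : R).

Definition bump0 : R -> R := cut (- w) w (bumpd r 0 0 w).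

Lemma bumpd0E c x : bumpd r 0 c w x = (1 - ((x - c) / w) ^+ 2) ^+ r.
Proof. by rewrite /bumpd expr0 invr1 mul1r derivn0 horner_exp !hornerE. Qed.

Lemma norm_divw x : - w <= x < w -> `|x / w| <= 1.
Proof.
move=> /andP[x1 x2]; rewrite ler_norml ler_pdivlMr// ler_pdivrMr// mulN1r mul1r.
by rewrite x1 ltW.
Qed.

Lemma bump0_bound x : 0 <= bump0 x <= 1.
Proof.
rewrite /bump0 /cut; case: ifP => [/norm_divw h|_]; last by rewrite lexx ler01.
rewrite bumpd0E subr0.
have s0 := sqr_ge0 (x / w).
have s1 : (x / w) ^+ 2 <= 1.
  by rewrite -real_normK ?num_real// expr_le1.
rewrite exprn_ge0 ?subr_ge0//= exprn_ile1 ?subr_ge0//.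
by rewrite lerBlDr lerDl.
Qed.

Lemma bump0_ge x : `|x| <= w / 2 -> (1 / 2) ^+ r <= bump0 x.
Proof.
move=> xw.
have : - (w / 2) <= x <= w / 2 by rewrite -ler_norml.
move=> /andP[x1 x2]; rewrite /bump0 /cut ifT; last by apply/andP; split; have := w0; lra.
rewrite bumpd0E subr0 lerXn2r ?nnegrE//.
- have h : `|x / w| <= 1 / 2.
    by rewrite normrM normfV (gtr0_norm w0) ler_pdivrMr//; lra.
  have : (x / w) ^+ 2 <= (1 / 2) ^+ 2 by rewrite -real_normK ?num_real// lerXn2r ?nnegrE.
  lra.
- have h : `|x / w| <= 1 / 2.
    by rewrite normrM normfV (gtr0_norm w0) ler_pdivrMr//; lra.
  have : (x / w) ^+ 2 <= (1 / 2) ^+ 2 by rewrite -real_normK ?num_real// lerXn2r ?nnegrE.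
  lra.
Qed.

Lemma bump0E x : bump0 x = if `|x| <= w then bumpd r 0 0 w x else 0.
Proof.
have [e1 e2] := bumpd_edge 0 (lt0r_neq0 w0) (ltnW r1).
rewrite sub0r in e1; rewrite add0r in e2.
rewrite /bump0 /cut ler_norml; case: (ltgtP x w) => [xw|xw|->].
- by rewrite andbT; case: ifP.
- by rewrite andbF.
- by rewrite andbF andbT e2 if_same.
Qed.

Lemma bump0_even x : bump0 (- x) = bump0 x.
Proof. by rewrite !bump0E normrN !bumpd0E !subr0 mulNr sqrrN. Qed.

Lemma intg_bump0 : intg bump0.
Proof. by apply: intg_cut; exact: continuous_bumpd. Qed.

Lemma poly_lipschitz (p : {poly R}) : exists2 L : R, 0 <= L &
  forall x y, `|x| <= 1 -> `|y| <= 1 -> `|p.[x] - p.[y]| <= L * `|x - y|.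
Proof.
have [L L0 hL] := poly_bounded p^`(); exists L => //.
move=> x y; wlog xy : x y / x <= y.
  move=> H x1 y1; have [xy|yx] := leP x y; first exact: H.
  by rewrite distrC (distrC x); apply: H => //; exact: ltW.
move=> x1 y1.
have [c cxy e] := @MVT_segment R (horner p) (horner p^`()) x y xy
   (fun z _ => is_derive_poly p z) (continuous_subspaceT (@continuous_horner _ p)).
rewrite distrC e (distrC x) normrM ler_wpM2r// hL//.
move: cxy; rewrite in_itv/= => /andP[c1 c2].
move: x1 y1; rewrite !ler_norml => /andP[x1 _] /andP[_ y1].
by rewrite (le_trans x1 c1) (le_trans c2 y1).
Qed.

Definition clamp (x : R) : R := Num.max (-1) (Num.min 1 x).

Lemma clamp_norm x : `|clamp x| <= 1.
Proof.
rewrite /clamp ler_norml le_max lexx /= ge_max ge_min lexx /= andbT.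
by rewrite (le_trans _ (@ler01 R))// oppr_le0.
Qed.

Lemma clamp_lip x y : `|clamp x - clamp y| <= `|x - y|.
Proof.
wlog xy : x y / x <= y.
  move=> H; have [xy|yx] := leP x y; first exact: H.
  by rewrite distrC (distrC x); apply: H => //; exact: ltW.
rewrite (distrC x) (distrC (clamp x)) [leRHS]ger0_norm ?subr_ge0// /clamp ler_norml.
rewrite /Num.max /Num.min; do ![case: ifP]; move=> *; apply/andP; split; lra.
Qed.

(** Since the polynomial vanishes at -1 and 1, cutting off amounts to clamping the argument, and a
    polynomial composed with the clamp is visibly Lipschitz. *)
Lemma bump0_clamp x : bump0 x = (bump R r).[clamp (x / w)].
Proof.
have [e1 e2] := bumpd_edge 0 (lt0r_neq0 w0) (ltnW r1).
rewrite bump0E; have w1 : w != 0 by rewrite gt_eqF.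
case: ifPn.
  rewrite ler_norml => /andP[x1 x2].
  have h1 : x / w <= 1 by rewrite ler_pdivrMr// mul1r.
  have h2 : -1 <= x / w by rewrite ler_pdivlMr// mulN1r.
  by rewrite /clamp (min_idPr h1) (max_idPr h2) bumpd0E subr0 horner_exp !hornerE.
rewrite -ltNge lter_normr => /orP[x1|x1].
  have h1 : 1 < x / w by rewrite ltr_pdivlMr// mul1r.
  rewrite /clamp (min_idPl (ltW h1)) (max_idPr _) ?horner_exp ?hornerE.
    by rewrite ?expr1n ?mulr1 subrr expr0n gtn_eqF// ltnW.
  by rewrite (le_trans _ (@ler01 R))// oppr_le0.
have h1 : x / w < -1 by rewrite ltr_pdivrMr// mulN1r; lra.
rewrite /clamp (min_idPr _); last by lra.
rewrite (max_idPl (ltW h1)) horner_exp !hornerE sqrrN expr1n subrr expr0n gtn_eqF//.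
exact: ltnW.
Qed.

Lemma bump0_lipschitz : exists2 L : R, 0 <= L & forall x y, `|bump0 x - bump0 y| <= L * `|x - y|.
Proof.
have [L L0 h] := poly_lipschitz (bump R r); exists (L * w^-1).
  by rewrite mulr_ge0// invr_ge0 ltW.
move=> x y; rewrite !bump0_clamp (le_trans (h _ _ (clamp_norm _) (clamp_norm _)))//.
rewrite -mulrA ler_wpM2l// (le_trans (clamp_lip _ _))// -mulrBl normrM mulrC.
by rewrite normfV (gtr0_norm w0).
Qed.

Definition kern : R -> R := ct bump0.

(** Two integrations by parts, possible because 1 < r, give decay of order x^-2: the tail of the
    Poisson kernel with parameter 1/w. *)
Lemma kern_bound (M : R) : 1 <= M ->
  (forall i x, (i <= 2)%N -> `|x| <= 1 -> `|((bump R r)^`(i)).[x]| <= M) ->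
  forall x, `|kern x| * (1 + (w * x) ^+ 2) <= 4 * M * w.
Proof.
move=> M1 hM x; have wn : w != 0 by rewrite gt_eqF.
have ww : - w < w by have := w0; lra.
have cb i : continuous (bumpd r i 0 w) by exact: continuous_bumpd.
have P i := @cut_parts R (- w) w (bumpd r i 0 w) (bumpd r i.+1 0 w) x ww
   (is_derive_bumpd r i 0 w) (cb i.+1).
have E i : (i < r)%N -> bumpd r i 0 w (- w) = 0 /\ bumpd r i 0 w w = 0.
  by move=> ir; have := bumpd_edge 0 wn ir; rewrite sub0r add0r.
have [e1 e2] := E 0%N (ltnW r1); have [e3 e4] := E 1%N r1.
have [p1 _] := P 0%N e1 e2; have [_ p2] := P 1%N e3 e4.
have bd i : (i <= 2)%N -> Rint (fun y => `|cut (- w) w (bumpd r i 0 w) y|) <= w ^- i * M * (2 * w).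
  move=> i2; have ii : intg (cut (- w) w (bumpd r i 0 w)) by exact: intg_cut.
  have i1 := intgZ (w ^- i * M) (intg_cut1 (- w) w).
  apply: (@le_trans _ _ (Rint (fun y => w ^- i * M * cut (- w) w (fun=> 1) y))).
    apply: le_Rint => //; first exact: intg_abs.
    move=> y; rewrite /cut; case: ifP => [/norm_divw yw|_]; last by rewrite normr0 mulr0.
    have wi : 0 <= w ^- i by rewrite invr_ge0 exprn_ge0// ltW.
    by rewrite mulr1 /bumpd normrM (ger0_norm wi) ler_wpM2l// subr0 hM.
  rewrite RintZ; last exact: intg_cut1.
  rewrite Rint_cut1 ?(ltW ww)// opprK.
  by rewrite (_ : w + w = 2 * w)//; ring.
have k0 : `|kern x| <= M * (2 * w).
  apply: le_trans (ct_bound x intg_bump0) _.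
  by apply: le_trans (bd 0%N isT) _; rewrite expr0 invr1 mul1r.
have k2 : w ^+ 2 * (x ^+ 2 * `|kern x|) <= M * (2 * w).
  have -> : x ^+ 2 * `|kern x| = `|ct (cut (- w) w (bumpd r 2 0 w)) x|.
    by rewrite -p2 -[RHS]normrN -mulrN -p1 mulrA -expr2 normrM (ger0_norm (sqr_ge0 x)).
  have i2 : intg (cut (- w) w (bumpd r 2 0 w)) by exact: intg_cut.
  apply: (@le_trans _ _ (w ^+ 2 * (w ^- 2 * M * (2 * w)))).
    apply: ler_wpM2l; first by rewrite exprn_ge0// ltW.
    exact: le_trans (ct_bound x i2) (bd 2 isT).
  by rewrite !mulrA mulfV ?expf_neq0// mul1r.
rewrite mulrDr mulr1 exprMn mulrCA (mulrC `|_|).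
lra.
Qed.

End kernel.

Section perturbation.
Context (R : realType).
Variables (r : nat) (w : R).
Hypotheses (r1 : (1 < r)%N) (w0 : 0 < w).
Implicit Types (x y c : R).

Local Notation kern := (kern r w).
Local Notation bump0 := (bump0 r w).
Let ib : intg bump0 := intg_bump0 r w.

Lemma kern_poisson : exists2 C : R, 0 < C & forall x, `|kern x| <= C * poisson w^-1 x.
Proof.
have [M M1 hM] := bump_bounded R r 2.
exists (2 * M); first by lra.
move=> x; have := kern_bound r1 w0 M1 hM x; rewrite -/kern => h.
have wn : w != 0 by rewrite gt_eqF.
have s0 : 0 < 1 + (w * x) ^+ 2 by rewrite ltr_pwDl ?sqr_ge0.
rewrite (_ : 2 * M * poisson w^-1 x = 4 * M * w / (1 + (w * x) ^+ 2)).
  by rewrite ler_pdivlMr.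
rewrite /poisson; field; rewrite wn gt_eqF ?s0//=.
Qed.

Lemma intg_kern : intg kern.
Proof.
have [C C0 h] := kern_poisson; have w1 : 0 < w^-1 by rewrite invr_gt0.
have [ip _] := integral_poisson w1.
apply: (le_intg (intgZ C ip)) => [|x]; last exact: h.
exact: measurable_ct (intg_measurable ib).
Qed.

Lemma kernN x : kern (- x) = kern x.
Proof. exact: ctN. Qed.

Lemma ct_kern y : ct kern y = 2 * pi * bump0 y.
Proof.
have [L L0 hL] := bump0_lipschitz r1 w0.
apply: (fourier_inversion (M := 1) (L := L) y ib) => //.
- by move=> v; exact: bump0_even.
- move=> v; have /andP[h1 h2] := bump0_bound r w0 v; by rewrite ger0_norm.
- exact: intg_kern.
Qed.

Lemma st_kern y : st kern y = 0.
Proof. by apply: st_even; [exact: kernN | exact: intg_kern]. Qed.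

(** Modulation by the cosine moves half of the bump to c and half to -c. The phase enters the mirror
    image with the opposite sine, as it must for a real function. *)
Lemma cos_kernE (y c p : R) :
  ct (fun x => kern x * cos (c * x - p)) y = pi * cos p * (bump0 (y - c) + bump0 (y + c)) /\
  st (fun x => kern x * cos (c * x - p)) y = pi * sin p * (bump0 (y - c) - bump0 (y + c)).
Proof.
have ik := intg_kern.
have ic z : intg (fun x => cos (z * x) * kern x) by exact: intg_cosM.
have is' z : intg (fun x => sin (z * x) * kern x) by exact: intg_sinM.
have C z : Rint (fun x => cos (z * x) * kern x) = 2 * pi * bump0 z by rewrite -ct_kern.
have S z : Rint (fun x => sin (z * x) * kern x) = 0 by rewrite -[RHS](st_kern z).
have lin (k1 k2 k3 k4 : R) : Rint (fun x => k1 * (cos ((y + c) * x) * kern x) +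
    (k2 * (cos ((y - c) * x) * kern x) + (k3 * (sin ((y + c) * x) * kern x) +
     k4 * (sin ((y - c) * x) * kern x)))) =
    k1 * (2 * pi * bump0 (y + c)) + k2 * (2 * pi * bump0 (y - c)).
  rewrite RintD; [|exact: intgZ|by do ![apply: intgD|exact: intgZ]].
  rewrite RintD; [|exact: intgZ|by do ![apply: intgD|exact: intgZ]].
  rewrite RintD; [|exact: intgZ|exact: intgZ].
  by rewrite !RintZ// !C !S !mulr0 !addr0.
have trig x : cos (y * x) * cos (c * x - p) = 2^-1 * (cos ((y + c) * x) * cos p +
    sin ((y + c) * x) * sin p + (cos ((y - c) * x) * cos p - sin ((y - c) * x) * sin p)).
  by rewrite (mulrDl y c x) (mulrBl x y c) !cosB !sinB !cosD !sinD; field.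
have trig' x : sin (y * x) * cos (c * x - p) = 2^-1 * (sin ((y + c) * x) * cos p -
    cos ((y + c) * x) * sin p + (sin ((y - c) * x) * cos p + cos ((y - c) * x) * sin p)).
  by rewrite (mulrDl y c x) (mulrBl x y c) !cosB !sinB !cosD !sinD; field.
split.
- transitivity (Rint (fun x => 2^-1 * cos p * (cos ((y + c) * x) * kern x) +
    (2^-1 * cos p * (cos ((y - c) * x) * kern x) + (2^-1 * sin p * (sin ((y + c) * x) * kern x) +
     - (2^-1 * sin p) * (sin ((y - c) * x) * kern x))))).
    apply: eq_Rint => x; rewrite (mulrC (kern x)) mulrA trig; ring.
  by rewrite lin; field.
- transitivity (Rint (fun x => - (2^-1 * sin p) * (cos ((y + c) * x) * kern x) +
    (2^-1 * sin p * (cos ((y - c) * x) * kern x) + (2^-1 * cos p * (sin ((y + c) * x) * kern x) +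
     2^-1 * cos p * (sin ((y - c) * x) * kern x))))).
    apply: eq_Rint => x; rewrite (mulrC (kern x)) mulrA trig'; ring.
  by rewrite lin; field.
Qed.

Variables (N : nat) (m dl : R) (p : nat -> R).

(* The Fourier transform of the k-th term is pi dl times a bump of phase p k on
   the k-th window, plus its mirror image. *)
Definition pert x : R := \sum_(k < N) dl * (kern x * cos (ctr m w k * x - p k)).

Lemma intg_cos_kern c q : intg (fun x => kern x * cos (c * x - q)).
Proof.
have mc : measurable_fun setT (fun x => cos (c * x - q)).
  apply: (measurableT_comp (continuous_measurable_fun (@continuous_cos R))).
  by apply: measurable_funB => //; exact: measurable_funM.
by apply: eq_intg (intg_bounded intg_kern mc (fun x => cos_max _)) => x; rewrite mulrC.
Qed.

Lemma intg_pert : intg pert.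
Proof. by apply: intg_sum => k; apply: intgZ; exact: intg_cos_kern. Qed.

Lemma ct_pert y : ct pert y = dl * pi *
  \sum_(k < N) (cos (p k) * (bump0 (y - ctr m w k) + bump0 (y + ctr m w k))).
Proof.
rewrite [ct _ _](ct_sum (F := fun k : 'I_N => fun x => dl * (kern x * cos (ctr m w k * x - p k)))); last first.
  by move=> k; apply: intgZ; exact: intg_cos_kern.
rewrite mulr_sumr; apply: eq_bigr => k _; rewrite ctZ; last exact: intg_cos_kern.
by have [-> _] := cos_kernE y (ctr m w k) (p k); ring.
Qed.

Lemma st_pert y : st pert y = dl * pi *
  \sum_(k < N) (sin (p k) * (bump0 (y - ctr m w k) - bump0 (y + ctr m w k))).
Proof.
rewrite [st _ _](st_sum (F := fun k : 'I_N => fun x => dl * (kern x * cos (ctr m w k * x - p k)))); last first.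
  by move=> k; apply: intgZ; exact: intg_cos_kern.
rewrite mulr_sumr; apply: eq_bigr => k _; rewrite stZ; last exact: intg_cos_kern.
by have [_ ->] := cos_kernE y (ctr m w k) (p k); ring.
Qed.

Lemma pert_bound x : `|pert x| <= `|dl| * N%:R * `|kern x|.
Proof.
apply: le_trans (ler_norm_sum _ _ _) _.
rewrite (_ : `|dl| * N%:R * `|kern x| = \sum_(k < N) `|dl| * `|kern x|).
  apply: ler_sum => k _; rewrite !normrM ler_wpM2l// ler_piMr// cos_max//.
by rewrite sumr_const card_ord -[RHS]mulr_natr; ring.
Qed.

(* The pointwise identity that turns the time-domain perturbation into cosine
   and sine transforms of window sums, to which the weighted bound applies. *)
Lemma pertE x : pert x =
  ct (wsum r N m w (fun k j _ => if j is 0%N then dl * cos (p k) else 0) 0 0) x +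
  st (wsum r N m w (fun k j _ => if j is 0%N then dl * sin (p k) else 0) 0 0) x.
Proof.
have cst0 k (f : nat -> R) : continuous (fun y : R => bumpd r 0 (ctr m w k) w y * f k).
  by move=> y; apply: cvgM; [exact: continuous_bumpd|exact: cvg_cst].
have shiftE k y : cut (lft m w k) (lft m w k.+1) (bumpd r 0 (ctr m w k) w) (y + ctr m w k) = bump0 y.
  rewrite /bump0 /cut lftS /ctr -[in LHS]lerBlDr -[in LHS]ltrBrDr.
  rewrite !bumpd0E addrK subr0.
  by congr (if _ then _ else _); congr (_ && _); congr (_ <= _) || congr (_ < _); ring.
have iw k : intg (cut (lft m w k) (lft m w k.+1) (bumpd r 0 (ctr m w k) w)).
  by apply: intg_cut; exact: continuous_bumpd.
have sb : st bump0 x = 0.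
  by apply: st_even => //; move=> z; exact: bump0_even.
have cE k : ct (cut (lft m w k) (lft m w k.+1) (bumpd r 0 (ctr m w k) w)) x = cos (ctr m w k * x) * kern x.
  rewrite /ct (Rint_shift (ctr m w k)); last by apply: intg_measurable; exact: intg_cosM.
  transitivity (Rint (fun y => cos (ctr m w k * x) * (cos (x * y) * bump0 y) -
      sin (ctr m w k * x) * (sin (x * y) * bump0 y))).
    by apply: eq_Rint => y; rewrite shiftE mulrDr cosD (mulrC x (ctr _ _ _)); ring.
  rewrite RintB; [|by apply: intgZ; exact: intg_cosM|by apply: intgZ; exact: intg_sinM].
  rewrite !RintZ; [|exact: intg_sinM|exact: intg_cosM].
  by rewrite -/(st bump0 x) sb mulr0 subr0.
have sE k : st (cut (lft m w k) (lft m w k.+1) (bumpd r 0 (ctr m w k) w)) x = sin (ctr m w k * x) * kern x.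
  rewrite /st (Rint_shift (ctr m w k)); last by apply: intg_measurable; exact: intg_sinM.
  transitivity (Rint (fun y => sin (ctr m w k * x) * (cos (x * y) * bump0 y) +
      cos (ctr m w k * x) * (sin (x * y) * bump0 y))).
    by apply: eq_Rint => y; rewrite shiftE mulrDr sinD (mulrC x (ctr _ _ _)); ring.
  rewrite RintD; [|by apply: intgZ; exact: intg_cosM|by apply: intgZ; exact: intg_sinM].
  rewrite !RintZ; [|exact: intg_sinM|exact: intg_cosM].
  by rewrite -/(st bump0 x) sb mulr0 addr0.
have winE (f : nat -> R) : wsum r N m w (fun k j _ => if j is 0%N then f k else 0) 0 0 =
    (fun y => \sum_(k < N) f k * cut (lft m w k) (lft m w k.+1) (bumpd r 0 (ctr m w k) w) y).
  apply/funext => y; apply: eq_bigr => k _; rewrite /win /cut.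
  by case: ifP => _; rewrite ?mulr0// mulrC.
rewrite !winE.
rewrite [ct _ _](ct_sum (F := fun k : 'I_N => fun y => dl * cos (p k) *
   cut (lft m w k) (lft m w k.+1) (bumpd r 0 (ctr m w k) w) y)); last by move=> k; exact: intgZ.
rewrite [st _ _](st_sum (F := fun k : 'I_N => fun y => dl * sin (p k) *
   cut (lft m w k) (lft m w k.+1) (bumpd r 0 (ctr m w k) w) y)); last by move=> k; exact: intgZ.
rewrite -big_split; apply: eq_bigr => k _ /=.
by rewrite ctZ// stZ// cE sE cosB; ring.
Qed.

End perturbation.

(** * The chi-square distance between two sample laws *)

Section conv.
Context (R : realType).
Implicit Types (g Hc Hs : R -> R) (x y : R).

(** The convolution theorem in real form. With H = Hc + i Hs, the function ct Hc + st Hs is the real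
    part of the integral of exp(-i x v) H(v), and the new amplitudes are the real and imaginary
    parts of H times [fourier g]. *)
Lemma conv_ct_st g Hc Hs y : intg g -> intg Hc -> intg Hs ->
  Rint (fun x => g (y - x) * (ct Hc x + st Hs x)) =
  ct (fun v => Hc v * ct g v - Hs v * st g v) y +
  st (fun v => Hc v * st g v + Hs v * ct g v) y.
Proof.
move=> hg hc hs; have mg := intg_measurable hg.
have mc := measurable_ct (intg_measurable hc); have ms := measurable_st (intg_measurable hs).
have mF : measurable_fun setT (fun x => g (y - x) * (ct Hc x + st Hs x)).
  apply: measurable_funM; last exact: measurable_funD.
  by apply: measurableT_comp => //; exact: measurable_funB.
rewrite (Rint_shift y mF) Rint_opp; last first.
  apply: (measurableT_comp mF (g := fun x => x + y)); exact: measurable_funD.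
have mk1 : measurable_fun setT (fun z : R * R => cos ((y - z.1) * z.2)).
  apply: (measurableT_comp (continuous_measurable_fun (@continuous_cos R))).
  by apply: measurable_funM => //; exact: measurable_funB.
have mk2 : measurable_fun setT (fun z : R * R => sin ((y - z.1) * z.2)).
  apply: (measurableT_comp (continuous_measurable_fun (@continuous_sin R))).
  by apply: measurable_funM => //; exact: measurable_funB.
have bc v := ct_bound v hg; have bs v := st_bound v hg.
have mgc := measurable_ct mg; have mgs := measurable_st mg.
have P1 f : intg f -> intg (fun v => f v * ct g v).
  by move=> hf; apply: eq_intg (intg_bounded hf mgc bc) => v; rewrite mulrC.
have P2 f : intg f -> intg (fun v => f v * st g v).
  by move=> hf; apply: eq_intg (intg_bounded hf mgs bs) => v; rewrite mulrC.
have i1 : intg (fun t => g t * ct Hc (y - t)).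
  have mc' : measurable_fun setT (fun t : R => ct Hc (y - t)).
    by apply: measurableT_comp => //; exact: measurable_funB.
  by apply: eq_intg (intg_bounded hg mc' (fun t => ct_bound _ hc)) => t; rewrite mulrC.
have i2 : intg (fun t => g t * st Hs (y - t)).
  have ms' : measurable_fun setT (fun t : R => st Hs (y - t)).
    by apply: measurableT_comp => //; exact: measurable_funB.
  by apply: eq_intg (intg_bounded hg ms' (fun t => st_bound _ hs)) => t; rewrite mulrC.
transitivity (Rint (fun t => g t * ct Hc (y - t)) + Rint (fun t => g t * st Hs (y - t))).
  rewrite -(RintD i1 i2); apply: eq_Rint => t.
  rewrite (_ : y - (- t + y) = t); last by ring.
  by rewrite (_ : - t + y = y - t) ?mulrDr//; ring.
rewrite (fubini_Rint hg hc mk1 (fun z => cos_max _)) (fubini_Rint hg hs mk2 (fun z => sin_max _)).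
transitivity (Rint (fun v => cos (y * v) * (Hc v * ct g v)) + Rint (fun v => sin (y * v) * (Hc v * st g v)) +
  (Rint (fun v => sin (y * v) * (Hs v * ct g v)) - Rint (fun v => cos (y * v) * (Hs v * st g v)))).
  have icg v : intg (fun t => cos (v * t) * g t) by exact: intg_cosM.
  have isg v : intg (fun t => sin (v * t) * g t) by exact: intg_sinM.
  congr (_ + _).
  - rewrite -RintD; [|exact/intg_cosM/P1|exact/intg_sinM/P2].
    apply: eq_Rint => v.
    have -> : Rint (fun t => cos ((y - (t, v).1) * (t, v).2) * g t) =
       cos (y * v) * ct g v + sin (y * v) * st g v.
      rewrite -!RintZ// -RintD; [|exact: intgZ|exact: intgZ].
      by apply: eq_Rint => t /=; rewrite mulrBl cosB (mulrC t v); ring.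
    ring.
  - rewrite -RintB; [|exact/intg_sinM/P1|exact/intg_cosM/P2].
    apply: eq_Rint => v.
    have -> : Rint (fun t => sin ((y - (t, v).1) * (t, v).2) * g t) =
       sin (y * v) * ct g v - cos (y * v) * st g v.
      rewrite -!RintZ// -RintB; [|exact: intgZ|exact: intgZ].
      by apply: eq_Rint => t /=; rewrite mulrBl sinB (mulrC t v); ring.
    ring.
rewrite /ct /st -!/(ct g _).
have -> : Rint (fun v => cos (y * v) * (Hc v * ct g v - Hs v * st g v)) =
  Rint (fun v => cos (y * v) * (Hc v * ct g v)) - Rint (fun v => cos (y * v) * (Hs v * st g v)).
  rewrite -RintB; [|exact/intg_cosM/P1|exact/intg_cosM/P2].
  by apply: eq_Rint => v; rewrite mulrBr.
have -> : Rint (fun v => sin (y * v) * (Hc v * st g v + Hs v * ct g v)) =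
  Rint (fun v => sin (y * v) * (Hc v * st g v)) + Rint (fun v => sin (y * v) * (Hs v * ct g v)).
  rewrite -RintD; [|exact/intg_sinM/P2|exact/intg_sinM/P1].
  by apply: eq_Rint => v; rewrite mulrDr.
set z1 := Rint _; set z2 := Rint _; set z3 := Rint _; set z4 := Rint _.
clearbody z1 z2 z3 z4; ring.
Qed.

End conv.

Section weighted.
Context (R : realType).
Variables (r K N : nat) (m w S : R) (A B : nat -> nat -> R -> R).
Hypotheses (w0 : 0 < w) (Kr : (K < r)%N) (S0 : 0 <= S).
Hypothesis dA : forall k j (x : R), (j < K)%N -> is_derive x 1 (A k j) (A k j.+1 x).
Hypothesis dB : forall k j (x : R), (j < K)%N -> is_derive x 1 (B k j) (B k j.+1 x).
Hypothesis cA : forall k j, (j <= K)%N -> continuous (A k j).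
Hypothesis cB : forall k j, (j <= K)%N -> continuous (B k j).
Hypothesis bA : forall k i j x, (k < N)%N -> (i + j <= K)%N ->
  lft m w k <= x < lft m w k.+1 -> `|bumpd r i (ctr m w k) w x * A k j x| <= S.
Hypothesis bB : forall k i j x, (k < N)%N -> (i + j <= K)%N ->
  lft m w k <= x < lft m w k.+1 -> `|bumpd r i (ctr m w k) w x * B k j x| <= S.

Lemma wsum2_weighted (f : R -> R) : measurable_fun setT f ->
  (forall x, f x = ct (wsum r N m w A 0 0) x + st (wsum r N m w B 0 0) x) ->
  intg (fun x => (1 + x ^+ 2) ^+ K * f x ^+ 2) /\
  Rint (fun x => (1 + x ^+ 2) ^+ K * f x ^+ 2) <= 4 * (5 ^+ K * (2 * pi * (S ^+ 2 * (2 * N%:R * w)))).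
Proof.
move=> mf fE.
have K0 : (0 + 0 + K <= K)%N by [].
have [a1 a2] := wsum_weighted w0 Kr S0 dA cA bA K0.
have [b1 b2] := wsum_weighted w0 Kr S0 dB cB bB K0.
have iab := intgZ 2 (intgD a1 b1).
have le1 x : (1 + x ^+ 2) ^+ K * f x ^+ 2 <=
    2 * ((1 + x ^+ 2) ^+ K * (ct (wsum r N m w A 0 0) x ^+ 2 + st (wsum r N m w A 0 0) x ^+ 2) +
         (1 + x ^+ 2) ^+ K * (ct (wsum r N m w B 0 0) x ^+ 2 + st (wsum r N m w B 0 0) x ^+ 2)).
  rewrite fE; set a := ct _ x; set b := st _ x; set c := st _ x; set d := ct _ x.
  set P := (1 + x ^+ 2) ^+ K.
  have P0 : 0 <= P by rewrite exprn_ge0// addr_ge0 ?sqr_ge0.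
  rewrite (_ : 2 * _ = P * (2 * (a ^+ 2 + c ^+ 2 + (d ^+ 2 + b ^+ 2)))); last by ring.
  apply: ler_wpM2l => //.
  rewrite -subr_ge0 (_ : _ - _ = (a - b) ^+ 2 + 2 * (c ^+ 2 + d ^+ 2)); last by ring.
  apply: addr_ge0; first exact: sqr_ge0.
  by apply: mulr_ge0 => //; apply: addr_ge0; exact: sqr_ge0.
have f0 x : 0 <= (1 + x ^+ 2) ^+ K * f x ^+ 2.
  by rewrite mulr_ge0 ?sqr_ge0// exprn_ge0// addr_ge0 ?sqr_ge0.
have iF : intg (fun x => (1 + x ^+ 2) ^+ K * f x ^+ 2).
  apply: (le_intg iab) => [|x]; last by rewrite ger0_norm.
  apply: measurable_funM; last exact: measurable_funX.
  by apply: measurable_funX; apply: measurable_funD => //; exact: measurable_funX.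
split => //; apply: le_trans (le_Rint iF iab le1) _.
rewrite RintZ; last exact: intgD.
rewrite RintD//; apply: (@le_trans _ _ (2 * (_ + _))); first exact: ler_wpM2l (lerD a2 b2).
by rewrite le_eqVlt; apply/orP; left; apply/eqP; ring.
Qed.

End weighted.

Section chi2.
Context (R : realType).
Notation leb := (@lebesgue_measure R).

Lemma intg_pdf (f : pdf R) : intg f /\ Rint f = 1.
Proof.
have mf : measurable_fun setT f by exact: measurable_pdf.
have i := intg_le_fin (M := 1) mf (@pdf_ge0 _ f) _.
split; first by apply: i; rewrite integral_pdf.
by rewrite /Rint /Rintegral integral_pdf.
Qed.

(** The atoms cancel in the difference, which is 2 p times the convolution of h with g. Since p <=
    1/2, the two atom parts in the denominator add up to at least g, hence to at least c1 (1 +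
    y^2)^-K; this is the origin of the polynomial weight. *)
Lemma chi2_bound (g f1 f2 : pdf R) (p : {i01 R}) (h : R -> R) (K : nat) (c1 V : R) :
  (exists M, forall x, g x <= M) ->
  0 < c1 -> (forall x, c1 <= g x * (1 + x ^+ 2) ^+ K) -> p%:num <= 1 / 2 ->
  intg h -> (forall x, f1 x - f2 x = 2 * h x) ->
  intg (fun y => (1 + y ^+ 2) ^+ K * conv_pdf h g y ^+ 2) ->
  Rint (fun y => (1 + y ^+ 2) ^+ K * conv_pdf h g y ^+ 2) <= V ->
  (\int[leb]_y ((obs_pdf g p f1 y - obs_pdf g p f2 y) ^+ 2 /
      (obs_pdf g p f1 y + obs_pdf g p f2 y))%:E <= (4 * p%:num ^+ 2 / c1 * V)%:E)%E.
Proof.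
move=> [M gM] c0 hg p2 ih fh iV hV.
have w0 y : 0 < (1 + y ^+ 2) ^+ K :> R by rewrite exprn_gt0// ltr_pwDl ?sqr_ge0.
have g0 y : 0 < g y.
  by have := lt_le_trans c0 (hg y); rewrite pmulr_lgt0.
have [if1 _] := intg_pdf f1; have [if2 _] := intg_pdf f2.
have gb y : `|g y| <= M by rewrite ger0_norm// ltW.
have mg (y : R) : measurable_fun setT (fun x : R => g (y - x)).
  by apply: (measurableT_comp (measurable_pdf g)); exact: measurable_funB.
have ic f (y : R) : intg f -> intg (fun x => g (y - x) * f x).
  by move=> hf; exact: (intg_bounded hf (mg y) (fun x => gb _)).
have pE y : obs_pdf g p f1 y - obs_pdf g p f2 y = p%:num * (2 * conv_pdf h g y).
  rewrite /obs_pdf opprD addrACA subrr addr0 -mulrBr; congr (_ * _).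
  rewrite /conv_pdf -!/(Rint _) -RintB ?ic// -RintZ ?ic//.
  by apply: eq_Rint => x; rewrite -mulrBr fh; ring.
have p0 : 0 <= p%:num by [].
have iZ := intgZ (4 * p%:num ^+ 2 / c1) iV.
apply: (@le_trans _ _ (Rint (fun y => 4 * p%:num ^+ 2 / c1 * ((1 + y ^+ 2) ^+ K * conv_pdf h g y ^+ 2)))%:E); last first.
  rewrite lee_fin RintZ// ler_wpM2l// divr_ge0 ?(ltW c0)// mulr_ge0// sqr_ge0.
rewrite EFin_Rint//.
have m1 := measurable_obs_pdf g p f1; have m2 := measurable_obs_pdf g p f2.
have p1 : p%:num < 1 by apply: le_lt_trans p2 _; lra.
have q1 := obs_pdf_gt0 g0 p1 f1; have q2 := obs_pdf_gt0 g0 p1 f2.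
have q0 y : 0 < obs_pdf g p f1 y + obs_pdf g p f2 y by rewrite addr_gt0.
apply: ge0_le_integral_leb.
- by move=> y; rewrite lee_fin divr_ge0 ?sqr_ge0// ltW.
- apply/measurable_EFinP; apply: measurable_funM.
    by apply: measurable_funX; exact: measurable_funB.
  by apply: measurable_funV_gt0 => //; exact: measurable_funD.
- by apply/measurable_EFinP; exact: intg_measurable iZ.
move=> y; rewrite lee_fin ler_pdivrMr// pE.
have gs : g y <= obs_pdf g p f1 y + obs_pdf g p f2 y.
  have h1 := obs_pdf_ge g p f1 y; have h2 := obs_pdf_ge g p f2 y.
  apply: le_trans (lerD h1 h2); rewrite -mulrDl ler_peMl//; first exact: ltW.
  lra.
set s := _ + _ in gs *; set W := (1 + y ^+ 2) ^+ K; set cv := conv_pdf h g y.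
have h1 : 1 <= (g y * W) / c1 by rewrite ler_pdivlMr// mul1r; exact: hg.
have h2 : 1 <= s * W / c1.
  apply: le_trans h1 _; rewrite ler_wpM2r ?invr_ge0 ?(ltW c0)// ler_wpM2r//.
  by rewrite ltW// w0.
rewrite (_ : 4 * p%:num ^+ 2 / c1 * (W * cv ^+ 2) * s = (p%:num * (2 * cv)) ^+ 2 * (s * W / c1)).
  by rewrite ler_peMr// sqr_ge0.
by field; rewrite gt_eqF.
Qed.

End chi2.

(** * Construction of the competing densities *)

Section cauchy.
Context (R : realType).
Notation leb := (@lebesgue_measure R).
Implicit Types (e x y z v w s t : R).

Lemma expR_lip e x y : 0 < e ->
  `|expR (- (e * `|x|)) - expR (- (e * `|y|))| <= e * `|x - y|.
Proof.
move=> e0.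
have key (a b : R) : 0 <= a -> a <= b -> `|expR (- (e * a)) - expR (- (e * b))| <= e * (b - a).
  move=> a0 ab; have [c cab H] := @MVT_segment R (fun z => expR (- e * z)) (fun z => - e * expR (- e * z)) a b ab
     (fun z _ => is_derive_expRM (- e) z) (continuous_subspaceT (is_derive_continuous (is_derive_expRM (- e)))).
  move: cab; rewrite in_itv/= => /andP[ac _].
  rewrite distrC -!mulNr H normrM [X in _ * X]ger0_norm ?subr_ge0// ler_wpM2r ?subr_ge0//.
  rewrite normrM normrN (gtr0_norm e0) ler_piMr ?(ltW e0)//.
  rewrite ger0_norm ?expR_ge0// -[leRHS]expR0 ler_expR mulNr oppr_le0 mulr_ge0 ?(ltW e0)//.
  exact: le_trans a0 ac.
have [xy|yx] := leP `|x| `|y|.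
  apply: le_trans (key _ _ (normr_ge0 x) xy) _; rewrite ler_wpM2l ?(ltW e0)//.
  by rewrite distrC; exact: lerB_dist.
rewrite distrC; apply: le_trans (key _ _ (normr_ge0 y) (ltW yx)) _; rewrite ler_wpM2l ?(ltW e0)//.
exact: lerB_dist.
Qed.

Lemma ct_poisson e y : 0 < e -> ct (poisson e) y = 2 * pi * expR (- (e * `|y|)).
Proof.
move=> e0.
have E : poisson e = ct (fun x => expR (- (e * `|x|))) by apply/funext => z; rewrite ct_expabs.
rewrite E; apply: (fourier_inversion (M := 1) (L := e)).
- exact: intg_expabs.
- by move=> v; rewrite normrN.
- exact: ltW.
- move=> v; rewrite ger0_norm ?expR_ge0// -[leRHS]expR0 ler_expR oppr_le0.
  by rewrite mulr_ge0// ltW.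
- by move=> x z; exact: expR_lip.
- by rewrite -E; have [] := integral_poisson e0.
Qed.

Lemma st_poisson e y : 0 < e -> st (poisson e) y = 0.
Proof.
move=> e0; apply: st_even; first by move=> x; rewrite poissonN.
by have [] := integral_poisson e0.
Qed.

Lemma exprn_le_expR (k : nat) x : 0 <= x -> (1 + x) ^+ k.+1 <= k.+1%:R ^+ k.+1 * expR x.
Proof.
move=> x0; set n : R := k.+1%:R; have n0 : 0 < n by rewrite /n.
have n1 : 1 <= n by rewrite /n ler1n.
have -> : expR x = expR (x / n) ^+ k.+1.
  by rewrite -expRM_natl -/n mulrC divfK// gt_eqF.
have h : 1 + x / n <= expR (x / n) by exact: expR_ge1Dx.
rewrite -exprMn; apply: lerXn2r; rewrite ?nnegrE ?addr_ge0 ?mulr_ge0 ?expR_ge0 ?(ltW n0)//.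
apply: le_trans (ler_wpM2l (ltW n0) h).
by rewrite mulrDr mulr1 mulrC divfK ?gt_eqF// lerD2r.
Qed.

Lemma powR_weight_exp s : 0 <= s -> exists2 C : R, 0 < C &
  forall y, (y ^+ 2 + 1) `^ s <= C * expR `|y|.
Proof.
move=> s0; pose k := Num.truncn s.
have sk : s <= k.+1%:R by have /andP[_ /ltW] := Num.Theory.truncn_itv s0.
pose n := (k.+1 * 2).-1.
exists (n.+1%:R ^+ n.+1); first by rewrite exprn_gt0.
move=> y; have y1 : 1 <= y ^+ 2 + 1 by rewrite lerDr sqr_ge0.
apply: le_trans (ler_powR y1 sk) _; rewrite powR_mulrn ?addr_ge0 ?sqr_ge0//.
apply: le_trans (exprn_le_expR n (normr_ge0 y)).
have -> : n.+1 = (2 * k.+1)%N by rewrite /n mulnC.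
rewrite exprM; apply: lerXn2r; rewrite ?nnegrE ?addr_ge0 ?sqr_ge0//.
rewrite -[X in X + 1 <= _]real_normK ?num_real//.
by rewrite sqrrD expr1n addrC lerD2r lerDl mulrn_wge0// mulr_ge0.
Qed.

Lemma Rint_expabs e : 0 < e -> Rint (fun x => expR (- (e * `|x|))) = 2 / e.
Proof.
move=> e0; transitivity (poisson e 0); last first.
  by rewrite /poisson expr0n addr0; field; rewrite gt_eqF.
rewrite -ct_expabs//; apply: eq_Rint => x.
by rewrite mul0r cos0 mul1r.
Qed.

Lemma measurable_weight s : measurable_fun setT (fun y : R => (y ^+ 2 + 1) `^ s).
Proof.
apply: (measurableT_comp (measurable_powR s)).
by apply: measurable_funD => //; exact: measurable_funX.
Qed.

(** The exponential is the Fourier transform of the Cauchy density of scale 1/w and lives on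
    frequencies of order w. A flat enough base thus takes up an arbitrarily small part of the
    Sobolev bound. *)
Lemma cauchy_weight s : 0 <= s -> exists2 C : R, 0 < C & forall w, 0 < w -> w <= 1 ->
  intg (fun y => expR (- (w^-1 * `|y|)) ^+ 2 * (y ^+ 2 + 1) `^ s) /\
  Rint (fun y => expR (- (w^-1 * `|y|)) ^+ 2 * (y ^+ 2 + 1) `^ s) <= C * w.
Proof.
move=> s0; have [C C0 hC] := powR_weight_exp s0; exists (C * 2); first by rewrite mulr_gt0.
move=> w w0 w1; have iw0 : 0 < w^-1 by rewrite invr_gt0.
have iw1 : 1 <= w^-1 by rewrite invf_ge1.
have ie := intgZ C (intg_expabs iw0).
have le1 y : expR (- (w^-1 * `|y|)) ^+ 2 * (y ^+ 2 + 1) `^ s <= C * expR (- (w^-1 * `|y|)).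
  apply: le_trans (ler_wpM2l (sqr_ge0 _) (hC y)) _.
  rewrite mulrCA ler_wpM2l ?(ltW C0)// expr2 -mulrA ler_piMr ?expR_ge0// -expRD.
  rewrite -[leRHS]expR0 ler_expR addrC subr_le0 ler_peMl//.
have p0 y : 0 <= expR (- (w^-1 * `|y|)) ^+ 2 * (y ^+ 2 + 1) `^ s.
  by rewrite mulr_ge0 ?sqr_ge0// powR_ge0.
have iI : intg (fun y => expR (- (w^-1 * `|y|)) ^+ 2 * (y ^+ 2 + 1) `^ s).
  apply: (le_intg ie) => [|y]; last by rewrite ger0_norm.
  apply: measurable_funM; last exact: measurable_weight.
  by apply: measurable_funX; exact: intg_measurable (intg_expabs iw0).
split => //; apply: le_trans (le_Rint iI ie le1) _.
rewrite RintZ; last exact: intg_expabs.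
by rewrite Rint_expabs// invrK mulrA.
Qed.

End cauchy.

(** * Sobolev norm of the perturbation *)

Section pert_sobolev.
Context (R : realType).
Variables (r N : nat) (w m dl s : R) (p : nat -> R).
Hypotheses (r1 : (1 < r)%N) (w0 : 0 < w) (m1 : 1 <= m) (dl0 : 0 <= dl) (s0 : 0 <= s).
Hypothesis mN : 2 * N%:R * w <= m.
Implicit Types (x y : R).

Let h := pert r w N m dl p.
(** The indicator function of the union of the windows. *)
Let W := cut (lft m w 0) (lft m w N) (fun=> 1).

Lemma bump0_shift k y : bump0 r w (y - ctr m w k) =
  cut (lft m w k) (lft m w k.+1) (fun z => bump0 r w (z - ctr m w k)) y.
Proof.
rewrite [RHS]/cut; case: ifPn => // hn; rewrite /bump0 /cut ifN//; apply: contra hn.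
rewrite lftS /ctr => /andP[h1 h2]; apply/andP; split; lra.
Qed.

Lemma bump_sum_bound (f : nat -> R) y : (forall k, `|f k| <= 1) ->
  `|\sum_(k < N) f k * bump0 r w (y - ctr m w k)| <= W y.
Proof.
move=> f1; pose t k y := f k * bump0 r w (y - ctr m w k).
have t1 k z : `|t k z| <= 1.
  have /andP[b0 b1] := bump0_bound r w0 (z - ctr m w k).
  by rewrite /t normrM (ger0_norm b0) -[leRHS]mulr1 ler_pM.
have t0 k z : ~~ (lft m w k <= z < lft m w k.+1) -> t k z = 0.
  by move=> /negbTE hz; rewrite /t bump0_shift /cut hz mulr0.
have [h1 h2] := @disjoint_sum R (lft m w) t 1 N y ler01 (lft_le m w0) t0 (fun k _ => t1 k y).
rewrite /W /cut; case: ifPn => [_|/h2]; first exact: h1.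
by rewrite /t => ->; rewrite normr0.
Qed.

Lemma bump0_add k y : bump0 r w (y + ctr m w k) = bump0 r w (- y - ctr m w k).
Proof. by rewrite -bump0_even// opprD. Qed.

Lemma W01 y : W y = 0 \/ W y = 1.
Proof. by rewrite /W /cut; case: ifP; [right|left]. Qed.

Lemma ct_st_pert_bound y : ct h y ^+ 2 + st h y ^+ 2 <= 4 * (dl * pi) ^+ 2 * (W y + W (- y)).
Proof.
have dp0 : 0 <= dl * pi by rewrite mulr_ge0// pi_ge0.
have A (f : nat -> R) : (forall k, `|f k| <= 1) -> `|\sum_(k < N) f k * bump0 r w (y + ctr m w k)| <= W (- y).
  by move=> f1; under eq_bigr do rewrite bump0_add; exact: bump_sum_bound.
have W0 z : 0 <= W z by case: (W01 z) => ->.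
have sq (a : R) : `|a| <= W y + W (- y) -> (dl * pi * a) ^+ 2 <= 2 * (dl * pi) ^+ 2 * (W y + W (- y)).
  move=> ha; rewrite exprMn.
  rewrite (_ : 2 * (dl * pi) ^+ 2 * (W y + W (- y)) = (dl * pi) ^+ 2 * (2 * (W y + W (- y)))); last by ring.
  apply: ler_wpM2l; first exact: sqr_ge0.
  apply: (@le_trans _ _ ((W y + W (- y)) ^+ 2)).
    by rewrite -[leLHS]real_normK ?num_real// lerXn2r ?nnegrE ?addr_ge0.
  by case: (W01 y) => ->; case: (W01 (- y)) => ->; lra.
have -> : 4 * (dl * pi) ^+ 2 * (W y + W (- y)) = 2 * (dl * pi) ^+ 2 * (W y + W (- y)) + 2 * (dl * pi) ^+ 2 * (W y + W (- y)) by ring.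
apply: lerD.
- rewrite /h ct_pert//; apply: sq; under eq_bigr do rewrite mulrDr.
  rewrite big_split /=; apply: le_trans (ler_normD _ _) _; apply: lerD.
    exact: (bump_sum_bound (f := fun k => cos (p k)) y (fun k => cos_max _)).
  exact: (A (fun k => cos (p k)) (fun k => cos_max _)).
- rewrite /h st_pert//; apply: sq; under eq_bigr do rewrite mulrBr.
  rewrite big_split /= sumrN; apply: le_trans (ler_normB _ _) _; apply: lerD.
    exact: (bump_sum_bound (f := fun k => sin (p k)) y (fun k => sin_max _)).
  exact: (A (fun k => sin (p k)) (fun k => sin_max _)).
Qed.

Lemma lft_range : lft m w 0 = m /\ lft m w N <= 2 * m.
Proof.
by rewrite /lft mulr0 mul0r addr0; split => //; have := mN; rewrite -/(2 * N%:R * w); lra.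
Qed.

Lemma W_range y : W y != 0 -> m <= y <= 2 * m.
Proof.
have [e1 e2] := lft_range; rewrite /W /cut e1; case: ifP => [/andP[-> h2] _|]; last by rewrite eqxx.
by rewrite (le_trans (ltW h2)).
Qed.

Lemma intg_W : intg W. Proof. exact: intg_cut1. Qed.

Lemma Rint_W : Rint W = 2 * N%:R * w.
Proof.
rewrite Rint_cut1; last by rewrite /lft mulr0 mul0r addr0 lerDl mulr_ge0 ?mulr_ge0// ltW.
by rewrite /lft; ring.
Qed.

Lemma weight_le y : `|y| <= 2 * m -> (y ^+ 2 + 1) `^ s <= 5 `^ s * m `^ (2 * s).
Proof.
move=> ym; have m0 : 0 <= m by apply: le_trans m1.
have y2 : y ^+ 2 <= 4 * m ^+ 2.
  rewrite -[leLHS]real_normK ?num_real// (_ : 4 * m ^+ 2 = (2 * m) ^+ 2); last by ring.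
  by rewrite lerXn2r ?nnegrE ?mulr_ge0.
have m2 : 1 <= m ^+ 2 by rewrite exprn_ege1.
apply: (@le_trans _ _ ((5 * m ^+ 2) `^ s)).
  by apply: ge0_ler_powR; rewrite ?nnegrE ?addr_ge0 ?sqr_ge0 ?mulr_ge0//; lra.
by rewrite powRM ?sqr_ge0// -powR_mulrn// -powRrM.
Qed.

(** The hypothesis [mN] keeps the windows inside [m, 2 m], where the weight is of order m^(2 s);
    together with their mirror images they have length 4 N w. *)
Lemma pert_sobolev :
  intg (fun y => (ct h y ^+ 2 + st h y ^+ 2) * (y ^+ 2 + 1) `^ s) /\
  Rint (fun y => (ct h y ^+ 2 + st h y ^+ 2) * (y ^+ 2 + 1) `^ s) <=
    16 * pi ^+ 2 * 5 `^ s * (dl ^+ 2 * (N%:R * w) * m `^ (2 * s)).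
Proof.
have iW := intg_W; have iW' := intg_opp iW.
have ih : intg h by exact: intg_pert.
pose c := 4 * (dl * pi) ^+ 2 * (5 `^ s * m `^ (2 * s)).
have iR := intgZ c (intgD iW iW').
have W0 z : 0 <= W z by case: (W01 z) => ->.
have le1 y : (ct h y ^+ 2 + st h y ^+ 2) * (y ^+ 2 + 1) `^ s <= c * (W y + W (- y)).
  have h1 := ct_st_pert_bound y.
  have c0 : 0 <= 4 * (dl * pi) ^+ 2 by rewrite mulr_ge0 ?sqr_ge0.
  apply: le_trans (ler_wpM2r (powR_ge0 _ _) h1) _.
  rewrite /c; set c' := 4 * _ in c0 *; rewrite -(mulrA c') -(mulrA c').
  apply: ler_wpM2l => //.
  have [e|ne] := eqVneq (W y + W (- y)) 0; first by rewrite e mul0r mulr0.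
  rewrite mulrC; apply: ler_wpM2r; first exact: addr_ge0.
  apply: weight_le.
  have [e|/W_range/andP[q1 q2]] := eqVneq (W y) 0.
    move: ne; rewrite e add0r => /W_range/andP[q1 q2].
    by rewrite -normrN ger0_norm// (le_trans _ q1)// (le_trans _ m1).
  by rewrite ger0_norm// (le_trans _ q1)// (le_trans _ m1).
have p0 y : 0 <= (ct h y ^+ 2 + st h y ^+ 2) * (y ^+ 2 + 1) `^ s.
  by rewrite mulr_ge0 ?powR_ge0// addr_ge0 ?sqr_ge0.
have iI : intg (fun y => (ct h y ^+ 2 + st h y ^+ 2) * (y ^+ 2 + 1) `^ s).
  apply: (le_intg iR) => [|y]; last by rewrite ger0_norm.
  apply: measurable_funM; last exact: measurable_weight.
  have mh := intg_measurable ih.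
  by apply: measurable_funD; apply: measurable_funX; [exact: measurable_ct|exact: measurable_st].
split => //; apply: le_trans (le_Rint iI iR le1) _.
rewrite RintZ; last exact: intgD.
rewrite RintD// -(Rint_opp (intg_measurable iW)) Rint_W /c exprMn.
by rewrite le_eqVlt; apply/orP; left; apply/eqP; ring.
Qed.

End pert_sobolev.

Section trig.
Context (R : realType).
Implicit Types (x y z : R).

Lemma lip1_MVT (f f' : R -> R) : (forall x : R, is_derive x 1 f (f' x)) ->
  (forall x, `|f' x| <= 1) -> forall x y, `|f x - f y| <= `|x - y|.
Proof.
move=> df f1 x y; wlog xy : x y / x <= y.
  move=> H; have [xy|yx] := leP x y; first exact: H.
  by rewrite distrC (distrC x); apply: H; exact: ltW.
have [c _ e] := @MVT_segment R f f' x y xy (fun z _ => df z)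
  (continuous_subspaceT (is_derive_continuous df)).
by rewrite distrC e (distrC x) normrM ler_piMl.
Qed.

Lemma cos_lip x y : `|cos x - cos y| <= `|x - y|.
Proof.
apply: (@lip1_MVT (@cos R) (fun z => - sin z)) => z.
by rewrite normrN sin_max.
Qed.

Lemma sin_lip x y : `|sin x - sin y| <= `|x - y|.
Proof. by apply: (@lip1_MVT (@sin R) (@cos R)) => z; exact: cos_max. Qed.

Lemma sin_lower x : `|x| <= 1 / 2 -> `|x| / 2 <= `|sin x|.
Proof.
wlog x0 : x / 0 <= x.
  move=> H; have [x0|x0] := leP 0 x; first exact: H.
  by have := H (- x); rewrite normrN sinN normrN; apply; rewrite oppr_ge0 ltW.
rewrite (ger0_norm x0) => x1.
have [c cx e] := @MVT_segment R (@sin R) (@cos R) 0 x x0 (fun z _ => is_derive_sin z)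
  (continuous_subspaceT (@continuous_sin R)).
move: cx; rewrite in_itv/= => /andP[c0 cx].
rewrite sin0 !subr0 in e; rewrite e normrM (ger0_norm x0) mulrC ler_wpM2r//.
have := cos_lip 0 c; rewrite cos0 sub0r normrN (ger0_norm c0) => h.
have := le_trans (ler_norm _) h; have := ler_norm (cos c); lra.
Qed.

Lemma one_sub_cos_lower z : `|z| <= 1 -> z ^+ 2 / 4 <= 2 - 2 * cos z.
Proof.
move=> z1; have zE : z = (z / 2) *+ 2 by rewrite mulr2n; field.
rewrite [in leRHS]zE cos_mulr2n.
have -> : 2 - 2 * (cos (z / 2) ^+ 2 *+ 2 - 1) = 4 * sin (z / 2) ^+ 2.
  by rewrite sin2cos2; ring.
have h : `|z / 2| <= 1 / 2 by rewrite normrM normfV (ger0_norm (ler0n R 2)); lra.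
have h2 := sin_lower h.
have : (`|z / 2| / 2) ^+ 2 <= sin (z / 2) ^+ 2.
  by rewrite -[leRHS]real_normK ?num_real// lerXn2r ?nnegrE// divr_ge0.
rewrite expr_div_n real_normK ?num_real// expr_div_n; lra.
Qed.

Lemma monotone_limit_cut (S : R -> R) (C : R) : measurable_fun setT S ->
  (forall x, 0 <= S x) ->
  (forall n : nat, intg (cut (- n.+1%:R) n.+1%:R S) /\ Rint (cut (- n.+1%:R) n.+1%:R S) <= C) ->
  intg S /\ Rint S <= C.
Proof.
move=> mS S0 h; set leb := @lebesgue_measure R.
have E : (\int[leb]_x (S x)%:E <= C%:E)%E.
  pose g n x := (cut (- n.+1%:R) n.+1%:R S x)%:E.
  have gx x : g n x @[n --> \oo] --> (S x)%:E.
    apply: cvg_near_cst; near=> n; rewrite /g /cut ifT//.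
    have xn : `|x| < n%:R by near: n; exact: nbhs_infty_gtr.
    have n1 : n%:R <= n.+1%:R :> R by rewrite ler_nat.
    have := lt_le_trans xn n1; rewrite ltr_norml => /andP[/ltW -> ->].
    by [].
  have := @cvg_monotone_convergence _ _ R leb setT measurableT g _ _ _.
  rewrite (_ : (fun x => limn (g ^~ x)) = EFin \o S); last first.
    by apply/funext => x; apply/cvg_lim => //; exact: gx.
  move=> H; apply: (cvge_to_le (H _ _ _)).
  - by move=> n; apply/measurable_EFinP; exact: (intg_measurable (h n).1).
  - by move=> n x _; rewrite /g /cut; case: ifP; rewrite lee_fin.
  - move=> x _ a b ab; rewrite /g /cut lee_fin.
    have ab1 : a.+1%:R <= b.+1%:R :> R by rewrite ler_nat.
    case: ifP => [/andP[h1 h2]|_]; last by case: ifP.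
    rewrite ifT//; apply/andP; split; last exact: lt_le_trans h2 _.
    by apply: le_trans h1; rewrite lerN2.
  - near=> n; have [h1 h2] := h n.
    by rewrite /g -EFin_Rint// lee_fin.
have iS := intg_le_fin mS S0 E.
by split => //; rewrite -lee_fin EFin_Rint.
Unshelve. all: end_near. Qed.

End trig.

(** * The modulus of the perturbation as a part of the base *)

Section modulus.
Context (R : realType).
Implicit Types (u q h : R -> R) (x y t s : R).

Lemma fourier_shift u t y : intg u ->
  ct (fun x => u (x + t) - u x) y ^+ 2 + st (fun x => u (x + t) - u x) y ^+ 2 =
  (ct u y ^+ 2 + st u y ^+ 2) * (2 - 2 * cos (y * t)).
Proof.
move=> hu; have hs := intg_shift t hu; have mu := intg_measurable hu.
have cs : ct (fun x => u (x + t)) y = cos (y * t) * ct u y + sin (y * t) * st u y.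
  rewrite /ct (Rint_shift (- t)); last exact: (intg_measurable (intg_cosM y hs)).
  rewrite -!RintZ; [|exact: intg_sinM|exact: intg_cosM].
  rewrite -RintD; [|by apply: intgZ; exact: intg_cosM|by apply: intgZ; exact: intg_sinM].
  by apply: eq_Rint => x; rewrite subrK mulrBr cosB; ring.
have ss : st (fun x => u (x + t)) y = cos (y * t) * st u y - sin (y * t) * ct u y.
  rewrite /st (Rint_shift (- t)); last exact: (intg_measurable (intg_sinM y hs)).
  rewrite -!RintZ; [|exact: intg_cosM|exact: intg_sinM].
  rewrite -RintB; [|by apply: intgZ; exact: intg_sinM|by apply: intgZ; exact: intg_cosM].
  by apply: eq_Rint => x; rewrite subrK mulrBr sinB; ring.
have -> : ct (fun x => u (x + t) - u x) y = cos (y * t) * ct u y + sin (y * t) * st u y - ct u y.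
  rewrite -cs /ct -RintB; [|exact: intg_cosM|exact: intg_cosM].
  by apply: eq_Rint => x; rewrite mulrBr.
have -> : st (fun x => u (x + t) - u x) y = cos (y * t) * st u y - sin (y * t) * ct u y - st u y.
  rewrite -ss /st -RintB; [|exact: intg_sinM|exact: intg_sinM].
  by apply: eq_Rint => x; rewrite mulrBr.
have := cos2Dsin2 (y * t); set C := cos _; set S := sin _; set a := ct u y; set b := st u y => e.
transitivity ((a ^+ 2 + b ^+ 2) * (C ^+ 2 + S ^+ 2 + 1 - 2 * C)); first by ring.
by rewrite e; ring.
Qed.

(* Bessel's inequality for the increments of u, divided by t^2, as t -> 0. *)
Lemma fourier_moment_modulus u (D : R) : intg u -> intg (fun x => u x ^+ 2) ->
  (forall t, 0 < t -> Rint (fun x => (u (x + t) - u x) ^+ 2) <= D * t ^+ 2) ->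
  intg (fun y => (ct u y ^+ 2 + st u y ^+ 2) * y ^+ 2) /\
  Rint (fun y => (ct u y ^+ 2 + st u y ^+ 2) * y ^+ 2) <= 8 * pi * D.
Proof.
move=> hu hu2 hD.
have mu := intg_measurable hu.
have mS : measurable_fun setT (fun y => (ct u y ^+ 2 + st u y ^+ 2) * y ^+ 2).
  apply: measurable_funM; last exact: measurable_funX.
  by apply: measurable_funD; apply: measurable_funX; [exact: measurable_ct|exact: measurable_st].
apply: monotone_limit_cut => // [y|n].
  by rewrite mulr_ge0 ?sqr_ge0// addr_ge0 ?sqr_ge0.
set k : R := n.+1%:R; have k0 : 0 < k by rewrite /k.
(* For y in [-k, k[ this gives |y t| <= 1, the range in which 2 - 2 cos (y t) is at least (y t)^2 /
   4. *)
pose t := k^-1; have t0 : 0 < t by rewrite invr_gt0.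
have hs := intg_shift t hu.
have hd : intg (fun x => u (x + t) - u x) by exact: intgB.
have hd2 : intg (fun x => (u (x + t) - u x) ^+ 2).
  have i2 := intgZ 2 (intgD (intg_shift t hu2) hu2).
  apply: (le_intg i2) => [|x]; first by apply: measurable_funX; exact: intg_measurable hd.
  rewrite ger0_norm ?sqr_ge0// -subr_ge0.
  by rewrite (_ : _ - _ = (u (x + t) + u x) ^+ 2) ?sqr_ge0//; ring.
have [b1 b2] := bessel hd hd2.
have iB := intgZ (4 * k ^+ 2) b1.
have le1 y : cut (- k) k (fun y => (ct u y ^+ 2 + st u y ^+ 2) * y ^+ 2) y <=
    4 * k ^+ 2 * (ct (fun x => u (x + t) - u x) y ^+ 2 + st (fun x => u (x + t) - u x) y ^+ 2).
  rewrite fourier_shift//; set F := ct u y ^+ 2 + st u y ^+ 2.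
  have F0 : 0 <= F by rewrite addr_ge0 ?sqr_ge0.
  rewrite mulrCA /cut; case: ifP => [/andP[h1 h2]|_]; last first.
    apply: mulr_ge0 => //; apply: mulr_ge0; first by rewrite mulr_ge0 ?sqr_ge0.
    by have := cos_le1 (y * t); set z := cos _; clearbody z; lra.
  apply: ler_wpM2l => //.
  have yt : `|y * t| <= 1.
    rewrite normrM (gtr0_norm t0) /t ler_pdivrMr// mul1r ler_norml h1/=.
    exact: ltW.
  have := one_sub_cos_lower yt; rewrite exprMn => h.
  apply: le_trans (ler_wpM2l _ h); last by rewrite mulr_ge0 ?sqr_ge0.
  rewrite le_eqVlt; apply/orP; left; apply/eqP; rewrite /t; field.
  by rewrite gt_eqF.
have c0 y : 0 <= cut (- k) k (fun y => (ct u y ^+ 2 + st u y ^+ 2) * y ^+ 2) y.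
  rewrite /cut; case: ifP => // _.
  by rewrite mulr_ge0 ?sqr_ge0// addr_ge0 ?sqr_ge0.
have iC : intg (cut (- k) k (fun y => (ct u y ^+ 2 + st u y ^+ 2) * y ^+ 2)).
  apply: (le_intg iB) => [|y]; last by rewrite ger0_norm.
  by rewrite cutE; apply/measurable_restrict => //; exact: measurable_funTS.
split => //; apply: le_trans (le_Rint iC iB le1) _.
rewrite RintZ//; apply: (@le_trans _ _ (4 * k ^+ 2 * (2 * pi * (D * t ^+ 2)))).
  apply: ler_wpM2l; first by rewrite mulr_ge0 ?sqr_ge0.
  apply: le_trans b2 _; apply: ler_wpM2l; first by rewrite mulr_ge0// pi_ge0.
  exact: hD.
rewrite le_eqVlt; apply/orP; left; apply/eqP; rewrite /t; field.
by rewrite gt_eqF.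
Qed.

(** Interpolation between the orders 0 and 1 at scale m: below m^2 the power is monotone, and above
    it (a / m^2)^s <= a / m^2 because s <= 1. *)
Lemma weight_interp s m y : 0 <= s -> s <= 1 -> 0 < m ->
  (y ^+ 2 + 1) `^ s <= m `^ (2 * s) * (1 + m ^- 2 * (y ^+ 2 + 1)).
Proof.
move=> s0 s1 m0; set a := y ^+ 2 + 1.
have a1 : 1 <= a by rewrite lerDr sqr_ge0.
have a0 : 0 < a by lra.
have m2 : 0 < m ^+ 2 by rewrite exprn_gt0.
have e : m `^ (2 * s) = (m ^+ 2) `^ s by rewrite powRrM powR_mulrn// ltW.
have p0 : 0 < (m ^+ 2) `^ s by rewrite powR_gt0.
have q0 : 0 <= m ^- 2 * a by rewrite mulr_ge0 ?invr_ge0// ltW.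
have [am|am] := leP a (m ^+ 2).
  apply: (@le_trans _ _ (m `^ (2 * s))); last by rewrite ler_peMr ?powR_ge0// lerDl.
  by rewrite e; apply: ge0_ler_powR; rewrite ?nnegrE// ltW.
rewrite e; apply: (@le_trans _ _ ((m ^+ 2) `^ s * (m ^- 2 * a))); last first.
  by rewrite ler_wpM2l ?(ltW p0)// lerDr.
have z1 : 1 <= m ^- 2 * a by rewrite mulrC ler_pdivlMr// mul1r ltW.
have {1}-> : a = m ^+ 2 * (m ^- 2 * a) by rewrite mulrA divff ?mul1r// gt_eqF.
rewrite powRM ?ler_wpM2l ?(ltW p0) ?(ltW m2)//.
by rewrite -[leRHS]powRr1//; exact: ler_powR.
Qed.

End modulus.

Section pert_modulus.
Context (R : realType).
Variables (r N : nat) (w m dl s M : R) (p : nat -> R).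
Hypotheses (r1 : (1 < r)%N) (w0 : 0 < w) (w1 : w <= 1) (m1 : 1 <= m) (dl0 : 0 <= dl).
Hypotheses (s0 : 0 <= s) (s1 : s <= 1) (M1 : 1 <= M).
Hypothesis hM : forall i x, (i <= 2)%N -> `|x| <= 1 -> `|((bump R r)^`(i)).[x]| <= M.
Hypothesis mN : 2 * N%:R * w <= m.
Implicit Types (x y t : R).

Let h := pert r w N m dl p.
Let A k j (_ : R) := if j is 0%N then dl * cos (p k) else 0.
Let B k j (_ : R) := if j is 0%N then dl * sin (p k) else 0.
Let Hc := wsum r N m w A 0 0.
Let Hs := wsum r N m w B 0 0.

Let cA k j : continuous (A k j). Proof. by move=> x; exact: cvg_cst. Qed.
Let cB k j : continuous (B k j). Proof. by move=> x; exact: cvg_cst. Qed.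
Let dA k j x : is_derive x 1 (A k j) (A k j.+1 x). Proof. exact: is_derive_cst. Qed.
Let dB k j x : is_derive x 1 (B k j) (B k j.+1 x). Proof. exact: is_derive_cst. Qed.

Let mh : measurable_fun setT h. Proof. exact: (intg_measurable (intg_pert r1 w0 N m dl p)). Qed.

Lemma lft_window k x : (lft m w k <= x < lft m w k.+1) -> `|(x - ctr m w k) / w| <= 1.
Proof.
rewrite lftS /ctr => /andP[h1 h2]; rewrite normrM normfV (gtr0_norm w0) ler_pdivrMr// mul1r.
by rewrite ler_norml; apply/andP; split; lra.
Qed.

Lemma bumpd_window_bound (i k : nat) x : (i <= 2)%N -> lft m w k <= x < lft m w k.+1 ->
  `|bumpd r i (ctr m w k) w x| <= w ^- i * M.
Proof.
move=> i2 /lft_window hx; rewrite /bumpd normrM ger0_norm; last by rewrite invr_ge0 exprn_ge0// ltW.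
by rewrite ler_wpM2l ?invr_ge0 ?exprn_ge0 ?(ltW w0)// hM.
Qed.

Lemma bumpd0_window_bound (k : nat) x : lft m w k <= x < lft m w k.+1 ->
  `|bumpd r 0 (ctr m w k) w x| <= 1.
Proof.
move=> /lft_window hx; rewrite bumpd0E normrX exprn_ile1//.
have s2 := sqr_ge0 ((x - ctr m w k) / w).
have : ((x - ctr m w k) / w) ^+ 2 <= 1 by rewrite -real_normK ?num_real// expr_le1.
by move=> h1; rewrite ger0_norm ?subr_ge0// lerBlDr lerDl.
Qed.

Let trig_bound (f : R -> R) z : (forall z, `|f z| <= 1) -> `|dl * f z| <= dl.
Proof. by move=> f1; rewrite normrM (ger0_norm dl0) ler_piMr. Qed.

Lemma pert_l2 : intg (fun x => h x ^+ 2) /\ Rint (fun x => h x ^+ 2) <= 16 * pi * (dl ^+ 2 * (N%:R * w)).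
Proof.
have bA (k i j : nat) x : (k < N)%N -> (i + j <= 0)%N ->
    lft m w k <= x < lft m w k.+1 -> `|bumpd r i (ctr m w k) w x * A k j x| <= dl.
  move=> _; rewrite leqn0 addn_eq0 => /andP[/eqP -> /eqP ->] hx.
  rewrite normrM -[leRHS]mul1r ler_pM// ?bumpd0_window_bound//.
  by apply: trig_bound => z; exact: cos_max.
have bB (k i j : nat) x : (k < N)%N -> (i + j <= 0)%N ->
    lft m w k <= x < lft m w k.+1 -> `|bumpd r i (ctr m w k) w x * B k j x| <= dl.
  move=> _; rewrite leqn0 addn_eq0 => /andP[/eqP -> /eqP ->] hx.
  rewrite normrM -[leRHS]mul1r ler_pM// ?bumpd0_window_bound//.
  by apply: trig_bound => z; exact: sin_max.
have [] := @wsum2_weighted R r 0 N m w dl A B w0 (ltnW r1) dl0 (fun k j x _ => dA k j x)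
  (fun k j x _ => dB k j x) (fun k j _ => @cA k j) (fun k j _ => @cB k j) bA bB h mh.
  by move=> x; rewrite /h pertE.
have e x : (1 + x ^+ 2) ^+ 0 * h x ^+ 2 = h x ^+ 2 by rewrite expr0 mul1r.
move=> i1 i2; split; first by apply: eq_intg i1 => x; rewrite e.
rewrite (eq_Rint e) in i2; apply: le_trans i2 _.
by rewrite le_eqVlt; apply/orP; left; apply/eqP; rewrite expr0; ring.
Qed.

Lemma pert_weighted1 : intg (fun x => (1 + x ^+ 2) * h x ^+ 2) /\
  Rint (fun x => (1 + x ^+ 2) * h x ^+ 2) <= 80 * pi * M ^+ 2 * (dl ^+ 2 * N%:R / w).
Proof.
have S0 : 0 <= dl * M / w by rewrite divr_ge0 ?mulr_ge0 ?(ltW w0)// (le_trans _ M1).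
have wi (i : nat) : (i <= 1)%N -> w ^- i * M * dl <= dl * M / w.
  case: i => [|[|//]] _; rewrite ?expr0 ?expr1 ?invr1 ?mul1r; last by rewrite le_eqVlt; apply/orP; left; apply/eqP; ring.
  by rewrite mulrC ler_peMr ?mulr_ge0 ?(le_trans _ M1)// invf_ge1.
have bA (k i j : nat) x : (k < N)%N -> (i + j <= 1)%N ->
    lft m w k <= x < lft m w k.+1 -> `|bumpd r i (ctr m w k) w x * A k j x| <= dl * M / w.
  move=> _ ij hx; case: j ij => [|j] ij; last by rewrite /A mulr0 normr0.
  rewrite addn0 in ij; apply: le_trans (wi _ ij); rewrite normrM ler_pM//.
    by apply: bumpd_window_bound => //; exact: leqW.
  by apply: trig_bound => z; exact: cos_max.
have bB (k i j : nat) x : (k < N)%N -> (i + j <= 1)%N ->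
    lft m w k <= x < lft m w k.+1 -> `|bumpd r i (ctr m w k) w x * B k j x| <= dl * M / w.
  move=> _ ij hx; case: j ij => [|j] ij; last by rewrite /B mulr0 normr0.
  rewrite addn0 in ij; apply: le_trans (wi _ ij); rewrite normrM ler_pM//.
    by apply: bumpd_window_bound => //; exact: leqW.
  by apply: trig_bound => z; exact: sin_max.
have [] := @wsum2_weighted R r 1 N m w (dl * M / w) A B w0 r1 S0 (fun k j x _ => dA k j x)
  (fun k j x _ => dB k j x) (fun k j _ => @cA k j) (fun k j _ => @cB k j) bA bB h mh.
  by move=> x; rewrite /h pertE.
move=> i1 i2; split => //; apply: le_trans i2 _.
rewrite le_eqVlt; apply/orP; left; apply/eqP; rewrite expr1; field.
by rewrite gt_eqF.
Qed.

Let HcE x : `|Hc x| <= dl * cut (lft m w 0) (lft m w N) (fun=> 1) x.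
Proof.
have bA (k i j : nat) y : (k < N)%N -> (i + j <= 0)%N ->
    lft m w k <= y < lft m w k.+1 -> `|bumpd r i (ctr m w k) w y * A k j y| <= dl.
  move=> _; rewrite leqn0 addn_eq0 => /andP[/eqP -> /eqP ->] hx.
  rewrite normrM -[leRHS]mul1r ler_pM// ?bumpd0_window_bound//.
  by apply: trig_bound => z; exact: cos_max.
have [h1 h2] := @wsum_bound R r 0 N m w dl A w0 dl0 bA 0 0 x (leqnn 0).
rewrite /cut; case: ifPn => [_|/h2 e]; first by rewrite mulr1.
by rewrite /Hc e normr0 mulr0.
Qed.

Let HsE x : `|Hs x| <= dl * cut (lft m w 0) (lft m w N) (fun=> 1) x.
Proof.
have bB (k i j : nat) y : (k < N)%N -> (i + j <= 0)%N ->
    lft m w k <= y < lft m w k.+1 -> `|bumpd r i (ctr m w k) w y * B k j y| <= dl.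
  move=> _; rewrite leqn0 addn_eq0 => /andP[/eqP -> /eqP ->] hx.
  rewrite normrM -[leRHS]mul1r ler_pM// ?bumpd0_window_bound//.
  by apply: trig_bound => z; exact: sin_max.
have [h1 h2] := @wsum_bound R r 0 N m w dl B w0 dl0 bB 0 0 x (leqnn 0).
rewrite /cut; case: ifPn => [_|/h2 e]; first by rewrite mulr1.
by rewrite /Hs e normr0 mulr0.
Qed.

(** In frequency a shift by t multiplies by exp(-i t v), whose difference from 1 has real and
    imaginary parts of size at most 2 m t on the windows. F and G below are the real and imaginary
    parts of the amplitude times this difference. *)
Lemma pert_increment t : 0 < t ->
  Rint (fun x => (h (x + t) - h x) ^+ 2) <= 256 * pi * (dl ^+ 2 * (N%:R * w)) * m ^+ 2 * t ^+ 2.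
Proof.
move=> t0.
have ic : intg Hc by exact: (intg_wsum r N m w (fun k j _ => @cA k j) 0 (leqnn 0)).
have is' : intg Hs by exact: (intg_wsum r N m w (fun k j _ => @cB k j) 0 (leqnn 0)).
pose F x := cos (t * x) * Hc x - Hc x + sin (t * x) * Hs x.
pose G x := cos (t * x) * Hs x - Hs x - sin (t * x) * Hc x.
have iF : intg F by apply: intgD; [apply: intgB => //; exact: intg_cosM | exact: intg_sinM].
have iG : intg G by apply: intgB; [apply: intgB => //; exact: intg_cosM | exact: intg_sinM].
have hE x : h (x + t) - h x = ct F x + st G x.
  have e y : h y = ct Hc y + st Hs y by rewrite /h pertE.
  rewrite !e.
  have E1 : ct F x = Rint (fun v => cos (x * v) * (cos (t * v) * Hc v)) - ct Hc x + Rint (fun v => cos (x * v) * (sin (t * v) * Hs v)).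
    rewrite -RintB; [|exact/intg_cosM/intg_cosM|exact: intg_cosM].
    rewrite -RintD; [|by apply: intgB; [exact/intg_cosM/intg_cosM|exact: intg_cosM]|exact/intg_cosM/intg_sinM].
    by apply: eq_Rint => v; rewrite /F; ring.
  have E2 : st G x = Rint (fun v => sin (x * v) * (cos (t * v) * Hs v)) - st Hs x - Rint (fun v => sin (x * v) * (sin (t * v) * Hc v)).
    rewrite -RintB; [|exact/intg_sinM/intg_cosM|exact: intg_sinM].
    rewrite -RintB; [|by apply: intgB; [exact/intg_sinM/intg_cosM|exact: intg_sinM]|exact/intg_sinM/intg_sinM].
    by apply: eq_Rint => v; rewrite /G; ring.
  have E3 : ct Hc (x + t) = Rint (fun v => cos (x * v) * (cos (t * v) * Hc v)) - Rint (fun v => sin (x * v) * (sin (t * v) * Hc v)).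
    rewrite -RintB; [|exact/intg_cosM/intg_cosM|exact/intg_sinM/intg_sinM].
    by apply: eq_Rint => v; rewrite mulrDl cosD; ring.
  have E4 : st Hs (x + t) = Rint (fun v => sin (x * v) * (cos (t * v) * Hs v)) + Rint (fun v => cos (x * v) * (sin (t * v) * Hs v)).
    rewrite -RintD; [|exact/intg_sinM/intg_cosM|exact/intg_cosM/intg_sinM].
    by apply: eq_Rint => v; rewrite mulrDl sinD; ring.
  rewrite E1 E2 E3 E4.
  set a1 := Rint _; set a2 := Rint _; set a3 := Rint _; set a4 := Rint _.
  set a5 := st Hs x; set a6 := ct Hc x; clearbody a1 a2 a3 a4 a5 a6; ring.
have [e1 e2] := @lft_range R N w m mN.
pose W := cut (lft m w 0) (lft m w N) (fun=> 1).
have iW : intg W by exact: intg_cut1.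
have bnd (a b : R) x : `|a| <= dl * W x -> `|b| <= dl * W x ->
   (cos (t * x) * a - a + sin (t * x) * b) ^+ 2 <= 16 * dl ^+ 2 * m ^+ 2 * t ^+ 2 * W x.
  move=> ha hb.
  have [Wx|Wx] : W x = 0 \/ W x = 1 by rewrite /W /cut; case: ifP; [right|left].
    move: ha hb; rewrite Wx !mulr0 !normr_le0 => /eqP -> /eqP ->.
    by rewrite !mulr0 subrr addr0 expr0n.
  have x2 : `|x| <= 2 * m.
    move: Wx; rewrite /W /cut; case: ifP => [/andP[q1 q2] _|_ /eqP]; last by rewrite eq_sym oner_eq0.
    rewrite e1 in q1; rewrite ger0_norm; first exact: le_trans (ltW q2) e2.
    by apply: le_trans q1; apply: le_trans m1.
  move: ha hb; rewrite Wx !mulr1 => ha hb.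
  have tx : `|t * x| <= t * (2 * m) by rewrite normrM (gtr0_norm t0) ler_wpM2l// ltW.
  have c1 : `|cos (t * x) - 1| <= t * (2 * m).
    by apply: le_trans tx; have := cos_lip (t * x) 0; rewrite cos0 subr0.
  have c2 : `|sin (t * x)| <= t * (2 * m).
    by apply: le_trans tx; have := sin_lip (t * x) 0; rewrite sin0 !subr0.
  have tm0 : 0 <= t * (2 * m) by apply: le_trans c2.
  have q : `|cos (t * x) * a - a + sin (t * x) * b| <= 2 * (t * (2 * m) * dl).
    rewrite (_ : _ - a = (cos (t * x) - 1) * a); last by ring.
    apply: le_trans (ler_normD _ _) _; rewrite !normrM mulr_natl mulr2n.
    by apply: lerD; apply: ler_pM.
  rewrite -[leLHS]real_normK ?num_real//.
  rewrite (_ : 16 * dl ^+ 2 * m ^+ 2 * t ^+ 2 = (2 * (t * (2 * m) * dl)) ^+ 2); last by ring.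
  by rewrite lerXn2r ?nnegrE// mulr_ge0// mulr_ge0.
have iWc := intgZ (16 * dl ^+ 2 * m ^+ 2 * t ^+ 2) iW.
have F2 x : F x ^+ 2 <= 16 * dl ^+ 2 * m ^+ 2 * t ^+ 2 * W x by apply: bnd; [exact: HcE|exact: HsE].
have G2 x : G x ^+ 2 <= 16 * dl ^+ 2 * m ^+ 2 * t ^+ 2 * W x.
  have := @bnd (Hs x) (- Hc x) x (HsE x); rewrite normrN => /(_ (HcE x)).
  by rewrite mulrN.
have sq (f : R -> R) : intg f -> (forall x, f x ^+ 2 <= 16 * dl ^+ 2 * m ^+ 2 * t ^+ 2 * W x) ->
    intg (fun x => ct f x ^+ 2 + st f x ^+ 2) /\
    Rint (fun x => ct f x ^+ 2 + st f x ^+ 2) <= 2 * pi * (16 * dl ^+ 2 * m ^+ 2 * t ^+ 2 * (2 * N%:R * w)).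
  move=> hf f2; have if2 : intg (fun x => f x ^+ 2).
    apply: (le_intg iWc) => [|x]; first by apply: measurable_funX; exact: intg_measurable hf.
    by rewrite ger0_norm ?sqr_ge0.
  have [b1 b2] := bessel hf if2; split => //; apply: le_trans b2 _.
  apply: ler_wpM2l; first by rewrite mulr_ge0// pi_ge0.
  apply: le_trans (le_Rint if2 iWc f2) _; rewrite RintZ//.
  rewrite /W Rint_cut1; last first.
    by rewrite /lft mulr0 mul0r addr0 lerDl mulr_ge0 ?mulr_ge0// ltW.
  by rewrite le_eqVlt; apply/orP; left; apply/eqP; rewrite /lft; ring.
have [f1 f2] := sq F iF F2; have [g1 g2] := sq G iG G2.
have iFG := intgZ 2 (intgD f1 g1).
have le1 x : (h (x + t) - h x) ^+ 2 <= 2 * (ct F x ^+ 2 + st F x ^+ 2 + (ct G x ^+ 2 + st G x ^+ 2)).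
  rewrite hE; set a := ct F x; set b := st F x; set c := ct G x; set d := st G x.
  rewrite -subr_ge0 (_ : _ - _ = (a - d) ^+ 2 + 2 * (b ^+ 2 + c ^+ 2)); last by ring.
  apply: addr_ge0; first exact: sqr_ge0.
  by apply: mulr_ge0 => //; apply: addr_ge0; exact: sqr_ge0.
have ih := intg_pert r1 w0 N m dl p.
have iI : intg (fun x => (h (x + t) - h x) ^+ 2).
  apply: (le_intg iFG) => [|x]; last by rewrite ger0_norm ?sqr_ge0.
  apply: measurable_funX; apply: intg_measurable; apply: intgB => //; exact: (intg_shift t ih).
apply: le_trans (le_Rint iI iFG le1) _.
rewrite RintZ; last exact: intgD.
rewrite RintD//; apply: le_trans (ler_wpM2l _ (lerD f2 g2)) _ => //.
by rewrite le_eqVlt; apply/orP; left; apply/eqP; ring.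
Qed.

Let u x := `|h x|.

(** The modulus has smaller increments than [h], so its transform inherits the second-moment bound
    through [fourier_moment_modulus]; [weight_interp] then reaches every s <= 1. The constant is
    2112 = 2 * 2 * 16 + 8 * 256, from the energy and from the second moment. *)
Lemma modulus_sobolev :
  intg (fun y => (ct u y ^+ 2 + st u y ^+ 2) * (y ^+ 2 + 1) `^ s) /\
  Rint (fun y => (ct u y ^+ 2 + st u y ^+ 2) * (y ^+ 2 + 1) `^ s) <=
    2112 * pi ^+ 2 * (dl ^+ 2 * (N%:R * w) * m `^ (2 * s)).
Proof.
have ih := intg_pert r1 w0 N m dl p.
have iu : intg u by exact: intg_abs.
have [h2 H2] := pert_l2.
have uE x : u x ^+ 2 = h x ^+ 2 by rewrite /u real_normK ?num_real.
have iu2 : intg (fun x => u x ^+ 2) by apply: eq_intg h2 => x; rewrite uE.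
have m0 : 0 < m by apply: lt_le_trans m1.
set E := dl ^+ 2 * (N%:R * w) in H2 *.
have E0 : 0 <= E by rewrite mulr_ge0 ?sqr_ge0// mulr_ge0// ltW.
have [b1 b2] := bessel iu iu2; rewrite (eq_Rint uE) in b2.
have Du t : 0 < t -> Rint (fun x => (u (x + t) - u x) ^+ 2) <= 256 * pi * E * m ^+ 2 * t ^+ 2.
  move=> t0; apply: le_trans (pert_increment t0).
  have i2 : intg (fun x => (h (x + t) - h x) ^+ 2).
    have i3 := intgZ 2 (intgD (intg_shift t h2) h2).
    apply: (le_intg i3) => [|x]; first by apply: measurable_funX; apply: intg_measurable; apply: intgB => //; exact: (intg_shift t ih).
    rewrite ger0_norm ?sqr_ge0// -subr_ge0.
    by rewrite (_ : _ - _ = (h (x + t) + h x) ^+ 2) ?sqr_ge0//; ring.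
  have le1 x : (u (x + t) - u x) ^+ 2 <= (h (x + t) - h x) ^+ 2.
    rewrite -[leLHS]real_normK ?num_real// -[leRHS]real_normK ?num_real//.
    by rewrite lerXn2r ?nnegrE//; exact: ler_dist_dist.
  apply: le_Rint => //; apply: (le_intg i2) => [|x]; last by rewrite ger0_norm ?sqr_ge0.
  by apply: measurable_funX; apply: intg_measurable; apply: intgB => //; exact: (intg_shift t iu).
have [c1 c2] := fourier_moment_modulus iu iu2 Du.
pose F y := ct u y ^+ 2 + st u y ^+ 2.
have F0 y : 0 <= F y by rewrite addr_ge0 ?sqr_ge0.
pose k := m `^ (2 * s); have k0 : 0 <= k by exact: powR_ge0.
have iR := intgZ k (intgD (intgZ 2 b1) (intgZ (m ^- 2) c1)).
have m2 : m ^- 2 <= 1 by rewrite invf_le1 ?exprn_gt0// exprn_ege1.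
have le1 y : F y * (y ^+ 2 + 1) `^ s <= k * (2 * F y + m ^- 2 * (F y * y ^+ 2)).
  rewrite (_ : k * _ = F y * (k * (2 + m ^- 2 * y ^+ 2))); last by ring.
  apply: ler_wpM2l => //; apply: le_trans (weight_interp y s0 s1 m0) _.
  apply: ler_wpM2l => //; rewrite -subr_ge0.
  by rewrite (_ : _ - _ = 1 - m ^- 2) ?subr_ge0//; ring.
have p0 y : 0 <= F y * (y ^+ 2 + 1) `^ s by rewrite mulr_ge0 ?powR_ge0.
have iI : intg (fun y => F y * (y ^+ 2 + 1) `^ s).
  apply: (le_intg iR) => [|y]; last by rewrite ger0_norm.
  by apply: measurable_funM; [exact: intg_measurable b1|exact: measurable_weight].
split => //; apply: le_trans (le_Rint iI iR le1) _.
rewrite RintZ; last by apply: intgD; exact: intgZ.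
rewrite RintD; [|exact: intgZ|exact: intgZ].
rewrite (RintZ _ b1) (RintZ _ c1).
have e : 2112 * pi ^+ 2 * (E * k) = k * (2 * (2 * pi * (16 * pi * E)) +
   m ^- 2 * (8 * pi * (256 * pi * E * m ^+ 2))) by field; rewrite gt_eqF.
rewrite e; apply: ler_wpM2l => //; apply: lerD.
  apply: ler_wpM2l => //; apply: le_trans b2 _.
  by apply: ler_wpM2l H2; rewrite mulr_ge0// pi_ge0.
by apply: ler_wpM2l c2; rewrite invr_ge0 exprn_ge0// ltW.
Qed.

(** With q = 1 + x^2, the bound |h| <= pi q h^2 + 1 / (4 pi q) turns the weighted energy into an L1
    bound. The last term integrates to 1/4, and 320 = 4 * 80 is chosen so that the first does not
    exceed 1/4. *)
Lemma pert_mass : dl ^+ 2 * N%:R <= w / (320 * pi ^+ 2 * M ^+ 2) -> Rint u <= 1 / 2.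
Proof.
move=> hd; have ih := intg_pert r1 w0 N m dl p.
have iu : intg u by exact: intg_abs.
have [h2 H2] := pert_weighted1.
have [ip Ip] := integral_poisson (@ltr01 R).
have pi0 := @pi_gt0 R.
have iR := intgD (intgZ pi h2) (intgZ (8 * pi)^-1 ip).
have gen (a q v : R) : q != 0 -> a != 0 -> q * (a * v ^+ 2) + (8 * q)^-1 * (2 / a) - v =
    q * a * (v - (2 * q * a)^-1) ^+ 2.
  by move=> q0 a0; field; rewrite q0 a0.
have le1 x : u x <= pi * ((1 + x ^+ 2) * h x ^+ 2) + (8 * pi)^-1 * poisson 1 x.
  have q0 : 0 < 1 + x ^+ 2 by rewrite ltr_pwDl ?sqr_ge0.
  have pn : pi != 0 :> R by rewrite gt_eqF.
  rewrite -subr_ge0 /poisson expr1n mulr1 -(real_normK (num_real (h x))) -/(u x).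
  rewrite (_ : _ - _ = pi * (1 + x ^+ 2) * (u x - (2 * pi * (1 + x ^+ 2))^-1) ^+ 2).
    exact: mulr_ge0 (mulr_ge0 (ltW pi0) (ltW q0)) (sqr_ge0 _).
  by apply: gen => //; rewrite gt_eqF.
apply: le_trans (le_Rint iu iR le1) _.
rewrite RintD; [|exact: intgZ|exact: intgZ].
rewrite (RintZ _ h2) (RintZ _ ip) Ip.
have c8 (q : R) : q != 0 -> (8 * q)^-1 * (2 * q) = 1 / 4 by move=> q0; field.
rewrite (c8 pi) ?(gt_eqF pi0)//.
have M0 : 0 < M by apply: lt_le_trans M1.
suff : pi * Rint (fun x => (1 + x ^+ 2) * h x ^+ 2) <= 1 / 4 by move=> q; apply: le_trans (lerD q (lexx _)) _; rewrite -mulr2n; lra.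
apply: le_trans (ler_wpM2l (ltW pi0) H2) _.
rewrite (_ : pi * _ = 80 * pi ^+ 2 * M ^+ 2 / w * (dl ^+ 2 * N%:R)); last by ring.
apply: le_trans (ler_wpM2l _ hd) _.
  apply: divr_ge0 (ltW w0); apply: mulr_ge0 (sqr_ge0 _).
  by apply: mulr_ge0 (sqr_ge0 _).
have c9 (q : R) : q != 0 -> M != 0 -> w != 0 ->
    80 * q ^+ 2 * M ^+ 2 / w * (w / (320 * q ^+ 2 * M ^+ 2)) = 1 / 4.
  by move=> a1 a2 a3; field; rewrite a1 a2 a3.
by rewrite c9 ?(gt_eqF pi0) ?(gt_eqF M0) ?(gt_eqF w0).
Qed.

End pert_modulus.

(** * Densities in the Sobolev class *)

Section sobolev.
Context (R : realType).
Notation leb := (@lebesgue_measure R).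
Implicit Types (q c u h : R -> R) (s x y w k E : R).

Definition sobolev_le s q E := intg q /\
  intg (fun y => (ct q y ^+ 2 + st q y ^+ 2) * (y ^+ 2 + 1) `^ s) /\
  Rint (fun y => (ct q y ^+ 2 + st q y ^+ 2) * (y ^+ 2 + 1) `^ s) <= E.

Lemma normc_fourier q y : ComplexField.Normc.normc (fourier q y) ^+ 2 = ct q y ^+ 2 + st q y ^+ 2.
Proof. by rewrite /fourier/fourier_on/= sqr_sqrtr// addr_ge0 ?sqr_ge0. Qed.

Lemma sobolev_Omega s B (f : pdf R) : sobolev_le s f (B ^+ 2) -> Omega s B f.
Proof.
move=> [_ [i1 i2]]; rewrite /Omega/=.
rewrite (_ : integral _ _ _ = \int[leb]_y ((ct f y ^+ 2 + st f y ^+ 2) * (y ^+ 2 + 1) `^ s)%:E)%E.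
  by rewrite -EFin_Rint// lee_fin.
by apply: eq_integral => y _; rewrite normc_fourier.
Qed.

Lemma sqr3_le (a b c : R) : (a + b + c) ^+ 2 <= 3 * (a ^+ 2 + b ^+ 2 + c ^+ 2).
Proof.
rewrite -subr_ge0 (_ : _ - _ = (a - b) ^+ 2 + ((b - c) ^+ 2 + (a - c) ^+ 2)); last by ring.
by do ![apply: addr_ge0]; exact: sqr_ge0.
Qed.

Lemma sobolev_sum3 s c u h k j E : 0 <= k <= 1 -> `|j| <= 1 ->
  sobolev_le s c E -> sobolev_le s u E -> sobolev_le s h E ->
  sobolev_le s (fun x => k * c x + u x + j * h x) (9 * E).
Proof.
move=> /andP[k0 k1] j1 [c0 [c1 c2]] [u0 [u1 u2]] [h0 [h1 h2]].
have i1 := intgZ k c0; have i3 := intgZ j h0; have i2 := intgD i1 u0.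
have i4 := intgD i2 i3.
have cE y : ct (fun x => k * c x + u x + j * h x) y = k * ct c y + ct u y + j * ct h y.
  by rewrite ctD// ctD// ctZ// ctZ.
have sE y : st (fun x => k * c x + u x + j * h x) y = k * st c y + st u y + j * st h y.
  by rewrite stD// stD// stZ// stZ.
have iR := intgZ 3 (intgD (intgD c1 u1) h1).
have j2 : j ^+ 2 <= 1 by rewrite -real_normK ?num_real// expr_le1.
have k2 : k ^+ 2 <= 1 by rewrite expr_le1.
have le1 y : (ct (fun x => k * c x + u x + j * h x) y ^+ 2 + st (fun x => k * c x + u x + j * h x) y ^+ 2) * (y ^+ 2 + 1) `^ s <=
   3 * ((ct c y ^+ 2 + st c y ^+ 2) * (y ^+ 2 + 1) `^ s + (ct u y ^+ 2 + st u y ^+ 2) * (y ^+ 2 + 1) `^ s + (ct h y ^+ 2 + st h y ^+ 2) * (y ^+ 2 + 1) `^ s).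
  rewrite -!mulrDl mulrA ler_wpM2r ?powR_ge0// cE sE.
  have sq (a b d : R) : (k * a + b + j * d) ^+ 2 <= 3 * (a ^+ 2 + b ^+ 2 + d ^+ 2).
    apply: le_trans (sqr3_le _ _ _) _; apply: ler_wpM2l => //; rewrite !exprMn.
    by apply: lerD; [apply: lerD => //|]; rewrite ler_piMl ?sqr_ge0.
  apply: le_trans (lerD (sq _ _ _) (sq _ _ _)) _.
  by rewrite le_eqVlt; apply/orP; left; apply/eqP; ring.
have p0 y : 0 <= (ct (fun x => k * c x + u x + j * h x) y ^+ 2 + st (fun x => k * c x + u x + j * h x) y ^+ 2) * (y ^+ 2 + 1) `^ s.
  by rewrite mulr_ge0 ?powR_ge0// addr_ge0 ?sqr_ge0.
have iI : intg (fun y => (ct (fun x => k * c x + u x + j * h x) y ^+ 2 + st (fun x => k * c x + u x + j * h x) y ^+ 2) * (y ^+ 2 + 1) `^ s).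
  apply: (le_intg iR) => [|y]; last by rewrite ger0_norm.
  have m4 := intg_measurable i4.
  apply: measurable_funM; last exact: measurable_weight.
  by apply: measurable_funD; apply: measurable_funX; [exact: measurable_ct|exact: measurable_st].
split => //; split => //; apply: le_trans (le_Rint iI iR le1) _.
rewrite RintZ; last by apply: intgD => //; exact: intgD.
rewrite RintD//; last exact: intgD.
rewrite RintD//; apply: le_trans (ler_wpM2l _ (lerD (lerD c2 u2) h2)) _ => //.
by rewrite le_eqVlt; apply/orP; left; apply/eqP; ring.
Qed.

Lemma sobolev0 s E : 0 <= E -> sobolev_le s (fun=> 0) E.
Proof.
move=> E0; have e y : (ct (fun=> 0 : R) y ^+ 2 + st (fun=> 0 : R) y ^+ 2) * (y ^+ 2 + 1) `^ s = 0.
  rewrite /ct /st; under eq_Rint do rewrite mulr0.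
  rewrite Rint0; under eq_Rint do rewrite mulr0.
  by rewrite Rint0 expr0n addr0 mul0r.
split; first exact: intg0; split.
  by apply: eq_intg (intg0 R) => y; rewrite e.
by rewrite (eq_Rint e) Rint0.
Qed.

Lemma sobolev_le_trans s q E E' : E <= E' -> sobolev_le s q E -> sobolev_le s q E'.
Proof. by move=> EE [a [b c]]; split => //; split => //; exact: le_trans EE. Qed.

(** The Cauchy density of scale 1/w, the scale on which [kern r w] decays. *)
Definition cauchy w x : R := (2 * pi)^-1 * poisson w^-1 x.

Lemma cauchy_ge0 w x : 0 < w -> 0 <= cauchy w x.
Proof.
move=> w0; apply: mulr_ge0; first by rewrite invr_ge0 mulr_ge0 ?pi_ge0.
by apply: poisson_ge0; rewrite invr_gt0.
Qed.

Lemma intg_cauchy w : 0 < w -> intg (cauchy w) /\ Rint (cauchy w) = 1.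
Proof.
move=> w0; have iw0 : 0 < w^-1 by rewrite invr_gt0.
have [ip Ip] := integral_poisson iw0; split; first exact: intgZ.
by rewrite /cauchy RintZ// Ip mulVf// gt_eqF// mulr_gt0// pi_gt0.
Qed.

Lemma sobolev_cauchy s : 0 <= s -> exists2 C : R, 0 < C & forall w, 0 < w -> w <= 1 ->
  sobolev_le s (cauchy w) (C * w).
Proof.
move=> s0; have [C C0 hC] := cauchy_weight s0; exists C => // w w0 w1.
have iw0 : 0 < w^-1 by rewrite invr_gt0.
have [ip _] := integral_poisson iw0; have [ic _] := intg_cauchy w0.
have e y : (ct (cauchy w) y ^+ 2 + st (cauchy w) y ^+ 2) * (y ^+ 2 + 1) `^ s =
    expR (- (w^-1 * `|y|)) ^+ 2 * (y ^+ 2 + 1) `^ s.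
  rewrite /cauchy ctZ// stZ// ct_poisson// st_poisson// mulr0 expr0n addr0 mulrA mulVf ?mul1r//.
  by rewrite gt_eqF// mulr_gt0// pi_gt0.
have [i1 i2] := hC w w0 w1; split => //; split; first by apply: eq_intg i1 => y; rewrite e.
by rewrite (eq_Rint e).
Qed.

Lemma pdf_of (f : R -> R) : intg f -> (forall x, 0 <= f x) -> Rint f = 1 ->
  exists g : pdf R, forall x, g x = f x.
Proof.
move=> fi f0 f1.
have F1 : (\int[leb]_x (f x)%:E = 1)%E by rewrite -EFin_Rint// f1.
by exists (Pdf (intg_measurable fi) f0 F1).
Qed.

End sobolev.

Section pert_pdfs.
Context (R : realType).
Implicit Types (s B w m dl x : R).

Lemma kern_le_poisson r w M : (1 < r)%N -> 0 < w -> 1 <= M ->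
  (forall i x, (i <= 2)%N -> `|x| <= 1 -> `|((bump R r)^`(i)).[x]| <= M) ->
  forall x, `|kern r w x| <= 4 * pi * M * cauchy w x.
Proof.
move=> r1 w0 M1 hM x; have h := kern_bound r1 w0 M1 hM x.
have wn : w != 0 by rewrite gt_eqF.
have s0 : 0 < 1 + (w * x) ^+ 2 by rewrite ltr_pwDl ?sqr_ge0.
have gen (q : R) : q != 0 -> 4 * q * M * ((2 * q)^-1 * poisson w^-1 x) = 4 * M * w / (1 + (w * x) ^+ 2).
  by move=> q0; rewrite /poisson; field; rewrite q0 wn /= gt_eqF.
rewrite /cauchy gen; last by rewrite gt_eqF// pi_gt0.
by rewrite ler_pdivlMr.
Qed.

(** The integral is the transform at frequency 0, which no window reaches because the first one
    starts at m >= 1. Adding the perturbation thus preserves total mass. *)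
Lemma Rint_pert r w N m dl (p : nat -> R) : (1 < r)%N -> 0 < w -> 1 <= m ->
  Rint (pert r w N m dl p) = 0.
Proof.
move=> r1 w0 m1; have -> : Rint (pert r w N m dl p) = ct (pert r w N m dl p) 0.
  by apply: eq_Rint => x; rewrite mul0r cos0 mul1r.
rewrite ct_pert// big1 ?mulr0// => k _; rewrite sub0r add0r bump0_even//.
have h : bump0 r w (ctr m w k) = 0.
  rewrite /bump0 /cut ifN// negb_and -!leNgt orbC /ctr /lft.
  have : 0 <= 2 * k%:R * w by rewrite mulr_ge0 ?mulr_ge0// ltW.
  by set z := _ * w; clearbody z => z0; rewrite (_ : w <= m + z + w) //; lra.
by rewrite h addr0 mulr0.
Qed.

(* The two densities are (1 - Rint u) * cauchy + u +/- pert. The alternatives in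
   the last hypothesis are two ways to keep them nonnegative: with u = 0 the heavy
   tails of the Cauchy density dominate the kernel; for s <= 1, u = |pert|. *)
Lemma pert_pdfs r s B : (1 < r)%N -> 0 <= s -> 0 < B ->
  exists w0 kp : R, [/\ 0 < w0, w0 <= 1, 0 < kp & forall N w m dl (p : nat -> R),
    0 < w -> w <= w0 -> 1 <= m -> 0 <= dl -> 2 * N%:R * w <= m ->
    dl ^+ 2 * (N%:R * w) * m `^ (2 * s) <= kp ->
    dl * N%:R <= kp \/ (s <= 1 /\ dl ^+ 2 * N%:R <= kp * w) ->
    exists f1 f2 : pdf R, [/\ Omega s B f1, Omega s B f2 &
      forall x, f1 x - f2 x = 2 * pert r w N m dl p x]].
Proof.
move=> r1 s0 B0.
have [M M1 hM] := bump_bounded R r 2.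
have M0 : 0 < M by apply: lt_le_trans M1.
have [C C0 hC] := sobolev_cauchy s0.
have pi0 := @pi_gt0 R.
(* Each density is a sum of three pieces of energy at most E, and [sobolev_sum3] loses a factor
   9. *)
pose E := B ^+ 2 / 9; have E0 : 0 < E by rewrite divr_gt0// exprn_gt0.
pose C1 : R := 16 * pi ^+ 2 * 5 `^ s; pose C2 : R := 2112 * pi ^+ 2.
have p2 : 0 < pi ^+ 2 :> R by rewrite exprn_gt0.
have C10 : 0 < C1 by rewrite mulr_gt0 ?powR_gt0// mulr_gt0.
have C20 : 0 < C2 by apply: mulr_gt0 p2; rewrite ltr0n.
pose k3 := (4 * pi * M)^-1; have k30 : 0 < k3 by rewrite invr_gt0 mulr_gt0// mulr_gt0.
pose k4 := (320 * pi ^+ 2 * M ^+ 2)^-1.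
have k40 : 0 < k4.
  by rewrite invr_gt0; apply: mulr_gt0 (exprn_gt0 2 M0); apply: mulr_gt0 p2; rewrite ltr0n.
pose kp := Num.min (Num.min (E / C1) (E / C2)) (Num.min k3 k4).
exists (Num.min 1 (E / C)), kp; split.
- by rewrite lt_min ltr01 divr_gt0.
- by rewrite ge_min lexx.
- by rewrite /kp !lt_min; apply/and3P; split; [apply/andP; split; exact: divr_gt0|exact: k30|exact: k40].
move=> N w m dl p w0 ww0 m1 dl0 mN hS hP.
have w1 : w <= 1 by apply: le_trans ww0 _; rewrite ge_min lexx.
have wE : C * w <= E.
  by rewrite mulrC -ler_pdivlMr//; apply: le_trans ww0 _; rewrite ge_min lexx orbT.
have [kp1 kp2] : kp <= E / C1 /\ kp <= E / C2 by rewrite !ge_min !lexx ?orbT.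
have [kp3 kp4] : kp <= k3 /\ kp <= k4 by rewrite !ge_min !lexx ?orbT.
pose h := pert r w N m dl p.
have ih : intg h by exact: intg_pert.
have Ih : Rint h = 0 by exact: Rint_pert.
have sc : sobolev_le s (cauchy w) E by exact: sobolev_le_trans wE (hC w w0 w1).
have sh : sobolev_le s h E.
  have [a1 a2] := @pert_sobolev R r N w m dl s p r1 w0 m1 dl0 s0 mN.
  split => //; split => //; apply: le_trans a2 _; rewrite -/C1 mulrC -ler_pdivlMr//.
  exact: le_trans hS kp1.
have [ic Ic] := intg_cauchy w0.
(* The bound on |h| gives nonnegativity for both signs; the mass is 1 because [cauchy w] has mass 1
   and h has mass 0. *)
suff [u [u0 su ku uh]] : exists u : R -> R, [/\ forall x, 0 <= u x, sobolev_le s u E,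
    Rint u <= 1 & forall x, `|h x| <= (1 - Rint u) * cauchy w x + u x].
  have [iu _] := su.
  have ku0 : 0 <= Rint u by exact: Rint_ge0.
  have k01 : 0 <= 1 - Rint u <= 1 by rewrite subr_ge0 ku gerBl.
  have mk j : `|j| = 1 -> exists f : pdf R, Omega s B f /\
      forall x, f x = (1 - Rint u) * cauchy w x + u x + j * h x.
    move=> j1; have j1' : `|j| <= 1 by rewrite j1.
    have sf := sobolev_sum3 k01 j1' sc su sh.
    have [fi _] := sf.
    have [| |f fE] := pdf_of fi.
    - move=> x; rewrite -lerBlDr sub0r (le_trans _ (uh x))//.
      by rewrite (le_trans (ler_norm _))// normrN normrM j1 mul1r.
    - rewrite RintD; [|by apply: intgD => //; exact: intgZ|exact: intgZ].
      rewrite RintD//; last exact: intgZ.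
      by rewrite (RintZ _ ic) (RintZ _ ih) Ic Ih mulr0 addr0 mulr1 subrK.
    exists f; split => //; apply: sobolev_Omega.
    have -> : (f : R -> R) = (fun x => (1 - Rint u) * cauchy w x + u x + j * h x) by exact/funext.
    by have -> : B ^+ 2 = 9 * E by rewrite /E; field.
  have [f1 [Om1 e1]] := mk 1 (normr1 _); have [f2 [Om2 e2]] := mk (-1) (normrN1 _).
  by exists f1, f2; split => // x; rewrite e1 e2 /h; ring.
case: hP => [hd|[s1 hd]].
- exists (fun=> 0); split; first by move=> x.
  + by apply: sobolev0; exact: ltW.
  + by rewrite Rint0.
  move=> x; rewrite Rint0 subr0 mul1r addr0 /h.
  apply: le_trans (pert_bound _ _ _ _ _ _ _) _; rewrite (ger0_norm dl0).
  have dN0 : 0 <= dl * N%:R by rewrite mulr_ge0.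
  apply: le_trans (ler_wpM2l dN0 (kern_le_poisson r1 w0 M1 hM x)) _.
  rewrite mulrA ler_piMl ?cauchy_ge0//.
  apply: (@le_trans _ _ (k3 * (4 * pi * M))).
    apply: ler_wpM2r; first by rewrite mulr_ge0 ?(ltW M0)// mulr_ge0 ?(ltW pi0).
    exact: le_trans hd kp3.
  by rewrite mulVf// gt_eqF// mulr_gt0// mulr_gt0.
- have hd4 : dl ^+ 2 * N%:R <= w / (320 * pi ^+ 2 * M ^+ 2).
    by apply: le_trans hd _; rewrite -/k4 mulrC; apply: ler_wpM2l kp4; exact: ltW.
  have hm := pert_mass m p r1 w0 w1 dl0 M1 hM hd4.
  have half1 : 1 / 2 <= 1 :> R by rewrite ler_pdivrMr// mul1r ler1n.
  exists (fun x => `|h x|); split; first by move=> x; exact: normr_ge0.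
  + split; first exact: intg_abs.
    have [a1 a2] := modulus_sobolev p r1 w0 m1 dl0 s0 s1 mN.
    split => //; apply: le_trans a2 _; rewrite -/C2 mulrC -ler_pdivlMr//.
    exact: le_trans hS kp2.
  + exact: le_trans hm half1.
  + move=> x; rewrite lerDr mulr_ge0 ?cauchy_ge0// subr_ge0.
    exact: le_trans hm half1.
Qed.

End pert_pdfs.

(** * Separation of the functional *)

Section ae.
Context (R : realType).
Notation leb := (@lebesgue_measure R).

#[local] Instance ae_leb_filter : Filter (almost_everywhere leb).
Proof. exact: (@ae_filter_ringOfSetsType _ (measurableTypeR R)). Qed.

Lemma ae_le_Rint (f g : R -> R) : intg f -> intg g ->
  {ae leb, forall x, f x <= g x} -> Rint f <= Rint g.
Proof.
move=> hf hg fg; rewrite -subr_ge0 -RintB//.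
have hd := intgB hg hf.
rewrite (_ : Rint _ = Rint (fun x => `|g x - f x|)); first by apply: Rint_ge0.
congr fine; apply: ae_eq_integral => //.
- exact: measurable_int hd.
- exact: measurable_int (intg_abs hd).
- by apply: (@filterS _ _ ae_leb_filter) fg => x fgx _; rewrite /= ger0_norm// subr_ge0.
Qed.

Lemma ae_opp (P : R -> Prop) : {ae leb, forall x, P x} -> {ae leb, forall x, P (- x)}.
Proof.
move=> [A [mA A0 sA]]; exists (sgaff true 0 @^-1` A); split.
- by rewrite -[X in measurable X]setTI; exact: measurable_sgaff.
- by have := lebesgue_measure_sgaff true 0 mA; rewrite A0 => ->.
- by move=> x /= nP; apply: sA => /=; rewrite /sgaff expr1 mulN1r addr0.
Qed.

(* phis is only known through symmetric improper integrals, whence the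
   restriction to almost every frequency. *)
Lemma fourier_sym (t : R -> R) (psi : R -> R[i]) : is_fourier t psi ->
  {ae leb, forall w, complex.Re (psi (- w)) = complex.Re (psi w) /\
                     complex.Im (psi (- w)) = - complex.Im (psi w)}.
Proof.
move=> [it h]; have h' := ae_opp h.
apply: (@filterS2 _ _ ae_leb_filter) h h' => w [h1 h2] [h3 h4]; split.
  rewrite -(cvg_lim (@norm_hausdorff _ R) h3).
  apply: (cvg_lim (@norm_hausdorff _ R)).
  rewrite (_ : (fun M : R => _) = (fun M => complex.Re (fourier_on `[- M, M] t w)))//.
  by apply/funext => M /=; apply: eq_Rintegral => x _; rewrite mulNr cosN.
rewrite -(cvg_lim (@norm_hausdorff _ R) h4).
apply: (cvg_lim (@norm_hausdorff _ R)).
rewrite (_ : (fun M : R => _) = (fun M => - complex.Im (fourier_on `[- M, M] t w))).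
  exact: cvgN.
apply/funext => M /=; have iM : leb.-integrable `[- M, M] (EFin \o (fun x => sin (w * x) * t x)).
  apply: (le_integrable _ _ _ (it M)) => //.
    apply/measurable_EFinP; apply: measurable_funM.
      by apply: measurable_funTS; exact: measurable_sinM.
    by apply/measurable_EFinP; exact: measurable_int (it M).
  by move=> x _ /=; rewrite lee_fin normrM ler_piMl// sin_max.
rewrite -[RHS]mulN1r -RintegralZl//; apply: eq_Rintegral => x _.
by rewrite mulNr sinN mulNr mulN1r.
Qed.

Lemma Re_mul (x y : R[i]) :
  complex.Re (x * y) = complex.Re x * complex.Re y - complex.Im x * complex.Im y.
Proof. by case: x; case: y. Qed.

Lemma parseval_Rint (phi : R -> R) (phis : R -> R[i]) (f : pdf R) :
  parseval_at phi phis f ->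
  let K w := ct f w * complex.Re (phis (- w)) - st f w * complex.Im (phis (- w)) in
  intg K /\ Phi phi f = (2 * pi)^-1 * Rint K.
Proof.
move=> [_ [i1 _] /(congr1 (@complex.Re _))] e K.
have eK w : complex.Re (fourier f w * phis (- w)) = K w by rewrite Re_mul.
split; first by move: i1; rewrite (_ : (fun w => _) = (EFin \o K))//; apply/funext => w /=; rewrite eK.
move: e; rewrite Re_mul /= mul0r subr0 => ->; congr (_ * _); congr fine.
by apply: eq_integral => w _; rewrite eK.
Qed.

End ae.

Section phase.
Context (R : realType).
Notation leb := (@lebesgue_measure R).

Lemma lip_above (f : R -> R) (m C : R) : (forall x, m <= x -> derivable f x 1) ->
  (forall x, m <= x -> `|derive1 f x| <= C) ->
  forall x y, m <= x -> m <= y -> `|f x - f y| <= C * `|x - y|.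
Proof.
move=> df fC x y mx my; wlog xy : x y mx my / x <= y.
  move=> H; have [xy|yx] := leP x y; first exact: H.
  by rewrite distrC (distrC x); apply: H => //; exact: ltW.
have [| |c] := @MVT_segment R f (derive1 f) x y xy.
- move=> z /[!in_itv]/= /andP[xz _].
  by rewrite derive1E; apply/derivableP; apply: df; rewrite (le_trans mx)// ltW.
- apply: derivable_within_continuous => z /[!in_itv]/= /andP[xz _].
  by apply: df; exact: le_trans xz.
move=> /[!in_itv]/= /andP[xc cy] e.
rewrite distrC e (distrC x) normrM ler_wpM2r//; apply: fC; exact: le_trans xc.
Qed.

Lemma dist_half (u c w : R) : c - w / 2 <= u -> u < c + w / 2 -> `|u - c| <= w / 2.
Proof. by move=> h1 h2; rewrite ler_norml; apply/andP; split; lra. Qed.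

(** Aligning each bump with the phase of [phis] at the centre excludes cancellation: on a window the
    integrand is the bump times |phis| cos (rho u - p k), and the phase moves by at most C w <= 1/2,
    so the cosine is at least 1/2. *)
Lemma Phi_pert (phi : R -> R) (phis : R -> R[i]) (rho : R -> R) (r N : nat)
    (w m dl L C : R) (f1 f2 : pdf R) :
  is_fourier phi phis -> parseval_at phi phis f1 -> parseval_at phi phis f2 ->
  (forall x, m <= x -> phis x = (ComplexField.Normc.normc (phis x))%:C%C *
                                (cos (rho x) +i* sin (rho x))%C) ->
  (forall x, m <= x -> derivable rho x 1) ->
  (forall x, m <= x -> `|derive1 rho x| <= C) ->
  (1 < r)%N -> 0 < w -> 1 <= m -> 0 <= dl -> C * w <= 1 / 2 -> 0 <= L ->
  (forall y, m <= y <= m + 2 * N%:R * w -> L <= ComplexField.Normc.normc (phis y)) ->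
  (forall x, f1 x - f2 x = 2 * pert r w N m dl (fun k => rho (ctr m w k)) x) ->
  (1 / 2) ^+ r.+1 * (dl * (N%:R * w) * L) <= Phi phi f1 - Phi phi f2.
Proof.
move=> hphi P1 P2 harg drho rhoC r1 w0 m1 dl0 Cw L0 hL hf.
set p : nat -> R := fun k => rho (ctr m w k) in hf.
pose pr (u : R) := complex.Re (phis u); pose pj (u : R) := complex.Im (phis u).
pose nc (u : R) := ComplexField.Normc.normc (phis u).
have nc0 u : 0 <= nc u by rewrite /nc; case: (phis u) => ? ? /=; exact: sqrtr_ge0.
have [i1 e1] := parseval_Rint P1; have [i2 e2] := parseval_Rint P2.
rewrite e1 e2 -mulrBr -RintB//.
pose T k u := bump0 r w (u - ctr m w k) * (cos (p k) * pr u + sin (p k) * pj u).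
pose G u := \sum_(k < N) T k u.
have ih := intg_pert r1 w0 N m dl p.
have if2 : intg f2 by have [] := intg_pdf f2.
have fE x : f1 x = f2 x + 2 * pert r w N m dl p x by rewrite -hf addrC subrK.
(* Parseval's formula pairs with [phis (- y)], the conjugate of [phis y] for almost every y. G y
   comes from the windows and G (- y) from their mirror images. *)
have KE y : pr (- y) = pr y -> pj (- y) = - pj y ->
    ct f1 y * pr (- y) - st f1 y * pj (- y) - (ct f2 y * pr (- y) - st f2 y * pj (- y)) =
    2 * dl * pi * (G y + G (- y)).
  move=> ey1 ey2.
  rewrite (eq_ct y fE) (eq_st y fE) ctD//; last exact: intgZ.
  rewrite stD//; last exact: intgZ.
  rewrite ctZ// stZ// ct_pert// st_pert//.
  have GE : G y + G (- y) =
      pr y * \sum_(k < N) (cos (p k) * (bump0 r w (y - ctr m w k) + bump0 r w (y + ctr m w k))) +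
      pj y * \sum_(k < N) (sin (p k) * (bump0 r w (y - ctr m w k) - bump0 r w (y + ctr m w k))).
    rewrite !mulr_sumr -!big_split/=; apply: eq_bigr => k _.
    rewrite /T -opprD bump0_even// ey1 ey2.
    by move: (bump0 _ _ _) (bump0 _ _ _) (cos _) (sin _) (pr y) (pj y) => *; ring.
  rewrite GE ey1 ey2; move: (\sum_(_ < _) _) (\sum_(_ < _) _) => A1 A2.
  by move: (ct f2 y) (st f2 y) (pr y) (pj y) pi => *; ring.
pose c := (1 / 2) ^+ r.+1 * L.
have c0 : 0 <= c by rewrite mulr_ge0// exprn_ge0.
(* A minorant on the middle half of the window, where the bump is at least (1/2)^r; the cosine
   supplies one more factor 1/2. *)
pose I k u := c * cut (ctr m w k - w / 2) (ctr m w k + w / 2) (fun=> 1) u.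
have TI k u : (k < N)%N -> 0 <= T k u /\ I k u <= T k u.
  move=> kN; have [uk|uk] := leP `|u - ctr m w k| w; last first.
    have b0 : bump0 r w (u - ctr m w k) = 0 by rewrite bump0E// leNgt uk.
    rewrite /T b0 mul0r lexx; split => //.
    rewrite /I /cut; case: ifP => [/andP[h1 h2]|_]; last by rewrite mulr0.
    have := dist_half h1 h2.
    by rewrite leNgt (lt_le_trans _ (ltW uk))// ltr_pdivrMr// ltr_pMr// ltr1n.
  have k0 : 0 <= 2 * k%:R * w by rewrite mulr_ge0 ?mulr_ge0// ltW.
  have mk : m <= ctr m w k by rewrite /ctr /lft; clear -k0 w0; lra.
  have kN2 : 2 * k%:R * w + 2 * w <= 2 * N%:R * w.
    rewrite (_ : 2 * k%:R * w + 2 * w = 2 * (k.+1)%:R * w); last by rewrite -natr1; ring.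
    by apply: ler_wpM2r; [exact: ltW|apply: ler_wpM2l => //; rewrite ler_nat].
  have um : m <= u <= m + 2 * N%:R * w.
    move: uk; rewrite ler_norml /ctr /lft => /andP[h1 h2].
    by clear -h1 h2 kN2 k0; apply/andP; split; lra.
  have mu : m <= u by case/andP: um.
  have rr : cos (rho u - p k) >= 1 / 2.
    have d1 : `|rho u - p k| <= 1 / 2.
      apply: le_trans (lip_above drho rhoC mu mk) _.
      apply: le_trans Cw; apply: ler_wpM2l uk.
      by apply: le_trans (rhoC _ mu).
    have := cos_lip 0 (rho u - p k); rewrite cos0 sub0r normrN => d2.
    have := le_trans (ler_norm _) d2 => d3.
    by clear -d1 d3; lra.
  have TE : T k u = bump0 r w (u - ctr m w k) * (nc u * cos (rho u - p k)).
    have er : pr u = nc u * cos (rho u).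
      by rewrite /nc /pr [in LHS](harg _ mu) Re_mul /= mul0r subr0.
    have ej : pj u = nc u * sin (rho u).
      by rewrite /nc /pj [in LHS](harg _ mu) /= mul0r addr0.
    rewrite /T er ej cosB; congr (_ * _).
    by move: (nc u) (cos _) (sin _) (cos _) (sin _) => *; ring.
  have /andP[b0 _] := bump0_bound r w0 (u - ctr m w k).
  have T1 : bump0 r w (u - ctr m w k) * (nc u * (1 / 2)) <= T k u.
    by rewrite TE; apply: ler_wpM2l => //; apply: ler_wpM2l.
  have T0 : 0 <= T k u.
    by apply: le_trans T1; apply: mulr_ge0 => //; apply: mulr_ge0.
  split => //; rewrite /I /cut; case: ifP => [/andP[h1 h2]|_]; last by rewrite mulr0.
  have uw := dist_half h1 h2.
  rewrite mulr1; apply: le_trans T1; have bg := bump0_ge r w0 uw.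
  rewrite /c exprSr -mulrA; apply: ler_pM bg _; first exact: exprn_ge0.
    exact: mulr_ge0.
  by rewrite mulrC; apply: ler_wpM2r => //; exact: hL.
have iI k : intg (I k) by apply: intgZ; exact: intg_cut1.
have IG u : \sum_(k < N) I k u <= G u by apply: ler_sum => k _; case: (TI k u (ltn_ord k)).
have G0 u : 0 <= G u by apply: sumr_ge0 => k _; case: (TI k u (ltn_ord k)).
have RI : Rint (fun u => \sum_(k < N) I k u) = N%:R * (w * c).
  rewrite Rint_sum// (eq_bigr (fun=> w * c)) ?sumr_const ?card_ord ?mulr_natl// => k _.
  rewrite /I RintZ; last exact: intg_cut1.
  rewrite Rint_cut1; first by rewrite mulrC; congr (_ * _); field.
  by clear -w0; lra.
have iS : intg (fun u => \sum_(k < N) I k u) by exact: intg_sum.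
have pi0 := @pi_gt0 R.
have d0 : 0 <= 2 * dl * pi by rewrite mulr_ge0 ?(ltW pi0)// mulr_ge0.
(* The mirror part G (- y) is nonnegative and is dropped. *)
have ae1 : {ae leb, forall y, 2 * dl * pi * (\sum_(k < N) I k y) <=
    ct f1 y * pr (- y) - st f1 y * pj (- y) - (ct f2 y * pr (- y) - st f2 y * pj (- y))}.
  apply: (@filterS _ _ (ae_leb_filter R)) (fourier_sym hphi) => y [h1 h2].
  by rewrite KE// ler_wpM2l// -[leLHS]addr0 lerD.
have := ae_le_Rint (intgZ (2 * dl * pi) iS) (intgB i1 i2) ae1.
rewrite RintZ// RI => H.
apply: le_trans (ler_wpM2l _ H); last by rewrite invr_ge0 mulr_ge0// ltW.
rewrite /c; have : pi != 0 :> R by rewrite gt_eqF.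
move: (pi : R) ((1 / 2) ^+ r.+1) => q t q0.
by rewrite le_eqVlt; apply/orP; left; apply/eqP; field.
Qed.

End phase.

Section chi2.
Context (R : realType).
Implicit Types (g h : R -> R) (x y w m : R).

Lemma Ck_on_derive K g j x : Ck_on K setT g -> (j < K)%N ->
  is_derive x 1 (derive1n j g) (derive1n j.+1 g x).
Proof.
move=> hg jK; have [/(_ j jK) d _] := hg x I.
by rewrite /derive1n/= derive1E; exact/derivableP.
Qed.

Lemma Ck_on_continuous K g j : Ck_on K setT g -> (j <= K)%N -> continuous (derive1n j g).
Proof.
rewrite leq_eqVlt => hg /orP[/eqP ->|jK] x; first by have [_] := hg x I.
by have [/(_ j jK) d _] := hg x I; exact/differentiable_continuous/derivable1_diffP.
Qed.

Lemma normr_Re_normc (z : R[i]) : `|complex.Re z| <= ComplexField.Normc.normc z.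
Proof.
case: z => u v /=; rewrite -sqrtr_sqr ler_wsqrtr// lerDl sqr_ge0 //.
Qed.

Lemma normr_Im_normc (z : R[i]) : `|complex.Im z| <= ComplexField.Normc.normc z.
Proof.
case: z => u v /=; rewrite -sqrtr_sqr ler_wsqrtr// lerDr sqr_ge0 //.
Qed.

(** By [conv_ct_st] the convolution is again a window sum, now with amplitude dl exp(i p k) times
    [fourier g]. A and B are the derivatives of its real and imaginary parts, and S controls every
    term that Leibniz' rule produces. *)
Lemma pert_conv (g : pdf R) (r K N : nat) (w m dl M S : R) (p : nat -> R) :
  (K < r)%N -> (1 < r)%N -> 0 < w -> 1 <= m -> 0 <= dl -> 1 <= M -> 0 <= S ->
  (forall i x, (i <= K)%N -> `|x| <= 1 -> `|((bump R r)^`(i)%R).[x]| <= M) ->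
  2 * N%:R * w <= m ->
  Ck_on K setT (ct g) -> Ck_on K setT (st g) ->
  (forall i j x, (i + j <= K)%N -> m <= x <= 2 * m ->
     w ^- i * ComplexField.Normc.normc (cderiv1n j (fourier g) x) <= S) ->
  let h := pert r w N m dl p in
  intg (fun y => (1 + y ^+ 2) ^+ K * conv_pdf h g y ^+ 2) /\
  Rint (fun y => (1 + y ^+ 2) ^+ K * conv_pdf h g y ^+ 2) <=
    4 * (5 ^+ K * (2 * pi * ((2 * dl * M * S) ^+ 2 * (2 * N%:R * w)))).
Proof.
move=> Kr r1 w0 m1 dl0 M1 S0 hM mN hRe hIm hS h.
have [ig _] := intg_pdf g; have ih := intg_pert r1 w0 N m dl p.
pose gr j := derive1n j (ct g); pose gi j := derive1n j (st g).
pose A k j (x : R) := dl * (cos (p k) * gr j x - sin (p k) * gi j x).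
pose B k j (x : R) := dl * (cos (p k) * gi j x + sin (p k) * gr j x).
have cs (u v z : R) : `|u| <= 1 -> `|v| <= z -> `|u * v| <= z.
  by move=> u1 vz; rewrite normrM (le_trans _ vz)// ler_piMl.
have AB k j x : `|A k j x| <= 2 * dl * ComplexField.Normc.normc (cderiv1n j (fourier g) x) /\
    `|B k j x| <= 2 * dl * ComplexField.Normc.normc (cderiv1n j (fourier g) x).
  have r0 := normr_Re_normc (cderiv1n j (fourier g) x).
  have i0 := normr_Im_normc (cderiv1n j (fourier g) x).
  have b1 := cs (cos (p k)) _ _ (cos_max (p k)) r0; have b2 := cs (sin (p k)) _ _ (sin_max (p k)) i0.
  have b3 := cs (cos (p k)) _ _ (cos_max (p k)) i0; have b4 := cs (sin (p k)) _ _ (sin_max (p k)) r0.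
  split; rewrite /A /B normrM (ger0_norm dl0) (mulrC 2) -mulrA ler_wpM2l// mulr2n mulrDl mul1r.
    by apply: le_trans (ler_normB _ _) _; apply: lerD.
  by apply: le_trans (ler_normD _ _) _; apply: lerD.
have bnd (F : nat -> nat -> R -> R) :
    (forall k j x, `|F k j x| <= 2 * dl * ComplexField.Normc.normc (cderiv1n j (fourier g) x)) ->
    forall k i j x, (k < N)%N -> (i + j <= K)%N ->
    lft m w k <= x < lft m w k.+1 -> `|bumpd r i (ctr m w k) w x * F k j x| <= 2 * dl * M * S.
  move=> hF k i j x kN ijK xk.
  have xm : m <= x <= 2 * m.
    move: xk; rewrite /lft => /andP[h1 h2].
    have k0 : 0 <= 2 * k%:R * w by rewrite mulr_ge0 ?mulr_ge0// ltW.
    have kN2 : 2 * k.+1%:R * w <= 2 * N%:R * w.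
      by apply: (ler_wpM2r (ltW w0)); apply: ler_wpM2l => //; rewrite ler_nat.
    by clear -h1 h2 kN2 k0 mN; apply/andP; split; lra.
  have iK : (i <= K)%N by apply: leq_trans ijK; exact: leq_addr.
  have Bd : `|bumpd r i (ctr m w k) w x| <= w ^- i * M.
    rewrite /bumpd normrM ger0_norm; last by rewrite invr_ge0 exprn_ge0// ltW.
    apply: ler_wpM2l; first by rewrite invr_ge0 exprn_ge0// ltW.
    by apply: hM => //; exact: lft_window.
  rewrite normrM; apply: le_trans (ler_pM (normr_ge0 _) (normr_ge0 _) Bd (hF k j x)) _.
  set z := ComplexField.Normc.normc _.
  have -> : w ^- i * M * (2 * dl * z) = 2 * dl * M * (w ^- i * z).
    by move: z (w ^- i) => *; ring.
  apply: ler_wpM2l; last exact: hS.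
  by apply: mulr_ge0; [apply: mulr_ge0|apply: le_trans M1].
have dA k j (x : R) : (j < K)%N -> is_derive x 1 (A k j) (A k j.+1 x).
  move=> jK; have d1 := Ck_on_derive x hRe jK; have d2 := Ck_on_derive x hIm jK.
  by rewrite /A; apply: is_deriveZ; apply: is_deriveB; apply: is_deriveZ.
have dB k j (x : R) : (j < K)%N -> is_derive x 1 (B k j) (B k j.+1 x).
  move=> jK; have d1 := Ck_on_derive x hRe jK; have d2 := Ck_on_derive x hIm jK.
  by rewrite /B; apply: is_deriveZ; apply: is_deriveD; apply: is_deriveZ.
have cA k j : (j <= K)%N -> continuous (A k j).
  move=> jK x; have c1 := @Ck_on_continuous K (ct g) j hRe jK x; have c2 := @Ck_on_continuous K (st g) j hIm jK x.
  by apply: cvgM; [exact: cvg_cst|apply: cvgB; apply: cvgM => //; exact: cvg_cst].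
have cB k j : (j <= K)%N -> continuous (B k j).
  move=> jK x; have c1 := @Ck_on_continuous K (ct g) j hRe jK x; have c2 := @Ck_on_continuous K (st g) j hIm jK x.
  by apply: cvgM; [exact: cvg_cst|apply: cvgD; apply: cvgM => //; exact: cvg_cst].
have S1 : 0 <= 2 * dl * M * S.
  by apply: mulr_ge0 => //; apply: mulr_ge0; [apply: mulr_ge0|apply: le_trans M1].
apply: (wsum2_weighted w0 Kr S1 dA dB cA cB (bnd A (fun k j x => (AB k j x).1)) (bnd B (fun k j x => (AB k j x).2))).
  apply: (measurable_Rint_param (k := fun z => g (z.1 - z.2) * h z.2)).
  apply: measurable_funM; last exact: (measurableT_comp (intg_measurable ih)).
  by apply: (measurableT_comp (measurable_pdf g)); exact: measurable_funB.
move=> y; rewrite /conv_pdf -/(Rint _).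
pose A0 k j (_ : R) := if j is 0%N then dl * cos (p k) else 0 : R.
pose B0 k j (_ : R) := if j is 0%N then dl * sin (p k) else 0 : R.
have iw (F : nat -> nat -> R -> R) : (forall k, continuous (F k 0%N)) -> intg (wsum r N m w F 0 0).
  move=> cF; apply: intg_sum => k; apply: intg_cut => x; apply: cvgM; last exact: cF.
  exact: continuous_bumpd.
rewrite (eq_Rint (g := fun x => g (y - x) * (ct (wsum r N m w A0 0 0) x + st (wsum r N m w B0 0 0) x))); last first.
  by move=> x; rewrite /h pertE.
rewrite conv_ct_st//; last 2 first.
- by apply: iw => k x; exact: cvg_cst.
- by apply: iw => k x; exact: cvg_cst.
congr (_ + _); [apply: eq_ct|apply: eq_st] => v.
  rewrite /wsum !mulr_suml -sumrB; apply: eq_bigr => k _.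
  rewrite /win /cut; case: ifP => _; last by rewrite !mul0r subr0.
  by rewrite /A /A0 /B0 /gr /gi !derive1n0; ring.
rewrite /wsum !mulr_suml -big_split; apply: eq_bigr => k _.
rewrite /win /cut; case: ifP => _ /=; last by rewrite !mul0r addr0.
by rewrite /B /A0 /B0 /gr /gi !derive1n0; ring.
Qed.

End chi2.

(** * The risk bound for one window system *)

Section powers.
Context (R : realType).
Implicit Types (x y m u v c : R).

Lemma powR_exp2 x c : 0 <= x -> (x ^+ 2) `^ c = x `^ (2 * c).
Proof. by move=> x0; rewrite -powR_mulrn// -powRrM. Qed.

Lemma powR_decay m x c : 0 <= c -> 1 <= m -> m <= x ->
  (x ^+ 2 + 1) `^ (- (c / 2)) <= m `^ (- c).
Proof.
move=> c0 m1 mx; have m0 : 0 < m by apply: lt_le_trans m1.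
have -> : m `^ (- c) = (m ^+ 2) `^ (- (c / 2)).
  by rewrite powR_exp2 ?(ltW m0)//; congr (_ `^ _); field.
rewrite !powRN lef_pV2 ?posrE ?powR_gt0 ?exprn_gt0//; last first.
  by rewrite ltr_pwDr// sqr_ge0.
apply: ge0_ler_powR; rewrite ?nnegrE ?sqr_ge0 ?divr_ge0//.
  by rewrite addr_ge0// sqr_ge0.
apply: (@le_trans _ _ (x ^+ 2)); last by rewrite lerDl.
by apply: lerXn2r => //; rewrite nnegrE; [exact: ltW|exact: le_trans (ltW m0) mx].
Qed.

Lemma powR_growth m x c : 0 <= c -> 1 <= m -> 0 <= x -> x <= 2 * m ->
  5 `^ (- (c / 2)) * m `^ (- c) <= (x ^+ 2 + 1) `^ (- (c / 2)).
Proof.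
move=> c0 m1 x0 mx; have m0 : 0 < m by apply: lt_le_trans m1.
have -> : m `^ (- c) = (m ^+ 2) `^ (- (c / 2)).
  by rewrite powR_exp2 ?(ltW m0)//; congr (_ `^ _); field.
rewrite -powRM ?sqr_ge0//.
have p1 : 0 < x ^+ 2 + 1 by rewrite ltr_pwDr// sqr_ge0.
have p2 : 0 < 5 * m ^+ 2 by rewrite mulr_gt0// exprn_gt0.
rewrite !powRN lef_pV2 ?posrE ?powR_gt0//.
apply: ge0_ler_powR; rewrite ?nnegrE ?divr_ge0 ?(ltW p1) ?(ltW p2)//.
have h1 : x ^+ 2 <= 4 * m ^+ 2.
  rewrite (_ : 4 * m ^+ 2 = (2 * m) ^+ 2); last by ring.
  by apply: lerXn2r => //; rewrite nnegrE mulr_ge0// ltW.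
have h2 : 1 <= m ^+ 2 by apply: exprn_ege1.
by clear -h1 h2; lra.
Qed.

Lemma mixed_exp u v (i j K : nat) : 1 <= u -> 1 <= v -> (i + j <= K)%N ->
  u ^+ i * v ^+ j <= u ^+ K + v ^+ K.
Proof.
move=> u1 v1 ijK; have u0 : 0 <= u by apply: le_trans u1.
have v0 : 0 <= v by apply: le_trans v1.
have [uv|vu] := leP u v.
  apply: (@le_trans _ _ (v ^+ K)); last by rewrite lerDr exprn_ge0.
  apply: le_trans (_ : v ^+ i * v ^+ j <= _).
    by apply: ler_wpM2r; [exact: exprn_ge0|apply: lerXn2r].
  by rewrite -exprD ler_weXn2l.
apply: (@le_trans _ _ (u ^+ K)); last by rewrite lerDl exprn_ge0.
apply: le_trans (_ : u ^+ i * u ^+ j <= _).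
  by apply: ler_wpM2l; [exact: exprn_ge0|apply: lerXn2r => //; exact: ltW].
by rewrite -exprD ler_weXn2l.
Qed.

End powers.

Section noise.
Context (R : realType).
Notation leb := (@lebesgue_measure R).

Lemma pdf_not_bounded_below (g : pdf R) (c : R) : 0 < c -> ~ (forall x, c <= g x).
Proof.
move=> c0 h; have [ig Ig] := intg_pdf g.
have p : 0 <= 2 / c by rewrite divr_ge0// ltW.
have := le_Rint (intgZ c (intg_cut1 0 (2 / c))) ig _.
rewrite Ig RintZ; last exact: intg_cut1.
rewrite Rint_cut1// subr0 (mulrC c) divfK ?gt_eqF// => H.
suff : (2 : R) <= 1 by rewrite leNgt ltr1n.
apply: H => x; rewrite /cut; case: ifP => _; first by rewrite mulr1.
by rewrite mulr0 pdf_ge0.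
Qed.

(** For K = 0 the density g would be bounded below by a positive constant and could not be
    integrable. The conclusion 0 < K makes the bound on the first derivative of the phase
    available. *)
Lemma noise_lower (g : pdf R) (c1 varsigma : R) (K : nat) : 0 < c1 ->
  (forall x, c1 * (x ^+ 2 + 1) `^ (- varsigma) <= `|g x|) ->
  Num.ceil varsigma = K%:Z ->
  (forall x, c1 <= g x * (1 + x ^+ 2) ^+ K) /\ (0 < K)%N.
Proof.
move=> c10 hg hK; have h x : c1 <= g x * (1 + x ^+ 2) ^+ K.
  have p1 : 1 <= 1 + x ^+ 2 by rewrite lerDl sqr_ge0.
  have p0 : 0 < 1 + x ^+ 2 by apply: lt_le_trans p1.
  have vK : varsigma <= K%:R by rewrite -[K%:R]/(K%:Z%:~R) -hK ceil_ge.
  have := hg x; rewrite ger0_norm ?pdf_ge0// addrC powRN => H.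
  rewrite -ler_pdivrMr ?exprn_gt0//; apply: le_trans H.
  rewrite ler_pM2l// lef_pV2 ?posrE ?powR_gt0 ?exprn_gt0// -(powR_mulrn K (ltW p0)).
  exact: ler_powR.
split => //; rewrite lt0n; apply/eqP => K0.
by apply: (@pdf_not_bounded_below g c1 c10) => x; have := h x; rewrite K0 expr0 mulr1.
Qed.

(** Putting i derivatives on the bump and j on the transform of g costs w^-i m^(tau j); as i + j <=
    K and both w^-1 and m^tau are at least 1, [mixed_exp] leaves only the two extreme terms. The
    base 3 comes from 1 + x <= 3 m on the windows. *)
Lemma noise_derivative (g : pdf R) (K : nat) (Cg2 alpha beta gamma c2 tau : R) :
  0 < Cg2 -> 0 <= alpha -> 0 <= beta -> 0 <= gamma -> 0 < c2 -> 0 <= tau ->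
  (forall w, ComplexField.Normc.normc (fourier g w) <=
     Cg2 * (w ^+ 2 + 1) `^ (- (alpha / 2)) * expR (- (gamma * `|w| `^ beta))) ->
  (forall l : nat, (1 <= l <= K)%N -> forall w,
     ComplexField.Normc.normc (cderiv1n l (fourier g) w) <=
     c2 * ComplexField.Normc.normc (fourier g w) * (1 + `|w|) `^ (tau * l%:R)) ->
  exists2 S : R, 0 < S & forall w m i j x, 0 < w -> w <= 1 -> 1 <= m ->
    (i + j <= K)%N -> m <= x <= 2 * m ->
    w ^- i * ComplexField.Normc.normc (cderiv1n j (fourier g) x) <=
    S * (w ^- K + m `^ (tau * K%:R)) * (m `^ (- alpha) * expR (- (gamma * m `^ beta))).
Proof.
move=> C0 al0 be0 ga0 c20 tau0 hg hd.
exists ((1 + c2) * 3 `^ (tau * K%:R) * Cg2).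
  by rewrite mulr_gt0// mulr_gt0 ?powR_gt0// addr_gt0.
move=> w m i j x w0 w1 m1 ijK /andP[mx xm].
have m0 : 0 < m by apply: lt_le_trans m1.
have x0 : 0 < x by apply: lt_le_trans mx.
have jK : (j <= K)%N by apply: leq_trans ijK; exact: leq_addl.
set nf := ComplexField.Normc.normc (fourier g x).
have nf0 : 0 <= nf by rewrite /nf; case: (fourier g x) => ? ? /=; exact: sqrtr_ge0.
have nfB : nf <= Cg2 * (m `^ (- alpha) * expR (- (gamma * m `^ beta))).
  apply: le_trans (hg x) _; rewrite -mulrA; apply: ler_wpM2l (ltW C0) _ _ _.
  apply: ler_pM; rewrite ?powR_ge0 ?expR_ge0//; first exact: powR_decay.
  rewrite ler_expR lerN2 gtr0_norm//; apply: ler_wpM2l => //.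
  by apply: ge0_ler_powR; rewrite ?nnegrE ?(ltW m0) ?(ltW x0).
have p3 : 1 <= 3 `^ (tau * K%:R) :> R.
  by rewrite -[leLHS](powRr0 3); apply: ler_powR; [rewrite ler1n|rewrite mulr_ge0].
have dB : ComplexField.Normc.normc (cderiv1n j (fourier g) x) <=
    (1 + c2) * 3 `^ (tau * K%:R) * (m `^ tau) ^+ j * nf.
  case: j jK {ijK} => [|j] jK.
    rewrite expr0 mulr1 -[leLHS]mul1r; apply: ler_wpM2r => //.
    by rewrite -[leLHS]mul1r; apply: ler_pM => //; rewrite lerDl ltW.
  apply: le_trans (hd j.+1 _ x) _; first by rewrite jK.
  rewrite -/nf [leLHS]mulrAC; apply: ler_wpM2r => //.
  rewrite -mulrA; apply: ler_pM; [exact: ltW|exact: powR_ge0|by rewrite lerDr|].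
  have tj : 0 <= tau * j.+1%:R by rewrite mulr_ge0.
  apply: (@le_trans _ _ ((3 * m) `^ (tau * j.+1%:R))).
    apply: ge0_ler_powR; rewrite ?nnegrE ?addr_ge0 ?mulr_ge0 ?(ltW m0)//.
    by rewrite gtr0_norm//; clear -xm m1; lra.
  rewrite powRM ?(ltW m0)// (powRrM m) powR_mulrn ?powR_ge0//.
  apply: ler_wpM2r; first by rewrite exprn_ge0 ?powR_ge0.
  by apply: ler_powR; [rewrite ler1n|apply: ler_wpM2l => //; rewrite ler_nat].
have u1 : 1 <= w^-1 by rewrite invf_ge1.
have v1 : 1 <= m `^ tau by rewrite -[leLHS](powRr0 m); apply: ler_powR.
have mix := mixed_exp u1 v1 ijK.
rewrite -(powR_mulrn K (powR_ge0 m tau)) -powRrM !exprVn in mix.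
rewrite -exprVn.
apply: le_trans (ler_wpM2l _ dB) _; first by rewrite exprn_ge0// invr_ge0 ltW.
set T := (1 + c2) * 3 `^ _ in dB *.
have T0 : 0 <= T by rewrite mulr_ge0 ?powR_ge0// addr_ge0// ltW.
rewrite exprVn (_ : _ * (T * _ * nf) = T * (w ^- i * (m `^ tau) ^+ j) * nf); last first.
  by move: (w ^- i) ((m `^ tau) ^+ j) => *; ring.
rewrite (_ : T * Cg2 * _ * _ = T * (w ^- K + m `^ (tau * K%:R)) * (Cg2 * (m `^ (- alpha) * expR (- (gamma * m `^ beta))))); last first.
  by move: (w ^- K) (m `^ _) (m `^ _) (expR _) => *; ring.
apply: ler_pM => //; last exact: ler_wpM2l.
apply: mulr_ge0 => //; apply: mulr_ge0; last by rewrite exprn_ge0// powR_ge0.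
by rewrite invr_ge0 exprn_ge0// ltW.
Qed.

End noise.

Lemma half_slope (R : realType) (rb w : R) : 0 < w -> w * (2 * (1 + rb)) <= 1 -> rb * w <= 1 / 2.
Proof. by move=> w0 h; lra. Qed.

Section risk.
Context (R : realType) (nu s B : R) (mu : nat -> {i01 R})
  (g : pdf R) (c1 varsigma : R) (varsigma0 : nat)
  (phi : R -> R) (phis : R -> R[i])
  (Cg2 Cphi1 alpha beta gamma a b d : R) (c2 tau : R)
  (omega0 : R) (rho : R -> R) (rhobar : R).
Hypotheses (hs : 0 <= s) (hB : 0 < B)
  (hmu : forall n : nat, (0 < n)%N -> (mu n)%:num = n%:R `^ (nu - 1))
  (hphi : is_fourier phi phis)
  (hparseval : forall f0 : pdf R, Omega s B f0 -> parseval_at phi phis f0)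
  (hgbounded : exists M : R, forall x, g x <= M)
  (hc1 : 0 < c1)
  (hglower : forall x, c1 * (x ^+ 2 + 1) `^ (- varsigma) <= `|g x|)
  (hvarsigma0 : Num.ceil varsigma = varsigma0%:Z)
  (hCg2 : 0 < Cg2) (hCphi1 : 0 < Cphi1)
  (halpha : 0 <= alpha) (hbeta : 0 <= beta) (hgamma : 0 <= gamma)
  (ha : 0 <= a) (hb : 0 <= b) (hd : 0 <= d)
  (hgs : forall w, ComplexField.Normc.normc (fourier g w) <=
     Cg2 * (w ^+ 2 + 1) `^ (- (alpha / 2)) * expR (- (gamma * `|w| `^ beta)))
  (hphis : forall w,
     Cphi1 * (w ^+ 2 + 1) `^ (- (a / 2)) * expR (- (d * `|w| `^ b)) <=
     ComplexField.Normc.normc (phis w))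
  (hgsCk_Re : Ck_on varsigma0 setT (fun w => complex.Re (fourier g w)))
  (hgsCk_Im : Ck_on varsigma0 setT (fun w => complex.Im (fourier g w)))
  (hc2 : 0 < c2) (htau : 0 <= tau)
  (hgsderiv : forall l : nat, (1 <= l <= varsigma0)%N -> forall w,
     ComplexField.Normc.normc (cderiv1n l (fourier g) w) <=
     c2 * ComplexField.Normc.normc (fourier g w) *
       (1 + `|w|) `^ (tau * l%:R))
  (homega0 : 0 < omega0)
  (harg : forall w, omega0 <= `|w| ->
     phis w = (ComplexField.Normc.normc (phis w))%:C%C *
              (cos (rho w) +i* sin (rho w))%C)
  (hrhoCk : Ck_on varsigma0 [set w | omega0 <= `|w|] rho)
  (hrhobound : forall (j : nat) w, (j <= varsigma0)%N -> omega0 <= `|w| ->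
     `|derive1n j rho w| <= rhobar).

Local Notation K := varsigma0.

(** The analysis is summarized as inequalities between N, w, m and dl, leaving only their choice. D
    is the tolerated growth of y^b over the windows; it costs a factor exp(-d D) in the
    separation. *)
Lemma risk_lower : exists w0 k c : R, [/\ 0 < w0 <= 1, 0 < k, 0 < c &
  forall n N w m dl D, (0 < n)%N -> (mu n)%:num <= 1 / 2 ->
    0 < w -> w <= w0 -> 1 <= m -> omega0 <= m -> 0 <= dl -> 2 * N%:R * w <= m ->
    dl ^+ 2 * (N%:R * w) * m `^ (2 * s) <= k ->
    dl * N%:R <= k \/ (s <= 1 /\ dl ^+ 2 * N%:R <= k * w) ->
    n%:R * (mu n)%:num ^+ 2 * (dl ^+ 2 * (N%:R * w) *
      (w ^- varsigma0 + m `^ (tau * varsigma0%:R)) ^+ 2 *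
      (m `^ (- alpha) * expR (- (gamma * m `^ beta))) ^+ 2) <= k ->
    (forall y, m <= y <= m + 2 * N%:R * w -> y `^ b <= m `^ b + D) ->
    ((c * (dl * (N%:R * w) * (m `^ (- a) * expR (- (d * (m `^ b + D))))) ^+ 2)%:E <=
      minimax_risk g phi (Omega s B) (mu n) n)%E].
Proof.
have [gK K0] := noise_lower hc1 hglower hvarsigma0.
pose r := K.+2; have r1 : (1 < r)%N by []. have Kr : (K < r)%N by rewrite /r ltnW.
have [M M1 hM] := bump_bounded R r K.
have [S1 S10 hS] := noise_derivative hCg2 halpha hbeta hgamma hc2 htau hgs hgsderiv.
have [w0 [kp [w00 w01 kp0 hpdf]]] := pert_pdfs r1 hs hB.
have rb0 : 0 <= rhobar.
  by apply: le_trans (normr_ge0 _) (@hrhobound 0 omega0 _ _) => //; rewrite ger0_norm// ltW.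
have pi0 := @pi_gt0 R.
pose C1 := 4 / c1 * (4 * (5 ^+ K * (2 * pi * ((2 * M * S1) ^+ 2 * 2)))).
have M0 : 0 < M by apply: lt_le_trans M1.
have C10 : 0 < C1.
  apply: mulr_gt0; first by apply: divr_gt0.
  apply: mulr_gt0 => //; apply: mulr_gt0; first by rewrite exprn_gt0.
  by apply: mulr_gt0; [exact: mulr_gt0|apply: mulr_gt0 => //; rewrite exprn_gt0// !mulr_gt0].
(* The second bound makes the phase vary by at most 1/2 over half a window. *)
pose w2 := Num.min w0 (2 * (1 + rhobar))^-1.
have rb1 : 0 < 2 * (1 + rhobar) by rewrite mulr_gt0// ltr_pwDl.
(* The factor 5 meets the threshold 1/5 of [minimax_risk_two_point]; C1 collects the constants of
   the chi-square bound. *)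
pose k := Num.min kp (5 * C1)^-1.
pose L0 := Cphi1 * 5 `^ (- (a / 2)).
have L00 : 0 < L0 by rewrite mulr_gt0 ?powR_gt0.
pose c := ((1 / 2) ^+ r.+1 * L0) ^+ 2 / 8.
have c0 : 0 < c by rewrite divr_gt0// exprn_gt0// mulr_gt0// exprn_gt0// divr_gt0.
exists w2, k, c; split => //.
- apply/andP; split; first by rewrite lt_min w00 invr_gt0.
  by rewrite ge_min w01.
- by rewrite lt_min kp0 invr_gt0 mulr_gt0.
move=> n N w m dl D n0 mu2 w_0 ww2 m1 om dl0 mN h1 h2 h3 hD.
have ww0 : w <= w0 by apply: le_trans ww2 _; rewrite ge_min lexx.
have rw : rhobar * w <= 1 / 2.
  have : w <= (2 * (1 + rhobar))^-1 by apply: le_trans ww2 _; rewrite ge_min lexx orbT.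
  rewrite -[X in _ <= X]div1r ler_pdivlMr// => h.
  exact: half_slope.
have w1 : w <= 1 by apply: le_trans ww0 w01.
have kkp : k <= kp by rewrite ge_min lexx.
have kC : k <= (5 * C1)^-1 by rewrite ge_min lexx orbT.
have h2' : dl * N%:R <= kp \/ (s <= 1 /\ dl ^+ 2 * N%:R <= kp * w).
  case: h2 => [h|[s1 h]]; first by left; exact: le_trans kkp.
  by right; split => //; apply: le_trans h _; apply: ler_wpM2r => //; exact: ltW.
pose p j := rho (ctr m w j).
have [f1 [f2 [Om1 Om2 fE]]] := hpdf N w m dl p w_0 ww0 m1 dl0 mN (le_trans h1 kkp) h2'.
have m0 : 0 < m by apply: lt_le_trans m1.
have xm x : m <= x -> omega0 <= `|x|.
  by move=> mx; rewrite (le_trans om)// (le_trans mx)// ler_norm.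
have drho x : m <= x -> derivable rho x 1.
  by move=> mx; have [/(_ 0%N K0)] := hrhoCk (xm x mx).
have rhoC x : m <= x -> `|derive1 rho x| <= rhobar.
  by move=> mx; have := hrhobound (j := 1) K0 (xm x mx).
have harg' x : m <= x -> phis x = (ComplexField.Normc.normc (phis x))%:C%C *
    (cos (rho x) +i* sin (rho x))%C by move=> mx; apply: harg; exact: xm.
pose L := L0 * (m `^ (- a) * expR (- (d * (m `^ b + D)))).
have L_0 : 0 <= L by rewrite mulr_ge0 ?(ltW L00)// mulr_ge0 ?powR_ge0 ?expR_ge0.
have Nw0 : 0 <= 2 * N%:R * w by rewrite mulr_ge0 ?mulr_ge0// ltW.
have hL y : m <= y <= m + 2 * N%:R * w -> L <= ComplexField.Normc.normc (phis y).
  move=> yy; have /andP[my ym] := yy; have y0 : 0 < y by apply: lt_le_trans my.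
  apply: le_trans (hphis y); rewrite /L /L0 gtr0_norm//.
  rewrite (_ : _ * _ = Cphi1 * (5 `^ (- (a / 2)) * m `^ (- a)) * expR (- (d * (m `^ b + D)))); last first.
    by rewrite !mulrA.
  apply: ler_pM; rewrite ?expR_ge0//.
  - by rewrite mulr_ge0 ?(ltW hCphi1)// mulr_ge0 ?powR_ge0.
  - apply: ler_wpM2l; first exact: ltW.
    apply: powR_growth => //; first exact: ltW.
    by apply: le_trans ym _; rewrite (mulr_natl m 2) mulr2n lerD2l.
  - by rewrite ler_expR lerN2; apply: ler_wpM2l => //; exact: hD.
have PP := Phi_pert hphi (hparseval Om1) (hparseval Om2) harg' drho rhoC r1 w_0 m1 dl0 rw L_0 hL fE.
set Q := (m `^ (- alpha) * _) in h3; set T := (_ + _) in h3.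
have Q0 : 0 <= Q by rewrite mulr_ge0 ?powR_ge0 ?expR_ge0.
have T0 : 0 <= T by rewrite addr_ge0 ?powR_ge0// invr_ge0 exprn_ge0// ltW.
have S0 : 0 <= S1 * T * Q by rewrite mulr_ge0// mulr_ge0// ltW.
have [iV hV] := pert_conv p Kr r1 w_0 m1 dl0 M1 S0 hM mN hgsCk_Re hgsCk_Im
  (fun i j x ij xx => hS w m i j x w_0 w1 m1 ij xx).
have ih := intg_pert r1 w_0 N m dl p.
have chi := chi2_bound hgbounded hc1 gK mu2 ih fE iV hV.
have g0 x : 0 < g x.
  have := lt_le_trans hc1 (gK x); rewrite pmulr_lgt0// exprn_gt0//.
  by rewrite ltr_pwDl ?sqr_ge0.
have mu1 : (mu n)%:num < 1.
  by apply: le_lt_trans mu2 _; rewrite ltr_pdivrMr// mul1r ltr1n.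
set cc := (X in (_ <= X%:E)%E) in chi.
have ccE : n%:R * cc = C1 * (n%:R * (mu n)%:num ^+ 2 * (dl ^+ 2 * (N%:R * w) * T ^+ 2 * Q ^+ 2)).
  rewrite /cc /C1; have : c1 != 0 by rewrite gt_eqF.
  move: (mu n)%:num (5 ^+ K) pi => u v q c1n.
  by clearbody T Q; move: (N%:R : R) (n%:R : R) => *; field.
have cc0 : 0 <= cc.
  apply: mulr_ge0; first by rewrite divr_ge0 ?(ltW hc1)// mulr_ge0// sqr_ge0.
  apply: mulr_ge0 => //; apply: mulr_ge0; first by rewrite exprn_ge0.
  apply: mulr_ge0; first by rewrite mulr_ge0// ltW.
  by apply: mulr_ge0; rewrite ?sqr_ge0.
have ncc : n%:R * cc <= 1 / 5.
  rewrite ccE mulrC -ler_pdivlMr//; apply: le_trans h3 (le_trans kC _).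
  by rewrite invfM div1r.
have := minimax_risk_two_point hgbounded g0 mu1 phi n0 Om1 Om2 cc0 ncc chi.
apply: le_trans; rewrite lee_fin /c mulrAC; apply: ler_wpM2r; first by rewrite invr_ge0.
rewrite -exprMn; set z := _ * (dl * _ * _).
have zE : z = (1 / 2) ^+ r.+1 * (dl * (N%:R * w) * L) by rewrite /z /L; ring.
have z0 : 0 <= z.
  rewrite zE; apply: mulr_ge0; first by rewrite exprn_ge0// divr_ge0.
  by apply: mulr_ge0 => //; rewrite mulr_ge0// mulr_ge0// ltW.
rewrite -zE in PP.
by apply: lerXn2r; rewrite ?nnegrE// (le_trans z0 PP).
Qed.

End risk.

(** * Choice of the frequency *)

Section powers2.
Context (R : realType).
Implicit Types (x y m t b z : R).

Lemma gt0_powRD m x y : 0 < m -> m `^ (x + y) = m `^ x * m `^ y.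
Proof. by move=> m0; rewrite powRD// (gt_eqF m0) implybT. Qed.

Lemma powR_exprn m x n : 0 < m -> (m `^ x) ^+ n = m `^ (x * n%:R).
Proof. by move=> m0; rewrite powRrM powR_mulrn// powR_ge0. Qed.

Lemma powR_1Dx b t : 0 <= b -> 0 <= t <= 1 -> (1 + t) `^ b <= 1 + b * 2 `^ b * t.
Proof.
move=> b0 /andP[t0 t1]; have p : 0 < 1 + t by rewrite ltr_pwDl.
have h1 : (1 + t) `^ b <= 2 `^ b.
  by apply: ge0_ler_powR; rewrite ?nnegrE ?(ltW p)//; lra.
have h2 : 0 <= b * ln (1 + t) <= b * t.
  rewrite mulr_ge0 ?ln_ge0 ?lerDl//=; apply: ler_wpM2l => //.
  by apply: le_ln1Dx; rewrite (lt_le_trans _ t0)// oppr_lt0.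
have e : (1 + t) `^ b = expR (b * ln (1 + t)) by rewrite /powR gt_eqF.
set x := b * _ in h2 e; clearbody x; have /andP[x0 xt] := h2.
have h3 : 1 - x <= expR (- x) by exact: expR_ge1Dx.
have h4 : expR x <= 1 + x * expR x.
  have := ler_wpM2r (expR_ge0 x) h3; rewrite -expRD addNr expR0 mulrBl mul1r.
  by rewrite lerBlDr.
rewrite e; apply: le_trans h4 _; rewrite lerD2l -e mulrAC; apply: ler_pM => //.
exact: powR_ge0.
Qed.

Lemma ln_le_powR x t : 0 < x -> 0 < t -> ln x <= t^-1 * x `^ t.
Proof.
move=> x0 t0; have -> : ln x = t^-1 * ln (x `^ t) by rewrite ln_powR mulrA mulVf ?gt_eqF// mul1r.
apply: ler_wpM2l; first by rewrite invr_ge0 ltW.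
have p : 0 < x `^ t by rewrite powR_gt0.
have h := @le_ln1Dx R (x `^ t - 1).
rewrite (_ : 1 + (x `^ t - 1) = x `^ t) in h; last by ring.
by apply: le_trans (h _) _; rewrite ?gerBl// ltrBrDl subrr.
Qed.

End powers2.

Section nonparametric.
Context (R : realType) (rk : nat -> \bar R) (X : nat -> R) (ok : nat -> Prop)
  (w0 k c s alpha beta gamma a b d tau omega0 : R) (K : nat).
Hypotheses (w00 : 0 < w0) (k0 : 0 < k) (c0 : 0 < c) (s0 : 0 <= s)
  (b0 : 0 <= b) (d0 : 0 <= d) (tau0 : 0 <= tau).
Hypothesis X0 : forall n, 0 <= X n.
Hypothesis RL : forall n N w m dl D, ok n ->
    0 < w -> w <= w0 -> 1 <= m -> omega0 <= m -> 0 <= dl -> 2 * N%:R * w <= m ->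
    dl ^+ 2 * (N%:R * w) * m `^ (2 * s) <= k ->
    dl * N%:R <= k \/ (s <= 1 /\ dl ^+ 2 * N%:R <= k * w) ->
    X n * (dl ^+ 2 * (N%:R * w) * (w ^- K + m `^ (tau * K%:R)) ^+ 2 *
      (m `^ (- alpha) * expR (- (gamma * m `^ beta))) ^+ 2) <= k ->
    (forall y, m <= y <= m + 2 * N%:R * w -> y `^ b <= m `^ b + D) ->
    ((c * (dl * (N%:R * w) * (m `^ (- a) * expR (- (d * (m `^ b + D))))) ^+ 2)%:E <= rk n)%E.

(* About m^f windows of width about m^-e are used; as f - e = 1 - b, the function
   y^b varies by a bounded amount over their union. *)
Let e := Num.max 0 (b - 1).
Let f := Num.max 0 (1 - b).
(** The order in m of the factor from differentiation, w^-K + m^(tau K). *)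
Let h := Num.max e tau * K%:R.

Lemma width_exponents : [/\ 0 <= e, 0 <= f, f - e = 1 - b & e = 0 \/ f = 0].
Proof.
rewrite /e /f; have [b1|b1] := leP b 1.
  have h1 : b - 1 <= 0 by rewrite subr_le0.
  have h2 : 0 <= 1 - b by rewrite subr_ge0.
  by rewrite (max_l h1) (max_r h2) subr0; split => //; left.
have h1 : 0 <= b - 1 by rewrite subr_ge0 ltW.
have h2 : 1 - b <= 0 by rewrite subr_le0 ltW.
by rewrite (max_r h1) (max_l h2) sub0r opprB; split => //; right.
Qed.

(** With N, w and dl expressed by powers of m, everything but the chi-square condition holds for all
    large m. What remains is one condition relating m to X n, which stands for n mu_n^2, and the
    resulting bound on the risk. *)
Lemma nonparametric_bound : exists k' C M0 : R, [/\ 0 < k', 0 < C, 1 <= M0 &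
  forall n m, ok n -> M0 <= m ->
  X n * (m `^ (- 2 * s - 2 * alpha + 2 * h - e) * expR (- (2 * gamma * m `^ beta))) <= k' ->
  ((C * (m `^ (- 2 * s - 2 * a + f - 2 * e) * expR (- (2 * d * m `^ b))))%:E <= rk n)%E].
Proof.
have [e0 f0 fe eof] := width_exponents.
pose w1 := Num.min w0 (1 / 2).
have w10 : 0 < w1 by rewrite lt_min w00 divr_gt0.
have w1w : w1 <= w0 by rewrite ge_min lexx.
have w12 : 2 * w1 <= 1.
  by rewrite mulrC -ler_pdivlMr// ge_min lexx orbT.
have w11 : w1 <= 1 by apply: le_trans w12; rewrite ler_peMl ?ler1n// ltW.
pose eps := Num.min 1 (k * w1).
have e1 : eps <= 1 by rewrite ge_min lexx.
have ek : eps <= k * w1 by rewrite ge_min lexx orbT.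
have ep0 : 0 < eps by rewrite lt_min ltr01 mulr_gt0.
have e2 : eps ^+ 2 <= k * w1.
  by apply: le_trans ek; rewrite expr2 ler_piMl// ltW.
have kw1 : k * w1 <= k by rewrite ler_piMr// ltW.
pose CT := (w1 ^- K + 1) ^+ 2.
have CT0 : 0 < CT by rewrite exprn_gt0// ltr_pwDr// invr_ge0 exprn_ge0// ltW.
pose D := b * 2 `^ b * (2 * w1).
have D0 : 0 <= D by rewrite !mulr_ge0 ?powR_ge0 ?(ltW w10).
pose M0 := Num.max 1 omega0.
exists (k / (eps ^+ 2 * w1 * CT)), (c * (eps ^+ 2 * w1 ^+ 2 / 2 * expR (- (2 * d * D)))), M0.
split.
- by rewrite divr_gt0// mulr_gt0// mulr_gt0// exprn_gt0.
- by rewrite mulr_gt0// mulr_gt0 ?expR_gt0// divr_gt0// mulr_gt0// exprn_gt0.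
- by rewrite le_max lexx.
move=> n m okn mM hX.
have m1 : 1 <= m by apply: le_trans mM; rewrite le_max lexx.
have mo : omega0 <= m by apply: le_trans mM; rewrite le_max lexx orbT.
have m0 : 0 < m by apply: lt_le_trans m1.
have pge x : 0 <= x -> 1 <= m `^ x.
  by move=> x0; rewrite -[leLHS](powRr0 m); apply: ler_powR.
have ple x : x <= 0 -> m `^ x <= 1.
  by move=> x0; rewrite -[leRHS](powRr0 m); apply: ler_powR.
have pgt x : 0 < m `^ x by exact: powR_gt0.
pose N := Num.truncn (m `^ f).
have Nf : N%:R <= m `^ f by rewrite truncn_le powR_ge0.
have fN : m `^ f < N.+1%:R by rewrite -truncn_le_nat.
have N1 : (0 < N)%N by rewrite truncn_gt0 pge.
have NR0 : 0 < N%:R :> R by rewrite ltr0n.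
have N2 : m `^ f / 2 <= N%:R.
  rewrite ler_pdivrMr//; apply: le_trans (ltW fN) _.
  by rewrite -natrM ler_nat muln2 -addnn -addn1 leq_add2l.
pose w := w1 * m `^ (- e).
have w_0 : 0 < w by rewrite mulr_gt0.
have ww1 : w <= w1 by rewrite ler_piMr ?(ltW w10)// ple// oppr_le0.
have Nw : N%:R * w <= w1 * m `^ (1 - b).
  rewrite mulrCA; apply: ler_wpM2l; first exact: ltW.
  by rewrite -fe gt0_powRD//; apply: ler_wpM2r Nf; exact: ltW.
have mb : m `^ (1 - b) = m * m `^ (- b) by rewrite gt0_powRD// powRr1// ltW.
have mb1 : m `^ (- b) <= 1 by rewrite ple// oppr_le0.
have Nwm : 2 * N%:R * w <= 2 * w1 * (m * m `^ (- b)).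
  by rewrite -mulrA -[leRHS]mulrA; apply: ler_wpM2l => //; rewrite -mb.
have mN : 2 * N%:R * w <= m.
  apply: le_trans Nwm _; rewrite mulrCA ler_piMr ?(ltW m0)// mulr_ile1 ?(ltW (pgt _))//.
  by rewrite mulr_ge0// ltW.
(* Thus dl^2 N is of order m^(-2 s). Leaving the factor w out of this balance satisfies the Sobolev
   constraint and still allows positivity for b > 1, where w tends to 0. *)
pose dl := eps * m `^ (- s) * (Num.sqrt N%:R)^-1.
have dl0 : 0 <= dl by rewrite !mulr_ge0 ?invr_ge0 ?sqrtr_ge0 ?(ltW ep0) ?powR_ge0.
have dlN : dl ^+ 2 * N%:R = eps ^+ 2 * m `^ (- 2 * s).
  rewrite !exprMn exprVn sqr_sqrtr ?(ltW NR0)// divfK ?gt_eqF//.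
  by rewrite powR_exprn//; congr (_ * _ `^ _); rewrite mulrC mulrN mulNr.
have dlN1 : dl * N%:R = eps * (m `^ (- s) * Num.sqrt N%:R).
  have sN : N%:R = Num.sqrt N%:R ^+ 2 :> R by rewrite sqr_sqrtr// ltW.
  rewrite [in LHS]sN /dl; have : Num.sqrt N%:R != 0 :> R by rewrite gt_eqF// sqrtr_gt0.
  by move: (Num.sqrt _) (m `^ _) => q r q0; field.
have ms : m `^ (- 2 * s) * m `^ (2 * s) = 1.
  by rewrite -gt0_powRD// mulNr addNr powRr0.
have ms1 : m `^ (- 2 * s) <= 1 by rewrite ple// mulNr oppr_le0 mulr_ge0.
have H1 : dl ^+ 2 * (N%:R * w) * m `^ (2 * s) <= k.
  rewrite mulrA dlN (_ : _ * _ = eps ^+ 2 * w * (m `^ (- 2 * s) * m `^ (2 * s))); last first.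
    by move: (m `^ _) (m `^ _) => *; ring.
  rewrite ms mulr1; apply: le_trans kw1; apply: le_trans e2.
  by rewrite ler_piMr ?exprn_ge0 ?(ltW ep0)// (le_trans ww1).
(* If f = 0 then N <= 1 and dl N is small. If e = 0 the width is constant: for s <= 1 the second
   alternative holds, and for s > 1 the quantity m^-s N^(1/2) is at most m^((1 - b)/2 - s) <= 1. *)
have H2 : dl * N%:R <= k \/ (s <= 1 /\ dl ^+ 2 * N%:R <= k * w).
  have small : m `^ (- s) * Num.sqrt N%:R <= 1 -> dl * N%:R <= k.
    move=> z; rewrite dlN1; apply: le_trans kw1; apply: le_trans ek.
    by rewrite ler_piMr// ltW.
  case: eof => [ez|fz]; last first.
    left; apply: small; rewrite mulr_ile1 ?sqrtr_ge0 ?powR_ge0 ?ple ?oppr_le0//.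
    rewrite -[leRHS]sqrtr1; apply: ler_wsqrtr; apply: le_trans Nf _.
    by rewrite fz powRr0.
  have wz : w = w1 by rewrite /w ez oppr0 powRr0 mulr1.
  have [s1|s1] := leP s 1.
    right; split => //; rewrite dlN wz; apply: le_trans e2.
    by rewrite ler_piMr// exprn_ge0// ltW.
  left; apply: small.
  have sb : Num.sqrt N%:R <= m `^ (f / 2).
    rewrite -[leRHS]ger0_norm ?powR_ge0// -sqrtr_sqr; apply: ler_wsqrtr.
    by rewrite powR_exprn// divfK.
  apply: le_trans (ler_wpM2l _ sb) _; first exact: powR_ge0.
  rewrite -gt0_powRD//; apply: ple.
  have fz : f = 1 - b by rewrite -fe ez subr0.
  by rewrite fz; have := b0; have := s1; lra.
have mh : w ^- K + m `^ (tau * K%:R) <= (w1 ^- K + 1) * m `^ h.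
  have wK : w ^- K = w1 ^- K * m `^ (e * K%:R).
    by rewrite /w exprMn invfM powR_exprn// mulNr powRN invrK.
  rewrite wK mulrDl mul1r; apply: lerD.
    apply: ler_wpM2l; first by rewrite invr_ge0 exprn_ge0// ltW.
    by apply: ler_powR => //; apply: ler_wpM2r => //; rewrite le_max lexx.
  by apply: ler_powR => //; apply: ler_wpM2r => //; rewrite le_max lexx orbT.
have H3 : X n * (dl ^+ 2 * (N%:R * w) * (w ^- K + m `^ (tau * K%:R)) ^+ 2 *
      (m `^ (- alpha) * expR (- (gamma * m `^ beta))) ^+ 2) <= k.
  rewrite [dl ^+ 2 * (_ * _)]mulrA dlN.
  have mh2 : (w ^- K + m `^ (tau * K%:R)) ^+ 2 <= CT * m `^ (2 * h).
    apply: le_trans (_ : ((w1 ^- K + 1) * m `^ h) ^+ 2 <= _).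
      apply: lerXn2r => //; rewrite nnegrE.
        by rewrite addr_ge0 ?powR_ge0// invr_ge0 exprn_ge0// ltW.
      by rewrite mulr_ge0 ?powR_ge0// addr_ge0// invr_ge0 exprn_ge0// ltW.
    by rewrite exprMn powR_exprn// (mulrC h).
  set T2 := (_ + _) ^+ 2 in mh2 *.
  have Q2 : (m `^ (- alpha) * expR (- (gamma * m `^ beta))) ^+ 2 =
      m `^ (- 2 * alpha) * expR (- (2 * gamma * m `^ beta)).
    rewrite exprMn powR_exprn// -expRM_natl; congr (_ `^ _ * expR _); ring.
  rewrite Q2.
  apply: (@le_trans _ _ (eps ^+ 2 * w1 * CT *
    (X n * (m `^ (- 2 * s - 2 * alpha + 2 * h - e) * expR (- (2 * gamma * m `^ beta)))))); last first.
    by rewrite mulrC -ler_pdivlMr// mulr_gt0// mulr_gt0// exprn_gt0.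
  have pE : m `^ (- 2 * s - 2 * alpha + 2 * h - e) =
      m `^ (- 2 * s) * m `^ (- 2 * alpha) * m `^ (2 * h) * m `^ (- e).
    by rewrite -!gt0_powRD//; congr (_ `^ _); ring.
  rewrite pE /w; have := ler_wpM2l (X0 n) mh2.
  set p1 := m `^ (- 2 * s); set p2 := m `^ (2 * h); set p3 := m `^ (- 2 * alpha).
  set p4 := m `^ (- e); set E := expR _ => hh.
  have -> : X n * (eps ^+ 2 * p1 * (w1 * p4) * T2 * (p3 * E)) =
    (X n * T2) * (eps ^+ 2 * w1 * p1 * p3 * p4 * E) by ring.
  have -> : eps ^+ 2 * w1 * CT * (X n * (p1 * p3 * p2 * p4 * E)) =
    (X n * (CT * p2)) * (eps ^+ 2 * w1 * p1 * p3 * p4 * E) by ring.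
  apply: ler_wpM2r hh; rewrite !mulr_ge0 ?expR_ge0 ?(ltW (pgt _)) ?exprn_ge0 ?(ltW ep0) ?(ltW w10)//.
(* The windows end before m (1 + t) with t = 2 w1 m^-b, so y^b exceeds m^b by at most m^b b 2^b t,
   which no longer depends on m. *)
have H4 y : m <= y <= m + 2 * N%:R * w -> y `^ b <= m `^ b + D.
  move=> /andP[my ym].
  pose t := 2 * w1 * m `^ (- b).
  have t01 : 0 <= t <= 1.
    apply/andP; split; first by rewrite /t !mulr_ge0 ?powR_ge0// ltW.
    by apply: mulr_ile1 => //; [apply: mulr_ge0 => //; exact: ltW|exact: powR_ge0].
  have y0 : 0 <= y by apply: le_trans my; exact: ltW.
  have /andP[t0 t1] := t01.
  apply: (@le_trans _ _ ((m * (1 + t)) `^ b)).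
    apply: ge0_ler_powR; rewrite ?nnegrE//; first by rewrite mulr_ge0 ?(ltW m0)// addr_ge0.
    by apply: le_trans ym _; rewrite mulrDr mulr1 lerD2l [leRHS]mulrCA.
  rewrite powRM ?(ltW m0) ?addr_ge0//.
  apply: le_trans (ler_wpM2l _ (powR_1Dx b0 t01)) _; first exact: powR_ge0.
  rewrite mulrDr mulr1 lerD2l /t /D.
  have mbb : m `^ b * m `^ (- b) = 1 by rewrite -gt0_powRD// subrr powRr0.
  suff -> : m `^ b * (b * 2 `^ b * (2 * w1 * m `^ (- b))) =
    b * 2 `^ b * (2 * w1) * (m `^ b * m `^ (- b)) by rewrite mbb mulr1.
  by move: (m `^ b) (m `^ (- b)) (2 `^ b) => *; ring.
have ww0 : w <= w0 by apply: le_trans ww1 w1w.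
have := RL okn w_0 ww0 m1 mo dl0 mN H1 H2 H3 H4.
apply: le_trans; rewrite lee_fin -[leLHS]mulrA; apply: ler_wpM2l; first exact: ltW.
have dw : (dl * (N%:R * w)) ^+ 2 = eps ^+ 2 * m `^ (- 2 * s) * N%:R * w ^+ 2.
  by rewrite -dlN; ring.
rewrite [leRHS]exprMn [X in _ <= _ * X]exprMn dw.
have E2 : expR (- (d * (m `^ b + D))) ^+ 2 = expR (- (2 * d * m `^ b)) * expR (- (2 * d * D)).
  by rewrite -expRM_natl -expRD; congr expR; ring.
have A2 : (m `^ (- a)) ^+ 2 = m `^ (- 2 * a) by rewrite powR_exprn//; congr (_ `^ _); ring.
have W2 : w ^+ 2 = w1 ^+ 2 * m `^ (- 2 * e).
  by rewrite /w exprMn powR_exprn//; congr (_ * _ `^ _); ring.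
rewrite E2 A2 W2.
have pE : m `^ (- 2 * s - 2 * a + f - 2 * e) =
    m `^ (- 2 * s) * m `^ (- 2 * a) * m `^ f * m `^ (- 2 * e).
  by rewrite -!gt0_powRD//; congr (_ `^ _); ring.
rewrite pE.
have := ler_wpM2l (ltW (pgt (- 2 * s))) N2.
set p1 := m `^ (- 2 * s); set p2 := m `^ f; set p3 := m `^ (- 2 * a).
set p4 := m `^ (- 2 * e); set E := expR (- (2 * d * m `^ b)); set E' := expR (- (2 * d * D)) => hh.
have -> : eps ^+ 2 * w1 ^+ 2 / 2 * E' * (p1 * p3 * p2 * p4 * E) =
  (p1 * (p2 / 2)) * (eps ^+ 2 * w1 ^+ 2 * p3 * p4 * E * E').
  by field.
have -> : eps ^+ 2 * p1 * N%:R * (w1 ^+ 2 * p4) * (p3 * (E * E')) =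
  (p1 * N%:R) * (eps ^+ 2 * w1 ^+ 2 * p3 * p4 * E * E') by ring.
by apply: ler_wpM2r hh; rewrite !mulr_ge0 ?expR_ge0 ?(ltW (pgt _)) ?exprn_ge0 ?(ltW ep0) ?(ltW w10).
Qed.

(** One window at a fixed frequency: the chi-square condition only asks that dl^2 X n be small, so
    dl is a small multiple of (X n)^(-1/2) and the squared separation is of order 1 / X n. At fixed
    m the crude value D = (2 m)^b is good enough. *)
Lemma parametric_bound : exists2 C : R, 0 < C &
  forall n, ok n -> 1 <= X n -> ((C * (X n)^-1)%:E <= rk n)%E.
Proof.
pose w1 := Num.min w0 (1 / 2).
have w10 : 0 < w1 by rewrite lt_min w00 divr_gt0.
have w1w : w1 <= w0 by rewrite ge_min lexx.
have w12 : 2 * w1 <= 1.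
  by rewrite mulrC -ler_pdivlMr// ge_min lexx orbT.
pose m := Num.max 1 omega0.
have m1 : 1 <= m by rewrite le_max lexx.
have mo : omega0 <= m by rewrite le_max lexx orbT.
have m0 : 0 < m by apply: lt_le_trans m1.
pose Z1 := w1 * m `^ (2 * s).
pose Z2 := w1 * (w1 ^- K + m `^ (tau * K%:R)) ^+ 2 *
  (m `^ (- alpha) * expR (- (gamma * m `^ beta))) ^+ 2.
have Z10 : 0 <= Z1 by rewrite mulr_ge0 ?powR_ge0// ltW.
have Z20 : 0 <= Z2 by rewrite mulr_ge0 ?sqr_ge0// mulr_ge0 ?sqr_ge0// ltW.
have Z01 : 1 <= 1 + Z1 + Z2 by rewrite -addrA lerDl addr_ge0.
have Z0 : 0 < 1 + Z1 + Z2 by apply: lt_le_trans Z01.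
pose eps := Num.min 1 (k / (1 + Z1 + Z2)).
have ep0 : 0 < eps by rewrite lt_min ltr01 divr_gt0.
have ep1 : eps <= 1 by rewrite ge_min lexx.
have epk : eps * (1 + Z1 + Z2) <= k by rewrite -ler_pdivlMr// ge_min lexx orbT.
have ek : eps <= k by apply: le_trans epk; rewrite ler_peMr// ltW.
have e2 z : z <= 1 + Z1 + Z2 -> 0 <= z -> eps ^+ 2 * z <= k.
  move=> zZ z0; apply: le_trans epk; apply: ler_pM => //; first by rewrite sqr_ge0.
  by rewrite expr2 ler_piMl// ltW.
pose D := (2 * m) `^ b.
pose L := w1 * (m `^ (- a) * expR (- (d * (m `^ b + D)))).
have L0 : 0 < L by rewrite mulr_gt0// mulr_gt0 ?powR_gt0 ?expR_gt0.
exists (c * (eps ^+ 2 * L ^+ 2)); first by rewrite mulr_gt0// mulr_gt0// exprn_gt0.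
move=> n okn X1; have X_0 : 0 < X n by apply: lt_le_trans X1.
pose dl := eps * (Num.sqrt (X n))^-1.
have dl0 : 0 <= dl by rewrite mulr_ge0 ?invr_ge0 ?sqrtr_ge0 ?(ltW ep0).
have dl2 : dl ^+ 2 = eps ^+ 2 * (X n)^-1 by rewrite exprMn exprVn sqr_sqrtr// ltW.
have iX : (X n)^-1 <= 1 by rewrite invf_le1.
have dl2e : dl ^+ 2 <= eps ^+ 2 by rewrite dl2 ler_piMr// sqr_ge0.
have dle : dl <= eps.
  have s1 : 1 <= Num.sqrt (X n) by rewrite -sqrtr1 ler_wsqrtr.
  by rewrite ler_piMr ?(ltW ep0)// invf_le1// (lt_le_trans _ s1).
have mN : 2 * 1%:R * w1 <= m by rewrite mulr1; apply: le_trans w12 m1.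
have H1 : dl ^+ 2 * (1%:R * w1) * m `^ (2 * s) <= k.
  rewrite mul1r -mulrA -/Z1; apply: le_trans (e2 Z1 _ Z10); first exact: ler_wpM2r.
  by rewrite addrAC lerDr addr_ge0.
have H2 : dl * 1%:R <= k \/ (s <= 1 /\ dl ^+ 2 * 1%:R <= k * w1).
  by left; rewrite mulr1; exact: le_trans ek.
have H3 : X n * (dl ^+ 2 * (1%:R * w1) * (w1 ^- K + m `^ (tau * K%:R)) ^+ 2 *
      (m `^ (- alpha) * expR (- (gamma * m `^ beta))) ^+ 2) <= k.
  rewrite dl2 (_ : X n * _ = eps ^+ 2 * Z2 * (X n / X n)); last first.
    rewrite /Z2; set t := _ + _; set q := _ * expR _; clearbody t q.
    by move: (X n) (X n)^-1 => x y; ring.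
  rewrite divff ?gt_eqF// mulr1.
  by apply: e2 => //; rewrite lerDr addr_ge0.
have H4 y : m <= y <= m + 2 * 1%:R * w1 -> y `^ b <= m `^ b + D.
  move=> /andP[my ym]; apply: (@le_trans _ _ D); last by rewrite lerDr powR_ge0.
  have y0 : 0 <= y by apply: le_trans my; exact: ltW.
  apply: ge0_ler_powR; rewrite ?nnegrE ?mulr_ge0 ?(ltW m0)//.
  by apply: le_trans ym _; rewrite (mulr_natl m 2) mulr2n lerD2l.
have := RL okn w10 w1w m1 mo dl0 mN H1 H2 H3 H4.
apply: le_trans; rewrite lee_fin.
have -> : dl * (1%:R * w1) * (m `^ (- a) * expR (- (d * (m `^ b + D)))) = dl * L.
  by rewrite mul1r -mulrA.
have -> : (dl * L) ^+ 2 = dl ^+ 2 * L ^+ 2 by exact: exprMn.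
rewrite dl2.
clearbody L; move: (X n)^-1 => x.
by rewrite le_eqVlt; apply/orP; left; apply/eqP; ring.
Qed.

End nonparametric.

(** * Frequencies of logarithmic order *)

Section log_choice.
Context (R : realType).
Implicit Types (l m z u C G P : R).

Lemma gt0_powRE u z : 0 < u -> u `^ z = expR (z * ln u).
Proof. by move=> u0; rewrite /powR gt_eqF. Qed.

Lemma powR_comparable l C G z : 1 <= C -> 0 < l -> l / C <= G <= C * l ->
  C `^ (- `|z|) * l `^ z <= G `^ z <= C `^ `|z| * l `^ z.
Proof.
move=> C1 l0 /andP[G1 G2]; have C0 : 0 < C by apply: lt_le_trans C1.
have G0 : 0 < G by apply: lt_le_trans G1; exact: divr_gt0.
rewrite !gt0_powRE// -!expRD !ler_expR.
have L1 : ln G - ln l <= ln C by rewrite lerBlDr -lnM// ler_ln// posrE mulr_gt0.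
have L2 : - ln C <= ln G - ln l.
  by rewrite lerBrDr -lerBrDl opprK -lerBlDr -ln_div// ler_ln// posrE divr_gt0.
have : `|z * (ln G - ln l)| <= `|z| * ln C.
  by rewrite normrM; apply: ler_wpM2l => //; rewrite ler_norml L2 L1.
rewrite ler_norml mulrBr lerBrDr lerBlDr => /andP[h1 h2].
by rewrite mulNr h1 h2.
Qed.

Lemma sublinear_log (A B C : R) : 0 <= A -> 0 <= B -> 0 < C ->
  exists2 l0 : R, 1 <= l0 & forall l, l0 <= l -> A * ln l + B <= C * l.
Proof.
move=> A0 B0 C0; pose q := (2 * A + B) / C.
have q0 : 0 <= q by rewrite divr_ge0 ?(ltW C0)// addr_ge0// mulr_ge0.
exists (Num.max 1 (q ^+ 2)); first by rewrite le_max lexx.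
move=> l; rewrite ge_max => /andP[l1 lq].
have l0 : 0 < l by apply: lt_le_trans l1.
have s1 : 1 <= Num.sqrt l by rewrite -sqrtr1 ler_wsqrtr.
have sq : q <= Num.sqrt l by rewrite -(ger0_norm q0) -sqrtr_sqr ler_wsqrtr.
have lE : l = Num.sqrt l ^+ 2 by rewrite sqr_sqrtr// ltW.
have h2 : 0 < (2^-1 : R) by rewrite invr_gt0.
have hl : ln l <= 2 * Num.sqrt l.
  have := ln_le_powR l0 h2; rewrite invrK => /le_trans; apply.
  apply: ler_wpM2l => //.
  by rewrite {1}lE -powR_mulrn ?sqrtr_ge0// -powRrM mulfV// powRr1// sqrtr_ge0.
apply: (@le_trans _ _ ((2 * A + B) * Num.sqrt l)).
  rewrite mulrDl; apply: lerD; last by rewrite ler_peMr.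
  by rewrite (mulrC 2) -mulrA; apply: ler_wpM2l.
rewrite [in leRHS]lE expr2 mulrA; apply: ler_wpM2r; first exact: sqrtr_ge0.
by rewrite [leRHS]mulrC -ler_pdivrMr.
Qed.

(** The leading term of m^beta balances exp(nu l) against the decay of the noise, and the term in ln
    l cancels the polynomial factor m^P, of order l^(P / beta). For large l the correction is at
    most nu l / 2 in absolute value, so m^beta stays comparable to l. *)
Lemma log_choice (nu beta gamma P k M : R) : 0 < nu -> 0 < beta -> 0 < gamma -> 0 < k ->
  exists kappa C l0 : R, [/\ 1 <= C, 1 <= l0 & forall l, l0 <= l ->
  exists m, [/\ M <= m, 0 < m, m `^ beta = (nu * l + P / beta * ln l + kappa) / (2 * gamma),
    l / C <= m `^ beta <= C * l &
    expR (nu * l) * (m `^ P * expR (- (2 * gamma * m `^ beta))) <= k]].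
Proof.
move=> nu0 be0 ga0 k0; pose z := P / beta.
pose C := Num.max 1 (Num.max (4 * gamma / nu) (nu / gamma)).
have C1 : 1 <= C by rewrite le_max lexx.
have C0 : 0 < C by apply: lt_le_trans C1.
have C2 : 4 * gamma / nu <= C by rewrite !le_max lexx orbT.
have C3 : nu / gamma <= C by rewrite !le_max lexx !orbT.
(* It absorbs both the constant lost in replacing m^P by l^z and the target k, so that the final
   product is at most exp (ln k). *)
pose kappa := `|z| * ln C - ln k.
have [l1 l11 hl1] := sublinear_log (normr_ge0 z) (normr_ge0 kappa) (divr_gt0 nu0 (ltr0Sn R 1)).
pose M1 := Num.max M 1.
exists kappa, C, (Num.max l1 (C * M1 `^ beta)); split => //.
  by rewrite le_max l11.
move=> l; rewrite ge_max => /andP[ll1 lM].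
have l_1 : 1 <= l by apply: le_trans ll1.
have l_0 : 0 < l by apply: lt_le_trans l_1.
have lnl : 0 <= ln l by rewrite ln_ge0.
have hl := hl1 l ll1.
have zl : `|z * ln l + kappa| <= nu / 2 * l.
  apply: le_trans (ler_normD _ _) _; apply: le_trans hl.
  by rewrite lerD2r normrM (ger0_norm lnl).
pose G := (nu * l + z * ln l + kappa) / (2 * gamma).
have G1 : nu * l / (4 * gamma) <= G.
  rewrite /G ler_pdivlMr ?mulr_gt0//.
  rewrite (_ : nu * l / (4 * gamma) * (2 * gamma) = nu * l / 2); last by field; rewrite gt_eqF.
  move: zl; rewrite ler_norml => /andP[h _].
  by rewrite -addrA; move: (z * ln l + kappa) h => q h; lra.
have G2 : G <= nu * l / gamma.
  rewrite /G ler_pdivrMr ?mulr_gt0//.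
  rewrite (_ : nu * l / gamma * (2 * gamma) = 2 * (nu * l)); last by field; rewrite gt_eqF.
  move: zl; rewrite ler_norml => /andP[_ h].
  have nl : 0 < nu * l by exact: mulr_gt0.
  by rewrite -addrA; move: (z * ln l + kappa) h => q h; lra.
have G0 : 0 < G.
  by apply: lt_le_trans G1; rewrite divr_gt0 ?mulr_gt0.
have lG : l / C <= G <= C * l.
  apply/andP; split.
    apply: le_trans G1; rewrite ler_pdivrMr// mulrAC ler_pdivlMr ?mulr_gt0//.
    move: C2; rewrite ler_pdivrMr// => C2.
    rewrite (_ : nu * l * C = l * (C * nu)); last by ring.
    by apply: ler_wpM2l => //; exact: ltW.
  apply: le_trans G2 _; rewrite mulrAC; apply: ler_wpM2r => //; exact: ltW.
pose m := G `^ (beta^-1).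
have mG : m `^ beta = G by rewrite /m -powRrM mulVf ?gt_eqF// powRr1// ltW.
have m0 : 0 < m by exact: powR_gt0.
have MG : M1 `^ beta <= G.
  have /andP[h _] := lG; apply: le_trans h.
  by rewrite ler_pdivlMr// mulrC.
exists m; split => //; last 2 first.
- by rewrite mG.
- have mP : m `^ P = G `^ z by rewrite /m -powRrM mulrC.
  have /andP[_ hz] := powR_comparable z C1 l_0 lG.
  rewrite mG mP (_ : 2 * gamma * G = nu * l + z * ln l + kappa); last first.
    by rewrite /G mulrC divfK// gt_eqF// mulr_gt0.
  rewrite mulrCA -expRD (_ : nu * l - _ = - (z * ln l + kappa)); last by ring.
  apply: le_trans (ler_wpM2r (expR_ge0 _) hz) _.
  rewrite !gt0_powRE// -!expRD /kappa.
  rewrite (_ : _ + _ = ln k); last by ring.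
  by rewrite lnK.
- have M10 : 0 < M1 by rewrite lt_max ltr01 orbT.
  apply: (@le_trans _ _ M1); first by rewrite le_max lexx.
  have -> : M1 = (M1 `^ beta) `^ beta^-1 by rewrite -powRrM mulfV ?gt_eqF// powRr1// ltW.
  by apply: ge0_ler_powR; rewrite ?nnegrE ?invr_ge0 ?powR_ge0 ?(ltW G0) ?(ltW be0).
Qed.

Lemma powR_increment (A0 r eta : R) : 0 < A0 -> 0 <= r -> 0 <= eta <= 1 ->
  (A0 + r) `^ (1 - eta) <= A0 `^ (1 - eta) + r * A0 `^ (- eta).
Proof.
move=> A00 r0 /andP[e0 e1].
have t0 : 0 <= r / A0 by rewrite divr_ge0// ltW.
have -> : A0 + r = A0 * (1 + r / A0) by rewrite mulrDr mulr1 mulrC divfK// gt_eqF.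
rewrite powRM ?(ltW A00)// ?addr_ge0//.
have h : (1 + r / A0) `^ (1 - eta) <= 1 + r / A0.
  rewrite -[leRHS]powRr1 ?addr_ge0//; apply: ler_powR; first by rewrite lerDl.
  by rewrite gerBl.
apply: le_trans (ler_wpM2l (powR_ge0 _ _) h) _.
rewrite mulrDr mulr1 lerD2l gt0_powRD// powRr1 ?(ltW A00)//.
rewrite (_ : _ * _ * _ = r * A0 `^ (- eta) * (A0 / A0)); last by ring.
by rewrite mulfV ?gt_eqF// mulr1.
Qed.

End log_choice.

(** * Rates obtained by solving for the frequency *)

Section cases.
Context (R : realType) (rk : nat -> \bar R) (X : nat -> R) (ok : nat -> Prop)
  (nu k C M P Q alpha beta gamma a b d : R).
Hypotheses (nu0 : 0 < nu) (k0 : 0 < k) (C0 : 0 < C) (M1 : 1 <= M) (d0 : 0 <= d) (b0 : 0 <= b).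
Hypothesis ok0 : forall n, ok n -> (0 < n)%N.
Hypothesis XE : forall n, ok n -> X n = expR (nu * ln n%:R).
Hypothesis NP : forall n m, ok n -> M <= m ->
  X n * (m `^ P * expR (- (2 * gamma * m `^ beta))) <= k ->
  ((C * (m `^ Q * expR (- (2 * d * m `^ b))))%:E <= rk n)%E.

Definition eventually_above (E : nat -> R) := exists c l : R, 0 < c /\
  forall n, ok n -> l <= ln n%:R -> ((c * E n)%:E <= rk n)%E.

Lemma log_lower : 0 < beta -> 0 < gamma -> exists kappa c l0 : R, [/\ 0 < c, 1 <= l0 &
  forall n, ok n -> l0 <= ln n%:R -> exists m, [/\ 0 < m,
    m `^ beta = (nu * ln n%:R + P / beta * ln (ln n%:R) + kappa) / (2 * gamma) &
    ((c * (ln n%:R `^ (Q / beta) * expR (- (2 * d * m `^ b))))%:E <= rk n)%E]].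
Proof.
move=> be0 ga0; have [kappa [Z [l0 [Z1 l01 h]]]] := log_choice P M nu0 be0 ga0 k0.
have Z0 : 0 < Z by apply: lt_le_trans Z1.
exists kappa, (C * Z `^ (- `|Q / beta|)), l0; split => //.
  by rewrite mulr_gt0// powR_gt0.
move=> n okn ln0; have [m [Mm m0 mE mZ mk]] := h _ ln0; exists m; split => //.
rewrite -XE// in mk; apply: le_trans (NP okn Mm mk); rewrite lee_fin -mulrA.
apply: ler_wpM2l; first exact: ltW.
rewrite mulrA; apply: ler_wpM2r; first exact: expR_ge0.
have -> : m `^ Q = (m `^ beta) `^ (Q / beta).
  by rewrite -powRrM mulrC divfK// gt_eqF.
have l0' : 0 < ln (n%:R : R) by apply: lt_le_trans ln0; apply: lt_le_trans l01.
by have /andP[] := powR_comparable (Q / beta) Z1 l0' mZ.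
Qed.

(** Here exp(-2 d m^b) equals exp(-2 gamma m^beta) to the power d / gamma. The leading term of
    m^beta becomes a power of n, and its logarithmic correction a power of log n, which shifts the
    exponent Q by -P d / gamma. *)
Lemma case_equal U : 0 < beta -> 0 < gamma -> b = beta -> - U <= Q - P * (d / gamma) ->
  eventually_above (fun n => ln n%:R `^ (- (U / beta)) * n%:R `^ (- (d * nu / gamma))).
Proof.
move=> be0 ga0 bb hU; have [kappa [c [l0 [c0 l01 h]]]] := log_lower be0 ga0.
exists (c * expR (- (d / gamma * kappa))), l0; split; first by rewrite mulr_gt0// expR_gt0.
move=> n okn ln0; have [m [m0 mE hm]] := h n okn ln0.
apply: le_trans hm; rewrite lee_fin -mulrA; apply: ler_wpM2l; first exact: ltW.
have n0 : 0 < n%:R :> R by rewrite ltr0n ok0.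
have ln1 : 1 <= ln (n%:R : R) by apply: le_trans ln0.
have l_0 : 0 < ln (n%:R : R) by apply: lt_le_trans ln1.
rewrite bb mE !gt0_powRE// -!expRD ler_expR.
set l := ln _ in ln1 l_0 *.
have -> : 2 * d * ((nu * l + P / beta * ln l + kappa) / (2 * gamma)) =
    d / gamma * nu * l + P / beta * (d / gamma) * ln l + d / gamma * kappa.
  by field; rewrite !gt_eqF.
have -> : d * nu / gamma = d / gamma * nu by ring.
have : - (U / beta) * ln l <= (Q / beta - P / beta * (d / gamma)) * ln l.
  apply: ler_wpM2r; first by rewrite ln_ge0.
  rewrite -mulNr (_ : _ - _ = (Q - P * (d / gamma)) / beta); last by ring.
  by apply: ler_wpM2r hU; rewrite invr_ge0 ltW.
move: (U / beta) (Q / beta) (P / beta * (d / gamma)) (d / gamma) (ln l) => u q p v ll hh.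
by lra.
Qed.

(** For b < beta the logarithmic correction to m^beta changes m^b by a bounded amount only, since ln
    l times l^(b / beta - 1) is bounded. It is absorbed in the constant, so P has no influence on
    the rate. *)
Lemma case_below U : 0 < beta -> 0 < gamma -> b < beta -> - U <= Q ->
  eventually_above (fun n => ln n%:R `^ (- (U / beta)) *
    expR (- 2 * d * (nu * ln n%:R / (2 * gamma)) `^ (b / beta))).
Proof.
move=> be0 ga0 bb hU; have [kappa [c [l0 [c0 l01 h]]]] := log_lower be0 ga0.
pose eta := 1 - b / beta.
have b1 : b / beta < 1 by rewrite ltr_pdivrMr// mul1r.
have bge : 0 <= b / beta by rewrite divr_ge0// ltW.
have et0 : 0 < eta by rewrite subr_gt0.
have et01 : 0 <= eta <= 1 by rewrite (ltW et0) gerBl.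
pose z := `|P / beta|.
pose D := (z / eta + `|kappa|) / (2 * gamma) * (nu / (2 * gamma)) `^ (- eta).
exists (c * expR (- (2 * d * D))), l0; split; first by rewrite mulr_gt0// expR_gt0.
move=> n okn ln0; have [m [m0 mE hm]] := h n okn ln0.
apply: le_trans hm; rewrite lee_fin -mulrA; apply: ler_wpM2l; first exact: ltW.
have ln1 : 1 <= ln (n%:R : R) by apply: le_trans ln0.
have l_0 : 0 < ln (n%:R : R) by apply: lt_le_trans ln1.
set l := ln _ in ln1 l_0 mE *.
have lnl : 0 <= ln l by rewrite ln_ge0.
have g2 : 0 < 2 * gamma by rewrite mulr_gt0.
pose A0 := nu * l / (2 * gamma).
have A00 : 0 < A0 by rewrite divr_gt0// mulr_gt0.
pose r := (z * ln l + `|kappa|) / (2 * gamma).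
have r0 : 0 <= r by rewrite divr_ge0 ?(ltW g2)// addr_ge0// mulr_ge0// /z.
have mr : m `^ beta <= A0 + r.
  rewrite mE -mulrDl; apply: ler_wpM2r; first by rewrite invr_ge0 ltW.
  rewrite -addrA lerD2l; apply: lerD; last exact: ler_norm.
  by apply: ler_wpM2r => //; exact: ler_norm.
have ee : 1 - eta = b / beta by rewrite /eta opprB addrC subrK.
have mb : m `^ b <= A0 `^ (b / beta) + D.
  have -> : m `^ b = (m `^ beta) `^ (b / beta) by rewrite -powRrM mulrC divfK// gt_eqF.
  apply: (@le_trans _ _ ((A0 + r) `^ (b / beta))).
    by apply: ge0_ler_powR; rewrite ?nnegrE ?powR_ge0 ?addr_ge0 ?(ltW A00).
  rewrite -ee; apply: le_trans (powR_increment A00 r0 et01) _; rewrite lerD2l.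
  have -> : A0 `^ (- eta) = (nu / (2 * gamma)) `^ (- eta) * l `^ (- eta).
    rewrite -powRM ?(ltW l_0)//; last by rewrite divr_ge0 ?(ltW nu0) ?(ltW g2).
    by rewrite /A0 mulrAC.
  rewrite mulrCA /D mulrC; apply: ler_wpM2r; first exact: powR_ge0.
  rewrite /r mulrAC; apply: ler_wpM2r; first by rewrite invr_ge0 ltW.
  have le1 : l `^ (- eta) <= 1.
    by rewrite -[leRHS](powRr0 l); apply: ler_powR => //; rewrite oppr_le0 ltW.
  rewrite mulrDl; apply: lerD; last by rewrite ler_piMr.
  rewrite -mulrA; apply: ler_wpM2l; first exact: normr_ge0.
  apply: le_trans (ler_wpM2r (powR_ge0 _ _) (ln_le_powR l_0 et0)) _.
  by rewrite -mulrA -gt0_powRD// subrr powRr0 mulr1.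
rewrite mulrCA; apply: ler_pM; rewrite ?powR_ge0 ?mulr_ge0 ?expR_ge0//.
  apply: ler_powR => //; rewrite -mulNr; apply: ler_wpM2r hU.
  by rewrite invr_ge0 ltW.
rewrite -expRD ler_expR -/A0.
have d2 : 0 <= 2 * d by rewrite mulr_ge0.
have := ler_wpM2l d2 mb.
rewrite mulrDr -lerN2 opprD addrC => /(le_trans _); apply.
by rewrite mulNr mulNr.
Qed.

(** Without exponential factors the constraint X n m^P <= k is solved with equality by m = (k / X
    n)^(1 / P), which tends to infinity because P < 0. *)
Lemma case_algebraic : gamma = 0 -> d = 0 -> P < 0 ->
  eventually_above (fun n => n%:R `^ (- (nu * Q / P))).
Proof.
move=> ga0 dd P0; have Pn : 0 < - P by rewrite oppr_gt0.
exists (C * k `^ (Q / P)), ((ln k - P * ln M) / nu); split; first by rewrite mulr_gt0// powR_gt0.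
move=> n okn ln0; have n0 : 0 < n%:R :> R by rewrite ltr0n ok0.
pose m := expR ((ln k - nu * ln n%:R) / P).
have M0 : 0 < M by apply: lt_le_trans M1.
have Mm : M <= m.
  rewrite -[leLHS]lnK// ler_expR; move: ln0; rewrite ler_pdivrMr// => h.
  rewrite ler_ndivlMr//; lra.
have m0 : 0 < m by exact: expR_gt0.
have mP z : m `^ z = expR (z / P * (ln k - nu * ln n%:R)).
  by rewrite gt0_powRE// /m expRK; congr expR; ring.
have mk : X n * (m `^ P * expR (- (2 * gamma * m `^ beta))) <= k.
  rewrite ga0 mulr0 mul0r oppr0 expR0 mulr1 XE// mP divff ?lt_eqF// mul1r -expRD.
  by rewrite addrC subrK lnK.
apply: le_trans (NP okn Mm mk); rewrite lee_fin -mulrA; apply: ler_wpM2l; first exact: ltW.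
rewrite dd mulr0 mul0r oppr0 expR0 mulr1 mP !gt0_powRE// -expRD.
by rewrite le_eqVlt; apply/orP; left; apply/eqP; congr expR; ring.
Qed.

End cases.

(** * Comparison with the stated logarithmic exponents *)

Section exponents.
Context (R : realType).

(** The difference of the two sides is A - (d / gamma) Z with 0 <= d / gamma <= 1, so 0 <= A and Z
    <= A suffice. Of the two bounds on Utau, the first gives Z <= A when tau is the larger of e and
    tau, the second when e is. *)
Lemma exponent_equal (K tau alpha beta gamma a d s Utau e f : R) :
  e = Num.max 0 (beta - 1) -> f = Num.max 0 (1 - beta) ->
  0 <= K -> 0 <= tau -> 0 < beta -> 0 <= d -> d <= gamma -> 0 < gamma ->
  Utau <= beta * (4 * K + 3) - 2 * tau * K - 1 ->
  Utau <= beta * (2 * K + 3) + 2 * K - 1 ->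
  - (2 * a + 2 * s * (1 - d / gamma) - 2 * d * alpha / gamma
                + 4 * beta * (K + 1) - (Utau + 1) * d / gamma - 1) <=
  (- 2 * s - 2 * a + f - 2 * e) -
  (- 2 * s - 2 * alpha + 2 * (Num.max e tau * K) - e) * (d / gamma).
Proof.
move=> eE fE K0 tau0 be0 d0 dg ga0 U1 U2.
pose de := d / gamma; have de0 : 0 <= de by rewrite divr_ge0// ltW.
have de1 : de <= 1 by rewrite ler_pdivrMr// mul1r.
pose A := f - 2 * e - 1 + 4 * beta * (K + 1).
pose Z := 2 * (Num.max e tau * K) + Utau + 1 - e.
suff [A0 ZA] : 0 <= A /\ Z <= A.
  have h : de * Z <= A.
    have [Zp|Zn] := leP 0 Z; first by apply: le_trans ZA; rewrite ler_piMl.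
    by apply: le_trans A0; rewrite mulr_ge0_le0// ltW.
  rewrite -subr_ge0.
  rewrite (_ : _ - _ = A - de * Z) ?subr_ge0//.
  rewrite /A /Z /de; set h' := Num.max e tau; clearbody h'.
  by field; rewrite gt_eqF.
have bK : 0 <= beta * K by rewrite mulr_ge0// ltW.
rewrite /A /Z eE fE; have [b1|b1] := leP beta 1.
  have h1 : beta - 1 <= 0 by rewrite subr_le0.
  have h2 : 0 <= 1 - beta by rewrite subr_ge0.
  rewrite (max_l h1) (max_r h2) (max_r tau0); split; lra.
have h1 : 0 <= beta - 1 by rewrite subr_ge0 ltW.
have h2 : 1 - beta <= 0 by rewrite subr_le0 ltW.
rewrite (max_r h1) (max_l h2); split; first lra.
by have [t1|t1] := leP (beta - 1) tau; lra.
Qed.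

Lemma exponent_below (K b a s : R) : 0 <= K -> 0 <= b ->
  - (4 * b * (K + 1) + 2 * a + 2 * s - 1) <=
  - 2 * s - 2 * a + Num.max 0 (1 - b) - 2 * Num.max 0 (b - 1).
Proof.
move=> K0 b0; have bK : 0 <= b * K by rewrite mulr_ge0.
have [b1|b1] := leP b 1.
  have h1 : b - 1 <= 0 by rewrite subr_le0.
  have h2 : 0 <= 1 - b by rewrite subr_ge0.
  by rewrite (max_l h1) (max_r h2); lra.
have h1 : 0 <= b - 1 by rewrite subr_ge0 ltW.
have h2 : 1 - b <= 0 by rewrite subr_le0 ltW.
by rewrite (max_r h1) (max_l h2); lra.
Qed.

End exponents.

(** * Assembly of the seven cases for large n *)

Section limits.
Context (R : realType).

Lemma ln_nat_near (l : R) : \forall n \near \oo, (0 < n)%N /\ l <= ln n%:R.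
Proof.
have h := @nbhs_infty_ger R (expR l).
apply: filterS h => n h.
have n0 : 0 < n%:R :> R by apply: lt_le_trans h; exact: expR_gt0.
by split; [rewrite -(@ltr0n R)|rewrite -(expRK l) ler_ln// posrE expR_gt0].
Qed.

(** One constant must serve all cases. The bound is therefore kept for every smaller constant, so
    that a minimum can be taken, and a case whose hypothesis H fails contributes the constant 1. *)
Lemma near_case (rk : nat -> \bar R) (ok : nat -> Prop) (H : Prop) (E : nat -> R) :
  (forall l : R, \forall n \near \oo, ok n /\ l <= ln n%:R) -> (forall n, 0 <= E n) ->
  (H -> eventually_above rk ok E) ->
  exists C : R, 0 < C /\ forall c, c <= C -> \forall n \near \oo, H -> ((c * E n)%:E <= rk n)%E.
Proof.
move=> hok E0 hE; have [h|nh] := pselect H; last first.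
  by exists 1; split => // c _; apply: nearW => n /nh.
have [C [l [C0 hC]]] := hE h; exists C; split => // c cC.
apply: filterS (hok l) => n [okn ln] _.
by apply: le_trans (hC n okn ln); rewrite lee_fin ler_wpM2r.
Qed.

End limits.

Local Open Scope complex_scope.

Theorem theorem8 (R : realType) (nu s B : R) (mu : nat -> {i01 R})
  (g : pdf R) (c1 varsigma : R) (varsigma0 : nat)
  (phi : R -> R) (phis : R -> R[i])
  (Cg2 Cphi1 alpha beta gamma a b d : R) (c2 tau : R)
  (omega0 : R) (rho : R -> R) (rhobar : R)
  (hnu : 1 / 2 < nu < 1) (hs : 0 <= s) (hB : 0 < B)
  (hmu : forall n : nat, (0 < n)%N -> (mu n)%:num = n%:R `^ (nu - 1))
  (hphi : is_fourier phi phis)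
  (hparseval : forall f0 : pdf R, Omega s B f0 -> parseval_at phi phis f0)
  (hgbounded : exists M : R, forall x, g x <= M)
  (hc1 : 0 < c1)
  (hglower : forall x, c1 * (x ^+ 2 + 1) `^ (- varsigma) <= `|g x|)
  (hvarsigma0 : Num.ceil varsigma = varsigma0%:Z)
  (hCg2 : 0 < Cg2) (hCphi1 : 0 < Cphi1)
  (halpha : 0 <= alpha) (hbeta : 0 <= beta) (hgamma : 0 <= gamma)
  (ha : 0 <= a) (hb : 0 <= b) (hd : 0 <= d)
  (hgamma0 : gamma = 0 -> 0 < alpha /\ beta = 0)
  (hd0 : d = 0 -> b = 0)
  (hgs : forall w, ComplexField.Normc.normc (fourier g w) <=
     Cg2 * (w ^+ 2 + 1) `^ (- (alpha / 2)) * expR (- (gamma * `|w| `^ beta)))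
  (hphis : forall w,
     Cphi1 * (w ^+ 2 + 1) `^ (- (a / 2)) * expR (- (d * `|w| `^ b)) <=
     ComplexField.Normc.normc (phis w))
  (hgsCk_Re : Ck_on varsigma0 setT (fun w => complex.Re (fourier g w)))
  (hgsCk_Im : Ck_on varsigma0 setT (fun w => complex.Im (fourier g w)))
  (hc2 : 0 < c2) (htau : 0 <= tau) (htau0 : gamma = 0 -> tau = 0)
  (hgsderiv : forall l : nat, (1 <= l <= varsigma0)%N -> forall w,
     ComplexField.Normc.normc (cderiv1n l (fourier g) w) <=
     c2 * ComplexField.Normc.normc (fourier g w) *
       (1 + `|w|) `^ (tau * l%:R))
  (homega0 : 0 < omega0)
  (harg : forall w, omega0 <= `|w| ->
     phis w = (ComplexField.Normc.normc (phis w))%:C *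
              (cos (rho w) +i* sin (rho w)))
  (hrhoCk : Ck_on varsigma0 [set w | omega0 <= `|w|] rho)
  (hrhobound : forall (j : nat) w, (j <= varsigma0)%N -> omega0 <= `|w| ->
     `|derive1n j rho w| <= rhobar) :
  let vs0 : R := varsigma0%:R in
  let Utau : R := Num.min (beta * (4 * vs0 + 3) - 2 * tau * vs0 - 1)
                          (beta * (2 * vs0 + 3) + 2 * vs0 - 1) in
  let U5 : R := 2 * a + 2 * s * (1 - d / gamma) - 2 * d * alpha / gamma
                + 4 * beta * (vs0 + 1) - (Utau + 1) * d / gamma - 1 in
  let U6 : R := 4 * b * (vs0 + 1) + 2 * a + 2 * s - 1 in
  let risk (n : nat) : \bar R := minimax_risk g phi (Omega s B) (mu n) n in
  exists C : R, 0 < C /\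
  \forall n \near \oo,
    (beta < b ->
       ((C * n%:R `^ (- (2 * nu - 1)))%:E <= risk n)%E) /\
    (b = beta /\ gamma < d /\ 0 < gamma ->
       ((C * n%:R `^ (- (2 * nu - 1)))%:E <= risk n)%E) /\
    (b = beta /\ d = gamma /\ alpha + 1 / 2 <= a ->
       ((C * n%:R `^ (- (2 * nu - 1)))%:E <= risk n)%E) /\
    (d = 0 /\ gamma = 0 /\ a < alpha + 1 / 2 ->
       ((C * n%:R `^ (- ((2 * nu - 1) * (2 * s + 2 * a - 1)
                          / (2 * s + 2 * alpha))))%:E <= risk n)%E) /\
    (b = beta /\ 0 < beta /\ d < gamma /\ 0 < d ->
       ((C * (ln n%:R) `^ (- (U5 / beta))
           * n%:R `^ (- (d * (2 * nu - 1) / gamma)))%:E <= risk n)%E) /\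
    (b < beta /\ 0 < d /\ 0 < gamma ->
       ((C * (ln n%:R) `^ (- (U6 / beta))
           * expR (- 2 * d * ((2 * nu - 1) * ln n%:R / (2 * gamma))
                               `^ (b / beta)))%:E <= risk n)%E) /\
    (b = 0 /\ d = 0 /\ 0 < beta /\ 0 < gamma ->
       ((C * (ln n%:R) `^ (- ((2 * s + 2 * a - 1) / beta)))%:E
          <= risk n)%E).

Proof.
move=> vs0 Utau U5 U6 risk.
have /andP[nu1 nu2] := hnu.
pose nu' := 2 * nu - 1.
have nu'0 : 0 < nu' by rewrite /nu'; lra.
have [w0 [k [c [/andP[w00 _] k0 c0 RL]]]] := risk_lower mu hs hB hphi hparseval hgbounded
  hc1 hglower hvarsigma0 hCg2 hCphi1 halpha hbeta hgamma ha hd hgs hphis hgsCk_Re hgsCk_Im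
  hc2 htau hgsderiv homega0 harg hrhoCk hrhobound.
pose ok n := (0 < n)%N /\ (mu n)%:num <= 1 / 2.
pose X n := n%:R * (mu n)%:num ^+ 2.
have ok0 n : ok n -> (0 < n)%N by case.
have X0 n : 0 <= X n by rewrite mulr_ge0// sqr_ge0.
(* The effective sample size n mu_n^2 is n^(2 nu - 1): hence nu' replaces nu in all rates. *)
have XE n : ok n -> X n = expR (nu' * ln n%:R).
  move=> [n0 _]; have nR : 0 < n%:R :> R by rewrite ltr0n.
  rewrite /X hmu// gt0_powRE// -expRM_natl -{1}(lnK nR) -expRD.
  by congr expR; rewrite /nu'; ring.
(* As mu_n = n^(nu - 1), the condition mu_n <= 1/2 amounts to ln n >= ln 2 / (1 - nu). *)
have okn (l : R) : \forall n \near \oo, ok n /\ l <= ln n%:R.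
  have h := ln_nat_near (Num.max l (ln 2 / (1 - nu))).
  apply: filterS h => n [n0]; rewrite ge_max => /andP[ln1 ln2]; split => //; split => //.
  have nR : 0 < n%:R :> R by rewrite ltr0n.
  rewrite hmu// gt0_powRE// div1r -[leRHS]lnK ?posrE ?invr_gt0// ler_expR lnV ?posrE//.
  by move: ln2; rewrite ler_pdivrMr ?subr_gt0//; move: (ln 2) (ln n%:R) => x y; lra.
have RL' n N w m dl D (hn : ok n) := RL n N w m dl D hn.1 hn.2.
have [Cp Cp0 hP] := parametric_bound w00 k0 c0 hb X0 RL'.
have [k' [Cn [M0 [k'0 Cn0 M01 NP]]]] := nonparametric_bound w00 k0 c0 hs hb X0 RL'.
have K0 : 0 <= vs0 by rewrite ler0n.
(* The parametric bound holds unconditionally and serves the first three cases at once. *)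
have [C1 [C10 h1]] : exists C : R, 0 < C /\ forall c, c <= C -> \forall n \near \oo, True ->
    ((c * n%:R `^ (- (2 * nu - 1)))%:E <= risk n)%E.
  apply: (near_case okn) => [n|_]; first exact: powR_ge0.
  exists Cp, 0; split => // n on ln0; have nR : 0 < n%:R :> R by rewrite ltr0n ok0.
  rewrite gt0_powRE// mulNr expRN -XE//; apply: hP => //.
  by rewrite XE// -[leLHS]expR0 ler_expR mulr_ge0// ltW.
have [C4 [C40 h4]] : exists C : R, 0 < C /\ forall c, c <= C -> \forall n \near \oo,
    (d = 0 /\ gamma = 0 /\ a < alpha + 1 / 2) ->
    ((c * n%:R `^ (- ((2 * nu - 1) * (2 * s + 2 * a - 1) / (2 * s + 2 * alpha))))%:E <= risk n)%E.
  apply: (near_case okn) => [n|[dd [ga0 _]]]; first exact: powR_ge0.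
  have [al0 be0] := hgamma0 ga0; have bb := hd0 dd; have tt := htau0 ga0.
  (* With b = tau = 0 one has e = h = 0 and f = 1: m windows of constant width, up to rounding,
     which is where the -1 in 2 s + 2 a - 1 comes from. *)
  move: NP; rewrite bb tt sub0r subr0 (max_l (lerN10 R)) (max_r (@ler01 R)) maxxx mul0r => NP.
  have sal : 0 < 2 * s + 2 * alpha by apply: ltr_wpDl; [exact: mulr_ge0|exact: mulr_gt0].
  have := case_algebraic nu'0 k'0 Cn0 M01 ok0 XE NP ga0 dd.
  set e1 := nu' * _ / _; rewrite (_ : e1 = (2 * nu - 1) * (2 * s + 2 * a - 1) / (2 * s + 2 * alpha)).
    apply; lra.
  rewrite /e1 /nu'; set q := 2 * s + 2 * alpha in sal *.
  rewrite (_ : - 2 * s - 2 * alpha + 2 * 0 - 0 = - q); last by rewrite /q; ring.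
  by field; rewrite gt_eqF.
have [C5 [C50 h5]] : exists C : R, 0 < C /\ forall c, c <= C -> \forall n \near \oo,
    (b = beta /\ 0 < beta /\ d < gamma /\ 0 < d) ->
    ((c * ((ln n%:R) `^ (- (U5 / beta)) * n%:R `^ (- (d * (2 * nu - 1) / gamma))))%:E <= risk n)%E.
  apply: (near_case okn) => [n|[bb [be0 [dg dp]]]]; first by rewrite mulr_ge0 ?powR_ge0.
  have ga0 := lt_trans dp dg.
  apply: (case_equal nu'0 k'0 Cn0 ok0 XE NP) => //.
  apply: exponent_equal => //.
  - by rewrite bb.
  - by rewrite bb.
  - exact: ltW.
  - by rewrite /Utau ge_min lexx.
  - by rewrite /Utau ge_min lexx orbT.
have [C6 [C60 h6]] : exists C : R, 0 < C /\ forall c, c <= C -> \forall n \near \oo,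
    (b < beta /\ 0 < d /\ 0 < gamma) ->
    ((c * ((ln n%:R) `^ (- (U6 / beta)) *
      expR (- 2 * d * ((2 * nu - 1) * ln n%:R / (2 * gamma)) `^ (b / beta))))%:E <= risk n)%E.
  apply: (near_case okn) => [n|[bb [dp ga0]]]; first by rewrite mulr_ge0 ?powR_ge0 ?expR_ge0.
  have be0 : 0 < beta by apply: le_lt_trans bb.
  apply: (case_below nu'0 k'0 Cn0 hd hb XE NP) => //.
  exact: exponent_below.
have [C7 [C70 h7]] : exists C : R, 0 < C /\ forall c, c <= C -> \forall n \near \oo,
    (b = 0 /\ d = 0 /\ 0 < beta /\ 0 < gamma) ->
    ((c * (ln n%:R) `^ (- ((2 * s + 2 * a - 1) / beta)))%:E <= risk n)%E.
  apply: (near_case okn) => [n|[bb [dd [be0 ga0]]]]; first exact: powR_ge0.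
  have bbe : b < beta by rewrite bb.
  (* The last case is [case_below] with b = d = 0: the exponential factor is 1, and f = 1 makes the
     exponent exact. *)
  have [] := case_below (U := 2 * s + 2 * a - 1) nu'0 k'0 Cn0 hd hb XE NP be0 ga0 bbe.
    rewrite bb sub0r subr0 (max_l (lerN10 R)) (max_r (@ler01 R)); lra.
  move=> C [l [C0 h]]; exists C, l; split => // n on ln0; have := h n on ln0.
  by rewrite dd mulr0 mul0r expR0 mulr1.
pose C := Num.min C1 (Num.min C4 (Num.min C5 (Num.min C6 C7))).
have [CC1 CC4 CC5 CC6 CC7] : [/\ C <= C1, C <= C4, C <= C5, C <= C6 & C <= C7].
  by rewrite /C !ge_min !lexx ?orbT.
exists C; split; first by rewrite /C !lt_min C10 C40 C50 C60 C70.
have near_and := fun P Q : nat -> Prop => @filterI _ \oo eventually_filter P Q.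
have := near_and _ _ (h1 C CC1) (near_and _ _ (h4 C CC4)
  (near_and _ _ (h5 C CC5) (near_and _ _ (h6 C CC6) (h7 C CC7)))).
apply: (@filterS _ \oo eventually_filter) => n [r1 [r4 [r5 [r6 r7]]]].
do 6![split; first by move=> H; rewrite -?[X in X%:E]mulrA; first [exact: r1|exact: r4|exact: r5|exact: r6]].
exact: r7.
Qed.
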